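(* Let $k$ be an algebraically closed field and let $G$ be a finite abelian group with $\operatorname{char}(k)\nmid |G|$. Let $A=\bigoplus_{n\in\mathbb{N}}A_n$ be a noetherian connected graded $k$-algebra on which $G$ acts by $\mathbb{N}$-graded $k$-algebra automorphisms. Fix an isomorphism $G\to G^\vee$, $g\mapsto\chi_g$, and let $\mu$ be a normalised 2-cocycle of $G$ with values in $k^\times$. If $A$ has one of the following properties, then the cocycle twist $A^{G,\mu}$ has that same property: (i) it is strongly noetherian; (ii) it is AS-regular; (iii) it is Koszul; (iv) it is Auslander regular; (v) it is Cohen-Macaulay.
   Context: Cocycle twist. $G^\vee=\operatorname{Hom}(G,k^\times)$ is the character group; $g\mapsto\chi_g$ is a fixed group isomorphism $G\to G^\vee$. The action of $g\in G$ on $a\in A$ is written $a^g$. The action induces a $G$-grading $A=\bigoplus_{g\in G}A_g$ with $A_g=\{a\in A: a^h=\chi_{g^{-1}}(h)a \text{ for all } h\in G\}$. A (normalised) 2-cocycle is a function $\mu:G\times G\to k^\times$ with $\mu(g,h)\mu(gh,l)=\mu(g,hl)\mu(h,l)$ and $\mu(e,g)=\mu(g,e)=1$ for all $g,h,l\in G$. $A^{G,\mu}$ is the $k$-algebra with the same underlying vector space as $A$ and multiplication $a\ast_\mu b=\mu(g,h)ab$ for $a\in A_g$, $b\in A_h$, extended bilinearly. It carries the same $\mathbb{N}$-grading as $A$. Connected graded: $A_0=k$ and $\dim_kA_n<\infty$ for all $n$. Strongly noetherian: $A$ is noetherian and $A\otimes_kR$ is (left and right) noetherian for every commutative noetherian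 $k$-algebra $R$. AS-regular (of dimension $d$): $A$ is connected graded, $\operatorname{GKdim}A<\infty$, $\operatorname{gldim}A=d<\infty$, and $A$ is AS-Gorenstein, i.e. $\operatorname{Ext}^i_A(k,A)\cong k$ if $i=d$ and $0$ if $i\ne d$, both when $k$ and $A$ are considered as left and as right $A$-modules. Koszul: $A$ is connected graded and for all $i\ge0$ the $\mathbb{Z}$-graded components of $\operatorname{Ext}^i_A(k,k)$ vanish in all degrees other than $i$ (the degree $j$ component being the group of graded extensions of $k$ in degree $0$ by $k$ placed in degree $j$). Grade of a finitely generated left or right module $M$: $j_A(M)=\inf\{i:\operatorname{Ext}^i_A(M,A)\ne0\}\in\mathbb{N}\cup\{+\infty\}$. Cohen-Macaulay: $\operatorname{GKdim}M+j_A(M)=\operatorname{GKdim}A$ for all non-zero finitely generated $A$-modules $M$. Auslander-Gorenstein condition: for every finitely generated left or right module $M$, all $i\ge0$ and every $A$-submodule $N$ of $\operatorname{Ext}^i_A(M,A)$, one has $j_A(N)\ge i$. Auslander regular: the Auslander-Gorenstein condition holds and $A$ has finite global dimension. *)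

(* Defs.v *)
From HB Require Import structures.
From mathcomp Require Import all_boot all_order all_algebra all_fingroup.
From mathcomp Require Import generic_quotient ring_quotient.
From mathcomp Require Import freeg.
From mathcomp Require Import mathcomp_extra boolp classical_sets functions.
From mathcomp Require Import reals ereal topology normedtype sequences exp.

Set Implicit Arguments.
Unset Strict Implicit.
Unset Printing Implicit Defensive.

Import Order.TTheory GRing.Theory Num.Theory.
Local Open Scope ring_scope.

(* Right A-modules are left modules over the converse ring A^c; as k is
   commutative, A^c inherits the k-algebra structure of A. *)
HB.instance Definition _ (k : comNzRingType) (A : algType k) :=
  GRing.Lmodule.copy A^c A.
HB.instance Definition _ (k : comNzRingType) (A : algType k) :=
  GRing.Lmodule_isLalgebra.Build k A^c (fun c (u v : A) => scalerAr c v u).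
HB.instance Definition _ (k : comNzRingType) (A : algType k) :=
  GRing.Lalgebra_isAlgebra.Build k A^c (fun c (u v : A) => scalerAl c v u).

Section Span.
Variables (R : nzRingType) (V : lmodType R).

Definition lspan (S : {pred V}) : {pred V} :=
  [pred x | `[< exists2 s : seq (R * V),
                  all (fun p => p.2 \in S) s & x = \sum_(p <- s) p.1 *: p.2 >]].

Lemma lspan_submod S : submod_closed (lspan S).
Proof.
split; first by apply/asboolP; exists [::] => //; rewrite big_nil.
move=> a u v /asboolP[s sS ->] /asboolP[t tS ->]; apply/asboolP.
exists ([seq (a * p.1, p.2) | p <- s] ++ t).
  by rewrite all_cat tS andbT all_map; exact: sub_all sS.
rewrite big_cat big_map scaler_sumr; congr (_ + _).
by apply: eq_bigr => p _; rewrite scalerA.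
Qed.

HB.instance Definition _ S :=
  GRing.isSubmodClosed.Build R V (lspan S) (lspan_submod S).

Lemma lspan_closed (S : {pred V}) : submod_closed S -> lspan S =i S.
Proof.
move=> [S0 SP] x; apply/idP/idP => [/asboolP[s sS ->]|Sx].
  elim: s sS => [|p s IHs] /=; first by rewrite big_nil.
  by case/andP=> Sp Ss; rewrite big_cons SP// IHs.
apply/asboolP; exists [:: (1, x)]; first by rewrite /= Sx.
by rewrite big_seq1 scale1r.
Qed.

Definition finitely_generated := exists s : seq V, lspan [in s] =i predT.

End Span.

Section Submodule.
Variables (R : nzRingType) (V : lmodType R) (S : {pred V}).

Record submodule := Submodule { submod_val :> V; _ : submod_val \in lspan S }.

HB.instance Definition _ := [isSub for submod_val].
HB.instance Definition _ := [Choice of submodule by <:].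
HB.instance Definition _ := [SubChoice_isSubLmodule of submodule by <:].

Lemma submod_valP a (x y : submodule) :
  submod_val (a *: x + y) = a *: submod_val x + submod_val y.
Proof. exact: (linearP (val : submodule -> V)). Qed.

End Submodule.

Section QuotientModule.
Variables (R : nzRingType) (V : lmodType R) (S : {pred V}).
Local Open Scope quotient_scope.

Definition quotmod : Type := Quotient.quot (lspan S).

HB.instance Definition _ := GRing.Zmodule.on quotmod.

Local Notation pi := (\pi_(Quotient.quot (lspan S))).
Definition quot_pi (x : V) : quotmod := pi x.

Definition quot_scale (a : R) (x : quotmod) : quotmod :=
  quot_pi (a *: repr (x : Quotient.quot (lspan S))).

Lemma quot_piE x y : (quot_pi x == quot_pi y) = (x - y \in lspan S).
Proof. by rewrite /quot_pi [LHS]piE Quotient.equivE. Qed.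

Lemma quot_piD : {morph quot_pi : x y / x + y}.
Proof. by move=> x y; exact: Quotient.pi_add. Qed.

Lemma quot_piZ a x : quot_pi (a *: x) = quot_scale a (quot_pi x).
Proof.
apply/eqP; rewrite quot_piE -scalerBr; apply: rpredZ.
by rewrite -quot_piE /quot_pi reprK.
Qed.

Lemma quot_piP x : exists y, x = quot_pi y.
Proof. by exists (repr (x : Quotient.quot (lspan S))); rewrite /quot_pi reprK. Qed.

Lemma quot_scaleA a b x : quot_scale a (quot_scale b x) = quot_scale (a * b) x.
Proof. by have [y ->] := quot_piP x; rewrite -!quot_piZ scalerA. Qed.

Lemma quot_scale1 : left_id 1 quot_scale.
Proof. by move=> x; have [y ->] := quot_piP x; rewrite -!quot_piZ scale1r. Qed.

Lemma quot_scaleDr : right_distributive quot_scale +%R.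
Proof.
move=> a x y; have [x' ->] := quot_piP x; have [y' ->] := quot_piP y.
by rewrite -!(quot_piZ, quot_piD) scalerDr.
Qed.

Lemma quot_scaleDl x : {morph quot_scale^~ x : a b / a + b}.
Proof.
move=> a b; have [y ->] := quot_piP x.
by rewrite -!(quot_piZ, quot_piD) scalerDl.
Qed.

HB.instance Definition _ := GRing.Zmodule_isLmodule.Build R quotmod
  quot_scaleA quot_scale1 quot_scaleDr quot_scaleDl.

End QuotientModule.

Definition left_noetherian (A : nzRingType) :=
  forall I : {pred A^o}, submod_closed I -> exists s : seq A^o, lspan [in s] =i I.

Definition noetherian (A : nzRingType) :=
  left_noetherian A /\ left_noetherian A^c.

Section Resolutions.
Variable A : nzRingType.

Definition surjective (T U : Type) (f : T -> U) := forall y, exists x, f x = y.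

Definition projective (P : lmodType A) :=
  forall (U W : lmodType A) (p : {linear U -> W}) (f : {linear P -> W}),
    surjective p -> exists g : {linear P -> U}, forall x, p (g x) = f x.

Definition exact (U V W : lmodType A) (f : U -> V) (g : V -> W) :=
  forall y, g y = 0 <-> exists x, f x = y.

Definition projdim_le (M : lmodType A) (n : nat) :=
  exists (P : nat -> lmodType A) (eps : {linear P 0%N -> M})
         (d : forall i, {linear P i.+1 -> P i}),
    [/\ forall i, projective (P i),
        surjective eps, exact (d 0%N) eps, forall i, exact (d i.+1) (d i)
      & forall i, (n < i)%N -> forall x : P i, x = 0].

Definition gldim_le (n : nat) := forall M : lmodType A, projdim_le M n.

Definition left_gldim (d : nat) :=
  gldim_le d /\ forall n, gldim_le n -> (d <= n)%N.

Lemma free_scaleU (K : choiceType) (a c : A) (x : K) :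
  a *: << c *g x >> = << a * c *g x >> :> {freeg K / A}.
Proof. by apply/eqP/freeg_eqP => y; rewrite coeffZ !coeffU mulrA. Qed.

(* The linear map from the free module on K extending f : K -> M. *)
Definition free_lift (K : choiceType) (M : lmodType A) (f : K -> M) :
  {freeg K / A} -> M := fglift f.

Lemma free_lift_linear (K : choiceType) (M : lmodType A) (f : K -> M) :
  linear (free_lift f).
Proof.
have fB u v : free_lift f (u - v) = free_lift f u - free_lift f v.
  exact: lift_is_additive.
have f0 : free_lift f 0 = 0 by rewrite -{1}(subrr 0) fB subrr.
have fD u v : free_lift f (u + v) = free_lift f u + free_lift f v.
  by rewrite -{1}[v]opprK fB -[- v]sub0r fB f0 sub0r opprK.
move=> a u v; rewrite fD; congr (_ + _).
rewrite -[u]freeg_sumE.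
have fS (r : seq K) (F : K -> {freeg K / A}) :
    free_lift f (\sum_(z <- r) F z) = \sum_(z <- r) free_lift f (F z).
  by elim/big_ind2: _ => // x1 x2 y1 y2 <- <-; rewrite fD.
rewrite scaler_sumr !fS scaler_sumr; apply: eq_bigr => z _.
by rewrite free_scaleU /free_lift !liftU scalerA.
Qed.

HB.instance Definition _ (K : choiceType) (M : lmodType A) (f : K -> M) :=
  GRing.isLinear.Build A {freeg K / A} M *:%R (free_lift f) (free_lift_linear f).

Record arrow := Arrow {
  arrow_src : lmodType A;
  arrow_tgt : lmodType A;
  arrow_map :> {linear arrow_src -> arrow_tgt} }.

Definition kernel_of (f : arrow) := {x : arrow_src f | f x == 0}.

(* The free module on the elements of ker f, mapped onto ker f. *)
Definition free_cover (f : arrow) : arrow :=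
  Arrow (free_lift (fun x : kernel_of f => val x)).

Lemma free_cover_exact (f : arrow) : exact (free_cover f) f.
Proof.
move=> y; split=> [fy0|[x <-]].
  exists (<< exist _ y (introT eqP fy0) : kernel_of f >>).
  by rewrite /= /free_lift liftU scale1r.
rewrite -[x]freeg_sumE !raddf_sum big1// => z _ /=.
by rewrite /free_lift liftU linearZ_LR (eqP (valP z)) scaler0.
Qed.

Lemma free_projective (K : choiceType) : projective {freeg K / A}.
Proof.
move=> U W p f psurj.
have [s sP] : {s : K -> U & forall x, p (s x) = f << x >>}.
  by apply: (@choice _ _ (fun x u => p u = f << x >>)) => x.
exists (free_lift s : {linear _ -> _}) => x.
rewrite -[x]freeg_sumE !raddf_sum; apply: eq_bigr => z _ /=.
by rewrite /free_lift liftU linearZ_LR sP -linearZ_LR free_scaleU mulr1.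
Qed.

(* The canonical free resolution of M: [res_arrow M 0] is the augmentation
   P_0 -> M, where P_0 is free on the set M = ker (M -> 0), and
   [res_arrow M i.+1] is the differential P_i.+1 -> P_i. *)
Definition res_arrow (M : lmodType A) (i : nat) : arrow :=
  iter i.+1 free_cover (Arrow (\0 : {linear M -> M})).

Definition res (M : lmodType A) (i : nat) : lmodType A :=
  arrow_src (res_arrow M i).

Definition res_diff (M : lmodType A) (i : nat) : {linear res M i.+1 -> res M i} :=
  res_arrow M i.+1.

End Resolutions.

(* Cocycles and coboundaries of the complex Hom(P_0, N) -> Hom(P_1, N) -> ...
   whose cochains are the functions P_i -> N satisfying [hom]. *)
Section Cochains.
Variables (A : nzRingType) (P : nat -> lmodType A).
Variables (d : forall i, {linear P i.+1 -> P i}) (N : nmodType).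
Variable hom : forall i, (P i -> N) -> Prop.

Definition cocycle i (f : P i -> N) := hom f /\ forall x, f (d i x) = 0.

Definition coboundary i : (P i -> N) -> Prop :=
  match i with
  | 0%N => fun f => forall x, f x = 0
  | j.+1 => fun f => exists2 g : P j -> N, hom g & forall x, f x = g (d j x)
  end.

End Cochains.

(* The cohomology of Hom_A(P, A). The functions P_i -> A form a right A-module
   through the right multiplication of A, i.e. the left multiplication of A^c. *)
Section DualCohomology.
Variables (A : nzRingType) (P : nat -> lmodType A).
Variable d : forall i, {linear P i.+1 -> P i}.

Definition cochain i : lmodType A^c := (P i -> (A^c)^o).

Definition A_linear i (f : cochain i) := linear (f : P i -> A^o).

Definition cocycles i : {pred cochain i} :=
  [pred f | `[< cocycle d A_linear f >]].

Definition coboundaries i : {pred submodule (@cocycles i)} :=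
  [pred z | `[< coboundary d A_linear (submod_val z) >]].

Definition dual_cohomology i : lmodType A^c := quotmod (@coboundaries i).

Lemma cochainE i (a : A^c) (f g : cochain i) x :
  (a *: f + g) x = (f x : A) * a + (g x : A).
Proof. by []. Qed.

Lemma A_linearP i (a : A^c) (f g : cochain i) :
  A_linear f -> A_linear g -> A_linear (a *: f + g).
Proof.
move=> fl gl b x y; rewrite !cochainE (fl b x y) (gl b x y).
by rewrite -![_ *: _]/(_ * _ : A) mulrDl mulrDr -!mulrA addrACA.
Qed.

Lemma A_linear0 i : A_linear (0 : cochain i).
Proof. by move=> a x y; rewrite -[RHS]/(a * 0 + 0 : A) mulr0 addr0. Qed.

Lemma cocycles_submod i : submod_closed (@cocycles i).
Proof.
split; first by apply/asboolP; split=> //; exact: A_linear0.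
move=> a f g /asboolP[fl fd] /asboolP[gl gd]; apply/asboolP.
split=> [|x]; first exact: A_linearP.
by rewrite cochainE fd gd mul0r addr0.
Qed.

Lemma coboundariesP i (z : submodule (@cocycles i)) :
  reflect (coboundary d A_linear (submod_val z)) (z \in @coboundaries i).
Proof. exact: asboolP. Qed.

Lemma coboundary0 i : coboundary d A_linear (0 : cochain i).
Proof. by case: i => [|i] //; exists 0 => //; exact: A_linear0. Qed.

Lemma coboundaryP i (a : A^c) (f g : cochain i) :
  coboundary d A_linear f -> coboundary d A_linear g ->
  coboundary d A_linear (a *: f + g).
Proof.
case: i f g => [|i] f g.
  by move=> f0 g0 x; rewrite cochainE f0 g0 mul0r addr0.
move=> [u ul uE] [v vl vE].
exists (a *: u + v) => [|x]; first exact: A_linearP.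
by rewrite !cochainE uE vE.
Qed.

Lemma coboundaries_submod i : submod_closed (@coboundaries i).
Proof.
split=> [|a f g /coboundariesP fB /coboundariesP gB]; apply/coboundariesP.
  exact: coboundary0.
by rewrite submod_valP; exact: coboundaryP.
Qed.

End DualCohomology.

Section Ext.
Variables (R : realType) (A : nzRingType) (M : lmodType A).

(* Ext^i_A(M, A) as a right A-module. *)
Definition Ext i : lmodType A^c := dual_cohomology (@res_diff A M) i.

(* The value +oo is the infimum of the empty set. *)
Definition grade : \bar R :=
  ereal_inf [set (i%:R%:E : \bar R) | i in [set i | exists x : Ext i, x != 0]].

End Ext.
Section Graded.
Variables (k : fieldType) (A : algType k) (gr : nat -> {pred A}).

Definition graded_algebra :=
  [/\ forall n, submod_closed (gr n),
      1 \in gr 0%N,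
      forall m n a b, a \in gr m -> b \in gr n -> a * b \in gr (m + n)%N,
      forall a, exists n, exists2 c : 'I_n -> A,
        forall i : 'I_n, c i \in gr i & a = \sum_i c i
    & forall n (c : 'I_n -> A), (forall i : 'I_n, c i \in gr i) ->
        \sum_i c i = 0 -> forall i, c i = 0].

Definition connected_graded :=
  [/\ graded_algebra,
      forall a, a \in gr 0%N <-> exists c : k, a = c%:A
    & forall n, exists s : seq A, gr n =i lspan [in s]].

(* The left A-module k = A / A_{>= 1}. *)
Definition positive_part : {pred A^o} := [pred a | `[< exists n, a \in gr n.+1 >]].

Definition trivial_module : lmodType A := quotmod positive_part.

End Graded.

Section GradedResolution.
Variables (k : fieldType) (A : algType k) (gr : nat -> {pred A}).

(* A homomorphism to [garrow_tgt] from a left A-module with Z-graded components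
   [garrow_deg]. *)
Record garrow := GArrow {
  garrow_src : lmodType A;
  garrow_deg : int -> {pred garrow_src};
  garrow_tgt : lmodType A;
  garrow_map :> {linear garrow_src -> garrow_tgt} }.

Definition graded_kernel_of (f : garrow) :=
  {x : int * garrow_src f | (x.2 \in garrow_deg x.1) && (f x.2 == 0)}.

(* The degree n component of the free module whose basis element x has
   degree [deg x]. *)
Definition free_deg (K : choiceType) (deg : K -> int) (n : int) :
    {pred {freeg K / A}} :=
  [pred v | `[< exists2 s : seq (A * K),
      forall p, p \in s -> exists2 m : nat, p.1 \in gr m & m%:Z + deg p.2 = n
    & v = \sum_(p <- s) << p.1 *g p.2 >> >]].

(* The graded free module on the homogeneous elements of ker f, mapped onto
   ker f. *)
Definition graded_free_cover (f : garrow) : garrow :=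
  GArrow (free_deg (fun x : graded_kernel_of f => (val x).1))
         (free_lift (fun x : graded_kernel_of f => (val x).2)).

Variables (M : lmodType A) (degM : int -> {pred M}).

Definition gres_arrow (i : nat) : garrow :=
  iter i.+1 graded_free_cover (GArrow degM (\0 : {linear M -> M})).

Definition gres (i : nat) : lmodType A := garrow_src (gres_arrow i).

Definition gres_deg (i : nat) : int -> {pred gres i} :=
  @garrow_deg (gres_arrow i).

Definition gres_diff (i : nat) : {linear gres i.+1 -> gres i} :=
  gres_arrow i.+1.

(* Homomorphisms of degree 0 to a module N with graded components [degN]. *)
Definition graded_hom (N : lmodType A) (degN : int -> {pred N}) i
    (f : gres i -> N) :=
  linear f /\ forall n x, x \in @gres_deg i n -> f x \in degN n.

Definition graded_Ext_zero (N : lmodType A) (degN : int -> {pred N}) (i : nat) :=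
  forall f : gres i -> N, cocycle gres_diff (graded_hom degN) f ->
    coboundary gres_diff (graded_hom degN) f.

End GradedResolution.

(* The n-th component of V, as a graded module concentrated in degree j. *)
Definition placed_in (V : zmodType) (j n : int) : {pred V} :=
  if n == j then predT else pred1 0.

Definition Koszul (k : fieldType) (A : algType k) (gr : nat -> {pred A}) :=
  connected_graded gr /\
  forall (i : nat) (j : int), j != i%:Z ->
    graded_Ext_zero gr (@placed_in (trivial_module gr) 0)
      (@placed_in (trivial_module gr) j) i.

Section GKdim.
Variables (R : realType) (k : fieldType) (A : algType k).

(* The dimension of the k-span of s. *)
Definition span_dim (M : lmodType A) (s : seq M) : nat :=
  \max_(I : {set 'I_(size s)} | `[< forall c : 'I_(size s) -> k,
      \sum_(i in I) (c i)%:A *: s`_i = 0 -> forall i, i \in I -> c i = 0 >])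
    #|I|.

(* The products of at most n factors from s. *)
Fixpoint words (s : seq A) (n : nat) : seq A :=
  1 :: (if n is m.+1 then [seq x * w | x <- s, w <- words s m] else [::]).

Local Open Scope ereal_scope.

Definition growth_exponent (M : lmodType A) (s : seq A) (t : seq M) : \bar R :=
  limn_esup (fun n =>
    (ln (span_dim [seq w *: x | w <- words s n, x <- t])%:R / ln n%:R)%:E).

(* As [words] contains 1, growth_exponent s [:: 1] is the growth exponent of the
   subalgebra of A generated by s. *)
Definition GKdim : \bar R :=
  ereal_sup [set growth_exponent s [:: 1%R : A^o] | s in [set: seq A]].

Definition GKdim_mod (M : lmodType A) : \bar R :=
  ereal_sup [set growth_exponent st.1 st.2 | st in [set: seq A * seq M]].

End GKdim.

Section Conditions.
Variables (R : realType) (k : fieldType) (A : algType k).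

(* Ext^i(k, A) is k for i = d and 0 otherwise, as k-vector spaces, where k is
   the trivial left A-module. *)
Definition left_AS_Gorenstein (gr : nat -> {pred A}) (d : nat) :=
  (forall i, i != d -> forall x : Ext (trivial_module gr) i, x = 0) /\
  exists x : Ext (trivial_module gr) d, bijective (fun c : k => (c%:A : A^c) *: x).

(* Up to isomorphism, an injective f : N -> Ext^i(M, A) is a submodule N. *)
Definition left_Auslander_Gorenstein :=
  forall M : lmodType A, finitely_generated M ->
  forall (i : nat) (N : lmodType A^c) (f : {linear N -> Ext M i}),
    injective f -> (i%:R%:E <= grade R N)%E.

End Conditions.

Section Properties.
Variables (R : realType) (k : fieldType) (A : algType k).

(* T, with a (x) b = f a * g b, is the tensor product of A and B over k: it has
   the universal property for k-bilinear maps, and the images of f and g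
   commute. *)
Definition is_tensor_product (B T : algType k)
    (f : {lrmorphism A -> T}) (g : {lrmorphism B -> T}) :=
  (forall a b, f a * g b = g b * f a) /\
  forall (V : lmodType k) (phi : A -> B -> V),
    (forall a, linear (phi a)) -> (forall b, linear (phi^~ b)) ->
    exists2 h : {linear T -> V}, forall a b, h (f a * g b) = phi a b
      & forall h' : {linear T -> V},
          (forall a b, h' (f a * g b) = phi a b) -> h' =1 h.

(* T ranges over the models of the tensor product of A and B over k. *)
Definition strongly_noetherian :=
  noetherian A /\
  forall B : comAlgType k, noetherian B ->
  forall (T : algType k) (f : {lrmorphism A -> T}) (g : {lrmorphism B -> T}),
    is_tensor_product f g -> noetherian T.

Definition AS_regular (gr : nat -> {pred A}) (d : nat) :=
  [/\ connected_graded gr,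
      (GKdim R A < +oo)%E,
      left_gldim A d /\ left_gldim A^c d,
      left_AS_Gorenstein gr d
    & left_AS_Gorenstein (gr : nat -> {pred A^c}) d].

Definition Auslander_regular :=
  [/\ left_Auslander_Gorenstein R A, left_Auslander_Gorenstein R A^c,
      exists d, left_gldim A d & exists d, left_gldim A^c d].

Definition Cohen_Macaulay :=
  (forall M : lmodType A, finitely_generated M -> (exists x : M, x != 0) ->
     (GKdim_mod R M + grade R M = GKdim R A)%E) /\
  (forall M : lmodType A^c, finitely_generated M -> (exists x : M, x != 0) ->
     (GKdim_mod R M + grade R M = GKdim R A)%E).

End Properties.

Section TwistData.
Variables (k : fieldType) (gT : finGroupType) (A : algType k).

(* [act g a] is a^g, so that a^(gh) = (a^g)^h. *)
Definition is_algebra_action (act : gT -> {lrmorphism A -> A}) :=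
  (forall a, act 1%g a = a) /\ forall g h a, act (g * h)%g a = act h (act g a).

Definition is_character (c : gT -> k) :=
  (forall x, c x != 0) /\ forall x y, c (x * y)%g = c x * c y.

Definition is_dual_iso (chi : gT -> gT -> k) :=
  [/\ forall g, is_character (chi g),
      forall g h x, chi (g * h)%g x = chi g x * chi h x,
      forall g h, chi g =1 chi h -> g = h
    & forall c, is_character c -> exists g, chi g =1 c].

Definition normalised_cocycle (mu : gT -> gT -> k) :=
  [/\ forall g h, mu g h != 0,
      forall g h l, mu g h * mu (g * h)%g l = mu g (h * l)%g * mu h l
    & forall g, mu 1%g g = 1 /\ mu g 1%g = 1].

Definition isotypic (act : gT -> {lrmorphism A -> A}) (chi : gT -> gT -> k)
  (g : gT) : {pred A} := [pred a | [forall h, act h a == chi g^-1%g h *: a]].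

(* The component of a in the summand A_g = [isotypic act chi g] (see [isotypic_proj_in] and
   [isotypic_decomposition]). *)
Definition isotypic_proj (act : gT -> {lrmorphism A -> A})
  (chi : gT -> gT -> k) (g : gT) (a : A) : A :=
  (#|gT|%:R)^-1 *: \sum_h chi g h *: act h a.

(* The algebra A^{G,mu}: its k-vector space is that of A and its multiplication
   is [twist_mul], the bilinear extension of [twist_mulE]. *)
Definition cocycle_twist (act : gT -> {lrmorphism A -> A})
  (chi mu : gT -> gT -> k)
  (cardG : [pchar k]^'.-nat #|gT|) (actP : is_algebra_action act)
  (chiP : is_dual_iso chi) (muP : normalised_cocycle mu) : Type := A.

End TwistData.

Section Twist.
Variables (k : fieldType) (gT : finGroupType) (A : algType k).
Variables (act : gT -> {lrmorphism A -> A}) (chi mu : gT -> gT -> k).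
Hypotheses (cardG : [pchar k]^'.-nat #|gT|) (actP : is_algebra_action act).
Hypotheses (chiP : is_dual_iso chi) (muP : normalised_cocycle mu).

Local Notation "A_[ g ]" := (isotypic act chi g) (at level 0).
Local Notation proj := (isotypic_proj act chi).
Local Notation n := (#|gT|%:R : k).

Let n_neq0 : n != 0. Proof. by rewrite natf_neq0_pchar. Qed.

Let chiM g h x : chi (g * h)%g x = chi g x * chi h x.
Proof. by case: chiP. Qed.

Let chiMr g x y : chi g (x * y)%g = chi g x * chi g y.
Proof. by case: chiP => /(_ g)[]. Qed.

Let chi_neq0 g x : chi g x != 0.
Proof. by case: chiP => /(_ g)[]. Qed.

Let chi1r g : chi g 1%g = 1.
Proof. by apply: (mulfI (chi_neq0 g 1%g)); rewrite -chiMr mulg1 mulr1. Qed.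

Let chi1 x : chi 1%g x = 1.
Proof. by apply: (mulfI (chi_neq0 1%g x)); rewrite -chiM mulg1 mulr1. Qed.

Let chiV g x : chi g^-1%g x = (chi g x)^-1.
Proof.
by apply: (mulfI (chi_neq0 g x)); rewrite -chiM mulgV chi1 divff.
Qed.

Let chiVr g x : chi g x^-1%g = (chi g x)^-1.
Proof.
by apply: (mulfI (chi_neq0 g x)); rewrite -chiMr mulgV chi1r divff.
Qed.

Let chi_row g : \sum_x chi g x = (g == 1%g)%:R * n.
Proof.
have [->|g1] := eqVneq.
  by rewrite (eq_bigr (fun=> 1)) // sumr_const mul1r.
have [x chix] : exists x, chi g x != 1.
  apply/existsP; apply: contraR g1 => /existsPn chig; apply/eqP.
  case: chiP => _ _ inj _; apply: inj => x; rewrite chi1.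
  by apply/eqP; have := chig x; rewrite negbK.
rewrite mul0r; apply/eqP; rewrite -[_ == 0]orFb -(negbTE chix) -subr_eq0.
rewrite -mulf_eq0 mulrBl mul1r subr_eq0 mulr_sumr; apply/eqP.
rewrite [RHS](reindex_inj (mulgI x)) /=.
by apply: eq_bigr => y _; rewrite chiMr.
Qed.

Let sum_rank (F : 'I_#|gT| -> k) : \sum_i F i = \sum_g F (enum_rank g).
Proof. by apply: reindex; exact/onW_bij/enum_rank_bij. Qed.

Let chi_col h : \sum_g chi g h = (h == 1%g)%:R * n.
Proof.
pose X : 'M[k]_#|gT| := \matrix_(i, j) chi (enum_val i) (enum_val j).
pose Y : 'M[k]_#|gT| :=
  \matrix_(i, j) (n^-1 * chi (enum_val j)^-1%g (enum_val i)).
have XY : X *m Y = 1%:M.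
  apply/matrixP => i j; rewrite !mxE.
  under eq_bigr do rewrite !mxE mulrCA -chiM.
  rewrite -mulr_sumr sum_rank.
  under eq_bigr do rewrite enum_rankK.
  rewrite chi_row mulrCA mulVf// mulr1; congr (_ %:R).
  by rewrite -eq_mulgV1 (inj_eq enum_val_inj).
have /matrixP/(_ (enum_rank 1%g) (enum_rank h)) := mulmx1C XY.
rewrite !mxE (inj_eq enum_rank_inj) eq_sym => <-.
rewrite mulr_suml sum_rank; apply: eq_bigr => g _.
by rewrite !mxE !enum_rankK chiV chi1r invr1 mulr1 mulrAC mulVf// mul1r.
Qed.

Let act1 a : act 1%g a = a. Proof. by case: actP. Qed.
Let actM g h a : act (g * h)%g a = act h (act g a). Proof. by case: actP. Qed.

Lemma isotypicP g a :
  reflect (forall h, act h a = chi g^-1%g h *: a) (a \in A_[g]).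
Proof. exact: 'forall_eqP. Qed.

Lemma isotypic_proj_linear g : linear (proj g).
Proof.
move=> c u v; rewrite /isotypic_proj scalerA mulrC -scalerA -scalerDr.
congr (_ *: _); rewrite scaler_sumr -big_split; apply: eq_bigr => h _ /=.
by rewrite linearP scalerDr !scalerA mulrC.
Qed.

HB.instance Definition _ g :=
  GRing.isLinear.Build k A A *:%R (proj g) (isotypic_proj_linear g).

Lemma isotypic_proj_in g a : proj g a \in A_[g].
Proof.
apply/isotypicP => h; rewrite /isotypic_proj linearZ_LR linear_sum /=.
rewrite scalerA mulrC -scalerA; congr (_ *: _).
rewrite scaler_sumr [RHS](reindex_inj (mulIg h)) /=; apply: eq_bigr => x _.
by rewrite linearZ_LR /= actM chiMr scalerA chiV mulrCA mulVf// mulr1.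
Qed.

Lemma isotypic_proj_id g h a : a \in A_[g] -> proj h a = (g == h)%:R *: a.
Proof.
move=> /isotypicP ag; rewrite /isotypic_proj.
under eq_bigr do rewrite ag scalerA -chiM.
rewrite -scaler_suml chi_row scalerA mulrCA mulVf// mulr1.
by rewrite -eq_mulgV1 eq_sym.
Qed.

Lemma isotypic_sum a : \sum_g proj g a = a.
Proof.
rewrite /isotypic_proj -scaler_sumr exchange_big /=.
under eq_bigr do rewrite -scaler_suml chi_col.
rewrite (bigD1 1%g) //= eqxx mul1r big1 ?addr0; last first.
  by move=> h /negbTE ->; rewrite mul0r scale0r.
by rewrite scalerA mulVf// scale1r act1.
Qed.

Lemma isotypic_decomposition a :
  exists! c : {ffun gT -> A}, (forall g, c g \in A_[g]) /\ \sum_g c g = a.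
Proof.
exists [ffun g => proj g a]; split.
  split=> [g|]; first by rewrite ffunE isotypic_proj_in.
  by under eq_bigr do rewrite ffunE; exact: isotypic_sum.
move=> c [cA <-]; apply/ffunP => g; rewrite ffunE linear_sum (bigD1 g) //=.
rewrite (isotypic_proj_id _ (cA g)) eqxx scale1r big1 ?addr0// => h /negbTE hg.
by rewrite (isotypic_proj_id _ (cA h)) hg scale0r.
Qed.

Lemma isotypic1 : 1 \in A_[1%g].
Proof. by apply/isotypicP => h; rewrite rmorph1 invg1 chi1 scale1r. Qed.

Lemma isotypicM g h a b :
  a \in A_[g] -> b \in A_[h] -> a * b \in A_[(g * h)%g].
Proof.
move=> /isotypicP aA /isotypicP bA; apply/isotypicP => x.
by rewrite rmorphM /= aA bA -scalerAl -scalerAr scalerA !chiV chiM invfM.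
Qed.

Local Notation twist := (cocycle_twist cardG actP chiP muP).

HB.instance Definition _ := GRing.Lmodule.copy twist A.

Definition twist_mul (a b : A) : A :=
  \sum_g \sum_h mu g h *: (proj g a * proj h b).

Lemma twist_mulE g h a b : a \in A_[g] -> b \in A_[h] ->
  twist_mul a b = mu g h *: (a * b).
Proof.
move=> aA bA; rewrite /twist_mul (bigD1 g) //= (bigD1 h) //=.
rewrite (isotypic_proj_id _ aA) (isotypic_proj_id _ bA) !eqxx !scale1r.
rewrite !big1 ?addr0// => [x /negbTE xg|x /negbTE xh].
  by apply: big1 => y _; rewrite (isotypic_proj_id _ aA) eq_sym xg scale0r mul0r
    scaler0.
by rewrite (isotypic_proj_id _ bA) eq_sym xh scale0r mulr0 scaler0.
Qed.

Lemma twist_mulDl : left_distributive twist_mul +%R.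
Proof.
move=> a b c; rewrite /twist_mul -big_split; apply: eq_bigr => g _ /=.
rewrite -big_split; apply: eq_bigr => h _ /=.
by rewrite linearD mulrDl scalerDr.
Qed.

Lemma twist_mulDr : right_distributive twist_mul +%R.
Proof.
move=> a b c; rewrite /twist_mul -big_split; apply: eq_bigr => g _ /=.
rewrite -big_split; apply: eq_bigr => h _ /=.
by rewrite linearD mulrDr scalerDr.
Qed.

Lemma twist_scaleAl c a b : c *: twist_mul a b = twist_mul (c *: a) b.
Proof.
rewrite /twist_mul scaler_sumr; apply: eq_bigr => g _; rewrite scaler_sumr.
apply: eq_bigr => h _.
by rewrite (linearZ_LR (proj g)) -(scalerAl c) !scalerA mulrC.
Qed.

Lemma twist_scaleAr c a b : c *: twist_mul a b = twist_mul a (c *: b).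
Proof.
rewrite /twist_mul scaler_sumr; apply: eq_bigr => g _; rewrite scaler_sumr.
apply: eq_bigr => h _.
by rewrite (linearZ_LR (proj h)) -(scalerAr c) !scalerA mulrC.
Qed.

Let twist_sumr (F : gT -> A) a :
  twist_mul a (\sum_g F g) = \sum_g twist_mul a (F g).
Proof.
have a0 : twist_mul a 0 = 0.
  by apply: (addrI (twist_mul a 0)); rewrite -twist_mulDr !addr0.
exact: (big_morph (twist_mul a) (twist_mulDr a) a0).
Qed.

Let twist_suml (F : gT -> A) b :
  twist_mul (\sum_g F g) b = \sum_g twist_mul (F g) b.
Proof.
have a0 : twist_mul 0 b = 0.
  by apply: (addrI (twist_mul 0 b)); rewrite -twist_mulDl !addr0.
exact: (big_morph (twist_mul^~ b) (fun x y => twist_mulDl x y b) a0).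
Qed.

Lemma twist_mulA : associative twist_mul.
Proof.
move=> a b c; rewrite -[a]isotypic_sum !twist_suml; apply: eq_bigr => g _.
rewrite -[b]isotypic_sum twist_suml !twist_sumr twist_suml.
apply: eq_bigr => h _; rewrite -[c]isotypic_sum !twist_sumr.
apply: eq_bigr => l _.
move: (isotypic_proj_in g a) (isotypic_proj_in h b) (isotypic_proj_in l c).
move: (proj g a) (proj h b) (proj l c) => {}a {}b {}c aA bA cA.
rewrite (twist_mulE aA bA) (twist_mulE bA cA) -twist_scaleAl -twist_scaleAr.
rewrite (twist_mulE aA (isotypicM bA cA)) (twist_mulE (isotypicM aA bA) cA).
case: muP => _ muA _.
by rewrite !scalerA mulrA muA [mu h l * _]mulrC.
Qed.

Lemma twist_mul1l : left_id 1 twist_mul.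
Proof.
move=> a; rewrite -[a]isotypic_sum twist_sumr; apply: eq_bigr => g _.
rewrite (twist_mulE isotypic1 (isotypic_proj_in g a)) mul1r.
by case: muP => _ _ /(_ g)[-> _]; rewrite scale1r.
Qed.

Lemma twist_mulr1 : right_id 1 twist_mul.
Proof.
move=> a; rewrite -[a]isotypic_sum twist_suml; apply: eq_bigr => g _.
rewrite (twist_mulE (isotypic_proj_in g a) isotypic1) mulr1.
by case: muP => _ _ /(_ g)[_ ->]; rewrite scale1r.
Qed.

HB.instance Definition _ := GRing.Zmodule_isNzRing.Build twist
  twist_mulA twist_mul1l twist_mulr1 twist_mulDl twist_mulDr (oner_neq0 A).
HB.instance Definition _ :=
  GRing.Lmodule_isLalgebra.Build k twist twist_scaleAl.
HB.instance Definition _ :=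
  GRing.Lalgebra_isAlgebra.Build k twist twist_scaleAr.

End Twist.

(* Main.v *)
Require Import Defs.
From HB Require Import structures.
From mathcomp Require Import all_boot all_order all_algebra all_fingroup.
From mathcomp Require Import freeg.
From mathcomp Require Import boolp classical_sets.
From mathcomp Require Import reals ereal topology normedtype sequences exp.

Set Implicit Arguments.
Unset Strict Implicit.
Unset Printing Implicit Defensive.

Import Order.TTheory GRing.Theory Num.Theory.
Local Open Scope ring_scope.

(* Write B for the twist and b_g for the component of b in degree g. The map
   b |-> (mu(x y^-1, y) b_{x y^-1})_{x,y} is a ring homomorphism r : B -> M_G(A),
   and mu^-1 gives s : A -> M_G(B) in the same way; summing s(r(b)_{xy})_{zy}
   over y, or s(r(b)_{xz})_{xw} over x, returns b on the diagonal and 0 off it,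
   and likewise with r and s exchanged. Everything follows from such a dual pair,
   and transposing it gives one for the opposite rings.

   Restricting column vectors along r and s yields exact functors
   A-Mod -> B-Mod and B-Mod -> A-Mod, M |-> M^G, adjoint to each other on both
   sides. They preserve projectives and resolutions, N is a direct summand of its
   double image because |G| is invertible, and
   Hom_A(N^G, A) = Hom_B(N, B)^G as right modules. So global dimension, grade,
   submodules of Ext and the cohomology of k are transported. The left ideals of
   B embed in those of a finitely generated A-module, and N and N^G have the same
   growth. For B (x) C one twists back with the induced action of G. *)

(** * Graded modules and comparison of resolutions *)

(** The scalar mu(x y^-1, y) is a structure constant. Sending b to the sum of the b_g tensor g
    embeds B in the tensor product of A with the twisted group algebra of mu, where left
    multiplication by g sends the basis vector y to mu(g, y) g y; [r(b)] is the matrix of left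
    multiplication by the image of b. As A is the twist of B by mu^-1, [s] has the same origin. The
    two functors are not inverse equivalences: N returns as N^(G x G). Hence only what survives
    passage to a direct summand can be transported directly, and the dimension of Ext of the trivial
    module must be found by counting: the Ext spaces over A and over B agree after taking |G| copies
    of each. A further obstacle is that Ext is defined by one particular free resolution, on all
    elements of successive kernels, which twisting does not preserve. Resolutions therefore have to
    be compared, and this is done for modules with degrees so that the graded Ext of the Koszul
    property is covered by the same lemmas. *)

Definition mklin (R : nzRingType) (U V : lmodType R) (f : U -> V)
    (fl : linear f) : {linear U -> V} :=
  HB.pack f (GRing.isLinear.Build R U V *:%R f fl).

Lemma linearE (R : nzRingType) (U V : lmodType R) (f : U -> V) :
  linear f -> exists f' : {linear U -> V}, f = f'.
Proof. by move=> fl; exists (mklin fl). Qed.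

Section GradedModules.
Variables (R : nzRingType) (I : Type) (dsh : nat -> I -> I) (gr : nat -> {pred R}).

(* Degrees live in I, on which the degrees of R act through dsh; the ungraded
   case is I = unit and gr = predT. *)
Record gmod := Gmod {
  gmod_car :> lmodType R;
  gdeg : I -> {pred gmod_car};
  gdeg_zmod : forall n, zmod_closed (gdeg n);
  gdeg_scale : forall m n a x,
    a \in gr m -> x \in gdeg n -> a *: x \in gdeg (dsh m n) }.

Arguments gdeg : clear implicits.

Definition ghom (U V : gmod) (f : U -> V) :=
  linear f /\ forall n x, x \in gdeg U n -> f x \in gdeg V n.

Lemma ghom_comp (U V W : gmod) (f : V -> W) (g : U -> V) :
  ghom f -> ghom g -> ghom (f \o g).
Proof.
move=> [fl fd] [gl gd]; split=> [a x y|n x xU] /=; first by rewrite gl fl.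
exact/fd/gd.
Qed.

Lemma ghom_sub (U V : gmod) (f g : U -> V) :
  ghom f -> ghom g -> ghom (fun x => f x - g x).
Proof.
move=> [fl fd] [gl gd]; split=> [a x y|n x xU].
  by rewrite fl gl scalerBr opprD addrACA.
by case: (gdeg_zmod V n) => _; apply; [exact: fd | exact: gd].
Qed.

Lemma ghom_id (U : gmod) : ghom (id : U -> U).
Proof. by []. Qed.

Lemma ghom_zero (U V : gmod) : ghom (fun _ : U => 0 : V).
Proof.
by split=> [a x y|n x _]; [rewrite scaler0 addr0 | case: (gdeg_zmod V n)].
Qed.

(** Exactness is asked of homogeneous elements only, and only as the inclusion of the kernel in the
    image; vanishing of the composites is a separate field of [gresol]. *)
Definition gexact (U V W : gmod) (p : U -> V) (q : V -> W) :=
  forall n y, y \in gdeg V n -> q y = 0 -> exists2 x, x \in gdeg U n & p x = y.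

(** Lifting is required against an exact pair instead of a surjection, so that it applies to a
    differential directly and no graded kernel has to be formed. *)
Definition gproj (P : gmod) :=
  forall (U V W : gmod) (p : U -> V) (q : V -> W) (f : P -> V),
    ghom p -> ghom q -> gexact p q -> ghom f -> (forall x, q (f x) = 0) ->
  exists2 g : P -> U, ghom g & forall x, p (g x) = f x.

Record gresol (M : gmod) := Gresol {
  rP :> nat -> gmod;
  rd : forall i, {linear rP i.+1 -> rP i};
  re : {linear rP 0%N -> M};
  rd_hom : forall i, ghom (rd i);
  re_hom : ghom re;
  rP_proj : forall i, gproj (rP i);
  re_surj : forall n y, y \in gdeg M n -> exists2 x, x \in gdeg (rP 0%N) n & re x = y;
  rd_comp0 : forall x, re (rd 0%N x) = 0;
  rd_exact0 : gexact (rd 0%N) re;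
  rd_comp : forall i x, rd i (rd i.+1 x) = 0;
  rd_exact : forall i, gexact (rd i.+1) (rd i) }.

Section Boundary.
Variables (M : gmod) (P : gresol M).

(* The differential out of P_i, with P_{-1} = M. *)
Definition bd_tgt (i : nat) : gmod := if i is j.+1 then P j else M.
Definition bd (i : nat) : P i -> bd_tgt i :=
  match i with 0%N => re P | j.+1 => rd P j end.

Lemma bd_hom i : ghom (@bd i).
Proof. by case: i => [|i]; [exact: re_hom | exact: rd_hom]. Qed.

Lemma bd_exact i : gexact (rd P i) (@bd i).
Proof. by case: i => [|i]; [exact: rd_exact0 | exact: rd_exact]. Qed.

End Boundary.

Definition chain_map (M N : gmod) (P : gresol M) (Q : gresol N) (u : M -> N)
    (alpha : forall i, P i -> Q i) :=
  [/\ forall i, ghom (alpha i),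
      forall x, re Q (alpha 0%N x) = u (re P x)
    & forall i x, rd Q i (alpha i.+1 x) = alpha i (rd P i x)].

Lemma chain_map_comp (L M N : gmod) (O : gresol L) (P : gresol M)
    (Q : gresol N) u v (alpha : forall i, P i -> Q i)
    (beta : forall i, O i -> P i) :
  chain_map v alpha -> chain_map u beta ->
  chain_map (v \o u) (fun i => alpha i \o beta i).
Proof.
move=> [ah ae ad] [bh be b_d]; split=> [i|x|i x] /=.
- exact: ghom_comp.
- by rewrite ae be.
- by rewrite ad b_d.
Qed.

Lemma chain_map_id (M : gmod) (P : gresol M) :
  chain_map id (fun i => id : P i -> P i).
Proof. by split=> // i; exact: ghom_id. Qed.

Lemma chain_map_exists (M N : gmod) (P : gresol M) (Q : gresol N) (u : M -> N) :
  ghom u -> exists alpha : forall i, P i -> Q i, chain_map u alpha.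
Proof.
move=> hu; have ul := hu.1; have u0 : u 0 = 0.
  by have := ul (-1) 0 0; rewrite scaler0 addr0 scaleN1r addNr.
(* The next lift exists once [f] sends boundaries to cycles, so this property is carried along the
   recursion. *)
pose good i (f : P i -> Q i) := ghom f /\ forall x, bd (f (rd P i x)) = 0.
have [f0 f0h f0E] : exists2 f0 : P 0%N -> Q 0%N, ghom f0 &
    forall x, re Q (f0 x) = u (re P x).
  (* Against the zero map, exactness is surjectivity of [re Q] in every degree. *)
  apply: (@rP_proj _ P 0%N _ _ _ (re Q) (fun _ => 0 : N)).
  - exact: re_hom.
  - exact: ghom_zero.
  - by move=> n y yN _; exact: re_surj.
  - exact: ghom_comp hu (re_hom P).
  - by [].
have f0_good : good 0%N f0.
  by split=> // x /=; rewrite f0E rd_comp0.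
have step i (f : P i -> Q i) : good i f ->
    {g : P i.+1 -> Q i.+1 | good i.+1 g /\ forall x, rd Q i (g x) = f (rd P i x)}.
  move=> [fh fE]; apply: cid.
  have [g gh gE] := @rP_proj _ P i.+1 _ _ _ (rd Q i) (@bd _ Q i)
    (f \o rd P i) (rd_hom Q i) (bd_hom Q i) (@bd_exact _ Q i)
    (ghom_comp fh (rd_hom P i)) fE.
  exists g; split=> //; split=> // x /=.
  rewrite gE /= rd_comp; have := fh.1 (-1) 0 0.
  by rewrite scaler0 addr0 scaleN1r addNr.
pose al := nat_rect (fun i => {f : P i -> Q i | good i f}) (exist _ f0 f0_good)
  (fun i f => exist _ (sval (step i (sval f) (svalP f)))
                      (svalP (step i (sval f) (svalP f))).1).
exists (fun i => sval (al i)); split=> [i|x|i x]; first exact: (svalP (al i)).1.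
  exact: f0E.
by rewrite /= (svalP (step i (sval (al i)) (svalP (al i)))).2.
Qed.

Lemma chain_homotopy (M N : gmod) (P : gresol M) (Q : gresol N) (u : M -> N)
    (alpha beta : forall i, P i -> Q i) :
  chain_map u alpha -> chain_map u beta ->
  exists s : forall i, P i -> Q i.+1,
    [/\ forall i, ghom (s i),
        forall x, alpha 0%N x - beta 0%N x = rd Q 0%N (s 0%N x)
      & forall i x, alpha i.+1 x - beta i.+1 x =
          rd Q i.+1 (s i.+1 x) + s i (rd P i x)].
Proof.
move=> [ah ae ad] [bh be b_d].
pose phi i x := alpha i x - beta i x.
have phih i : ghom (phi i) by exact: ghom_sub.
have phid i x : rd Q i (phi i.+1 x) = phi i (rd P i x).
  by rewrite /phi raddfB /= ad b_d.
(* The map to be lifted next, the difference of the chain maps minus s d, must take its values in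
   cycles. *)
pose good i (s : P i -> Q i.+1) := ghom s /\
  forall x, rd Q i (phi i.+1 x - s (rd P i x)) = 0.
have [s0 s0h s0E] : exists2 s0 : P 0%N -> Q 1%N, ghom s0 &
    forall x, rd Q 0%N (s0 x) = phi 0%N x.
  apply: (@rP_proj _ P 0%N _ _ _ (rd Q 0%N) (re Q)).
  - exact: rd_hom.
  - exact: re_hom.
  - exact: rd_exact0.
  - exact: phih.
  - by move=> x; rewrite /phi raddfB /= ae be subrr.
have s0_good : good 0%N s0.
  by split=> // x; rewrite raddfB /= phid s0E subrr.
have step i (s : P i -> Q i.+1) : good i s ->
    {t : P i.+1 -> Q i.+2 | good i.+1 t /\
      forall x, phi i.+1 x = rd Q i.+1 (t x) + s (rd P i x)}.
  move=> [sh sE]; apply: cid.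
  have [t th tE] := @rP_proj _ P i.+1 _ _ _ (rd Q i.+1) (rd Q i)
    (fun x => phi i.+1 x - s (rd P i x)) (rd_hom Q i.+1) (rd_hom Q i)
    (@rd_exact _ Q i) (ghom_sub (phih i.+1) (ghom_comp sh (rd_hom P i))) sE.
  exists t; split=> [|x]; last by rewrite tE subrK.
  split=> // x; rewrite raddfB /= phid tE rd_comp.
  have -> : s 0 = 0.
    by have := sh.1 (-1) 0 0; rewrite scaler0 addr0 scaleN1r addNr.
  by rewrite subr0 subrr.
pose al := nat_rect (fun i => {s : P i -> Q i.+1 | good i s}) (exist _ s0 s0_good)
  (fun i s => exist _ (sval (step i (sval s) (svalP s)))
                      (svalP (step i (sval s) (svalP s))).1).
exists (fun i => sval (al i)); split=> [i|x|i x]; first exact: (svalP (al i)).1.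
  by rewrite /= s0E.
exact: (svalP (step i (sval (al i)) (svalP (al i)))).2.
Qed.

Section Cohomology.
Variable X : gmod.

Definition ghomX (M : gmod) (P : gresol M) i (f : P i -> X) := ghom f.

Definition gcocycle (M : gmod) (P : gresol M) i (f : P i -> X) :=
  cocycle (rd P) (@ghomX M P) f.
Definition gcobound (M : gmod) (P : gresol M) i (f : P i -> X) :=
  coboundary (rd P) (@ghomX M P) f.

Lemma gcobound_ext (M : gmod) (P : gresol M) i (f g : P i -> X) :
  f =1 g -> gcobound f -> gcobound g.
Proof.
case: i f g => [|i] f g fg /=; first by move=> f0 x; rewrite -fg.
by case=> h hh hE; exists h => // x; rewrite -fg.
Qed.

Lemma gcocycle_comp (M N : gmod) (P : gresol M) (Q : gresol N) u
    (alpha : forall i, P i -> Q i) i (f : Q i -> X) :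
  chain_map u alpha -> gcocycle f -> gcocycle (f \o alpha i).
Proof.
move=> [ah ae ad] [fh fd]; split; first exact: (ghom_comp fh (ah i)).
by move=> x /=; rewrite -ad fd.
Qed.

Lemma gcobound_comp (M N : gmod) (P : gresol M) (Q : gresol N) u
    (alpha : forall i, P i -> Q i) i (f : Q i -> X) :
  chain_map u alpha -> gcobound f -> gcobound (f \o alpha i).
Proof.
move=> [ah ae ad]; case: i f => [|i] f; first by move=> f0 x /=; rewrite f0.
case=> g gh gE; exists (g \o alpha i); first exact: (ghom_comp gh (ah i)).
by move=> x /=; rewrite gE ad.
Qed.

Lemma gcobound_homotopy (M N : gmod) (P : gresol M) (Q : gresol N) u
    (alpha beta : forall i, P i -> Q i) i (f : Q i -> X) :
  chain_map u alpha -> chain_map u beta -> gcocycle f ->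
  gcobound (fun x => f (alpha i x) - f (beta i x)).
Proof.
move=> ha hb [fh fd]; have [s [sh s0E sE]] := chain_homotopy ha hb.
pose F := mklin fh.1; have FB x y : f x - f y = f (x - y).
  by rewrite -[f]/(F : _ -> _) raddfB.
case: i f fh fd @F FB => [|i] f fh fd F FB /=.
  by move=> x; rewrite FB s0E fd.
exists (f \o s i); first exact: (ghom_comp fh (sh i)).
by move=> x /=; rewrite FB sE -[f]/(F : _ -> _) raddfD /= fd add0r.
Qed.

Lemma gcobound_sub (M : gmod) (P : gresol M) i (f g : P i -> X) :
  gcobound f -> gcobound g -> gcobound (fun x => f x - g x).
Proof.
case: i f g => [|i] f g /=; first by move=> f0 g0 x; rewrite f0 g0 subrr.
move=> [f' f'h f'E] [g' g'h g'E]; exists (fun x => f' x - g' x).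
  exact: ghom_sub.
by move=> x; rewrite f'E g'E.
Qed.

(** As v after u is the identity, [beta] after [alpha] is homotopic to the identity, so f and its
    pullback along both have the same class. Since M need only be a retract of N, this serves both a
    change of resolution and the passage to a direct summand. *)
Lemma gcobound_retract (M N : gmod) (P : gresol M) (Q : gresol N) u v
    (alpha : forall i, P i -> Q i) (beta : forall i, Q i -> P i) i
    (f : P i -> X) :
  chain_map u alpha -> chain_map v beta -> v \o u =1 id -> gcocycle f ->
  gcobound (f \o beta i) -> gcobound f.
Proof.
move=> ha hb vu fZ fB.
have hba : chain_map id (fun i => beta i \o alpha i).
  by have [h1 h2 h3] := chain_map_comp hb ha; split=> // x; rewrite h2 vu.
have := gcobound_sub (gcobound_comp ha fB)
  (gcobound_homotopy hba (chain_map_id P) fZ).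
by apply: gcobound_ext => x; rewrite /= opprB addrC subrK.
Qed.

End Cohomology.

End GradedModules.
Arguments gdeg {R I dsh gr} g n.

(** * Restriction along a homomorphism into matrices *)

Section MatrixMorphism.
Variables (J : finType) (A B : nzRingType).

(* A ring homomorphism B -> M_J(A). *)
Record mxmor := Mxmor {
  mxm :> B -> J -> J -> A;
  mxmD : forall b c x y, mxm (b + c) x y = mxm b x y + mxm c x y;
  mxmM : forall b c x z, mxm (b * c) x z = \sum_y mxm b x y * mxm c y z;
  mxm1 : forall x y, mxm 1 x y = (x == y)%:R }.

Lemma mxm0 (r : mxmor) x y : r 0 x y = 0.
Proof. by apply: (addrI (r 0 x y)); rewrite -mxmD !addr0. Qed.

Lemma mxm_sum (r : mxmor) I (s : seq I) (P : pred I) (F : I -> B) x y :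
  r (\sum_(i <- s | P i) F i) x y = \sum_(i <- s | P i) r (F i) x y.
Proof.
exact: (big_morph (fun b => r b x y) (fun a b => mxmD r a b x y) (mxm0 r x y)).
Qed.

Lemma mxmor_op_mul (r : mxmor) (b c : B^c) x z :
  r (b * c) z x = \sum_y (r b y x : A^c) * r c z y.
Proof. by rewrite -[b * c]/((c : B) * (b : B)) mxmM. Qed.

End MatrixMorphism.

Definition mxmor_op (J : finType) (A B : nzRingType) (r : mxmor J A B) :
    mxmor J A^c B^c :=
  @Mxmor J A^c B^c (fun b x y => r b y x) (fun b c x y => mxmD r b c y x)
    (fun b c x z => mxmor_op_mul r b c x z)
    (fun x y => etrans (mxm1 r y x) (congr1 (fun b : bool => b%:R) (eq_sym y x))).

(* M^J, as column vectors, restricted along r. *)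
Definition Tw (J : finType) (A B : nzRingType) (r : mxmor J A B)
  (M : lmodType A) : Type := {ffun J -> M}.

Section Twist.
Variables (J : finType) (A B : nzRingType) (r : mxmor J A B).
Local Notation Tw := (Tw r).

HB.instance Definition _ (M : lmodType A) := GRing.Zmodule.copy (Tw M) {ffun J -> M}.

Section Module.
Variable M : lmodType A.

Definition Tw_scale (b : B) (c : Tw M) : Tw M :=
  [ffun x => \sum_y r b x y *: c y].

Lemma Tw_scaleA a b c : Tw_scale a (Tw_scale b c) = Tw_scale (a * b) c.
Proof.
apply/ffunP => x; rewrite !ffunE.
under eq_bigr do rewrite ffunE scaler_sumr.
rewrite exchange_big; apply: eq_bigr => z _ /=.
by rewrite mxmM scaler_suml; apply: eq_bigr => y _; rewrite scalerA.
Qed.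

Lemma sum_delta (c : J -> M) x : \sum_y ((x == y)%:R : A) *: c y = c x.
Proof.
rewrite (bigD1 x) //= eqxx scale1r big1 ?addr0// => y.
by rewrite eq_sym => /negbTE ->; rewrite scale0r.
Qed.

Lemma Tw_scale1 : left_id 1 Tw_scale.
Proof.
move=> c; apply/ffunP => x; rewrite ffunE -[RHS]sum_delta.
by apply: eq_bigr => y _; rewrite mxm1.
Qed.

Lemma Tw_scaleDr : right_distributive Tw_scale +%R.
Proof.
move=> a c d; apply/ffunP => x; rewrite !ffunE -big_split.
by apply: eq_bigr => y _; rewrite ffunE scalerDr.
Qed.

Lemma Tw_scaleDl c : {morph Tw_scale^~ c : a b / a + b}.
Proof.
move=> a b; apply/ffunP => x; rewrite !ffunE -big_split.
by apply: eq_bigr => y _; rewrite mxmD scalerDl.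
Qed.

HB.instance Definition _ := GRing.Zmodule_isLmodule.Build B (Tw M)
  Tw_scaleA Tw_scale1 Tw_scaleDr Tw_scaleDl.

Lemma TwZE b (c : Tw M) x : (b *: c) x = \sum_y r b x y *: c y.
Proof. by rewrite ffunE. Qed.

Lemma TwDE (c d : Tw M) x : (c + d) x = c x + d x.
Proof. by rewrite ffunE. Qed.

Lemma Tw0E x : (0 : Tw M) x = 0.
Proof. by rewrite ffunE. Qed.

Definition inj_at (x : J) (m : M) : Tw M := [ffun y => if y == x then m else 0].

Lemma inj_atE x m y : inj_at x m y = if y == x then m else 0.
Proof. by rewrite ffunE. Qed.

Lemma inj_atD x m m' : inj_at x (m + m') = inj_at x m + inj_at x m'.
Proof. by apply/ffunP => y; rewrite !ffunE; case: ifP; rewrite ?addr0. Qed.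

Lemma sum_inj_at (c : Tw M) : \sum_x inj_at x (c x) = c.
Proof.
apply/ffunP => y; rewrite sum_ffunE (bigD1 y) //= ffunE eqxx big1 ?addr0// => x.
by rewrite ffunE eq_sym => /negbTE ->.
Qed.

Lemma Tw_inj_at b y m : b *: inj_at y m = \sum_x inj_at x (r b x y *: m).
Proof.
rewrite -[LHS]sum_inj_at; apply: eq_bigr => x _; congr inj_at.
rewrite TwZE (bigD1 y) //= inj_atE eqxx big1 ?addr0// => z /negbTE zy.
by rewrite inj_atE zy scaler0.
Qed.

End Module.

Section Map.
Variables (M N : lmodType A) (f : {linear M -> N}).

Definition Tw_map (c : Tw M) : Tw N := [ffun x => f (c x)].

Lemma Tw_map_linear : linear Tw_map.
Proof.
move=> b c d; apply/ffunP => x; rewrite !ffunE !raddfD raddf_sum /=; congr (_ + _).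
by apply: eq_bigr => y _; rewrite linearZ_LR ffunE.
Qed.

HB.instance Definition _ := GRing.isLinear.Build B (Tw M) (Tw N) *:%R Tw_map Tw_map_linear.

Lemma Tw_mapE c x : Tw_map c x = f (c x).
Proof. by rewrite ffunE. Qed.

Lemma Tw_map_inj_at x m : Tw_map (inj_at x m) = inj_at x (f m).
Proof. by apply/ffunP => y; rewrite !ffunE; case: ifP => // _; rewrite raddf0. Qed.

End Map.
End Twist.
Arguments Tw_map {J A B} r {M N} f c.

(** * Dual pairs of matrix homomorphisms *)

(** These are the identities of an adjunction written in coordinates. The first makes [inj_at]
    compatible with the actions, the second makes coordinate sums such as [adj2] linear;
    transposition exchanges them. *)
Definition mx_dual (J : finType) (A B : nzRingType) (r : mxmor J A B)
    (s : mxmor J B A) :=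
  (forall b x z, \sum_y s (r b x y) z y = (x == z)%:R * b) /\
  (forall b z w, \sum_x s (r b x z) x w = (z == w)%:R * b).

Lemma mx_dual_op (J : finType) (A B : nzRingType) (r : mxmor J A B)
    (s : mxmor J B A) : mx_dual r s -> mx_dual (mxmor_op r) (mxmor_op s).
Proof.
have mulC (b : B) (i : bool) : i%:R * b = b * i%:R by rewrite -commr_nat.
move=> [rs1 rs2]; split=> b x z.
  exact: etrans (rs2 b x z) (mulC b _).
exact: etrans (rs1 b x z) (mulC b _).
Qed.

Section Adjunction.
Variables (J : finType) (A B : nzRingType).
Variables (r : mxmor J A B) (s : mxmor J B A).
Hypotheses (rs : mx_dual r s) (sr : mx_dual s r).

(** In other words, n |-> (inj_at s x n)_x is B-linear from N to its double image: it is the unit of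
    the adjunction. *)
Lemma inj_at_scale (N : lmodType B) x b (n : N) :
  inj_at s x (b *: n) = \sum_y r b x y *: inj_at s y n.
Proof.
under [RHS]eq_bigr do rewrite Tw_inj_at.
rewrite exchange_big /= (bigD1 x) //= [X in _ + X]big1 ?addr0 => [|z zx].
  apply/ffunP => y; rewrite sum_ffunE inj_atE; have [-> | yx] := eqVneq.
    under eq_bigr do rewrite inj_atE eqxx.
    by rewrite -scaler_suml rs.1 eqxx mul1r.
  by rewrite big1// => z _; rewrite inj_atE (negbTE yx).
apply/ffunP => y; rewrite sum_ffunE [RHS]ffunE; have [-> | yz] := eqVneq y z.
  under eq_bigr do rewrite inj_atE eqxx.
  by rewrite -scaler_suml rs.1 eq_sym (negbTE zx) mul0r scale0r.
by rewrite big1// => w _; rewrite inj_atE (negbTE yz).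
Qed.

Section Adjoint.
Variables (N : lmodType B) (X : lmodType A).

(** The two directions of the adjunction Hom_A(Tw s N, X) = Hom_B(N, Tw r X). *)
Definition adj1 (f : Tw s N -> X) (n : N) : Tw r X :=
  [ffun x => f (inj_at s x n)].
Definition adj2 (F : N -> Tw r X) (c : Tw s N) : X := \sum_x F (c x) x.

Lemma adj1_linear f : linear f -> linear (adj1 f).
Proof.
move=> /linearE[{}f ->] b m n; apply/ffunP => x.
rewrite [adj1 _ _ _]ffunE inj_atD raddfD TwDE TwZE.
rewrite inj_at_scale raddf_sum ffunE; congr (_ + _).
by apply: eq_bigr => y _; rewrite /= linearZ_LR ffunE.
Qed.

Lemma adj2_linear F : linear F -> linear (adj2 F).
Proof.
move=> /linearE[{}F ->] a c d; rewrite /adj2.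
under eq_bigr do rewrite TwDE raddfD TwDE.
rewrite big_split /=; congr (_ + _).
under eq_bigr do rewrite TwZE raddf_sum sum_ffunE.
rewrite exchange_big /= scaler_sumr; apply: eq_bigr => y _.
under eq_bigr do rewrite /= linearZ_LR TwZE.
rewrite exchange_big /=; under eq_bigr do rewrite -scaler_suml sr.2.
rewrite (bigD1 y) //= eqxx mul1r big1 ?addr0// => z.
by rewrite eq_sym => /negbTE ->; rewrite mul0r scale0r.
Qed.

Lemma adj1K f : linear f -> adj2 (adj1 f) =1 f.
Proof.
move=> /linearE[{}f ->] c; rewrite /adj2 -[in RHS](sum_inj_at c).
rewrite raddf_sum; apply: eq_bigr => x _.
by rewrite ffunE.
Qed.

End Adjoint.

(** A left adjoint of a functor that preserves surjections preserves projectives: the adjoint map is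
    lifted and carried back. *)
Lemma Tw_projective (P : lmodType B) :
  projective P -> projective (Tw s P : lmodType A).
Proof.
move=> Pproj U W p f psurj.
have fl : linear f by move=> ? ? ?; rewrite linearP.
have [|g gE] := Pproj (Tw r U) (Tw r W) (Tw_map r p)
  (mklin (adj1_linear fl)).
  move=> c; have [h hP] := choice psurj.
  by exists [ffun x => h (c x)]; apply/ffunP => x; rewrite !ffunE hP.
have gl : linear g by move=> ? ? ?; rewrite linearP.
exists (mklin (adj2_linear gl)) => c /=.
rewrite -[RHS](adj1K fl) raddf_sum; apply: eq_bigr => x _.
by have := gE (c x) => /ffunP/(_ x); rewrite /= Tw_mapE.
Qed.

(** The unit followed by the trace c |-> sum_x c x x is multiplication by |J|, which [v] undoes.
    Centrality of [v] keeps the scaled trace linear. *)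
Lemma Tw_retract (N : lmodType B) (v : B) :
  (forall b, v * b = b * v) -> v *+ #|J| = 1 ->
  exists (i : {linear N -> Tw r (Tw s N)}) (p : {linear Tw r (Tw s N) -> N}),
    forall n, p (i n) = n.
Proof.
move=> vC v1.
have il : linear (adj1 (id : Tw s N -> Tw s N)) by exact: adj1_linear.
pose tr (c : Tw r (Tw s N)) := v *: \sum_x c x x.
have trl : linear tr.
  move=> b c d; rewrite /tr scalerA -vC -scalerA -scalerDr; congr (_ *: _).
  under eq_bigr do rewrite 2!TwDE TwZE sum_ffunE.
  rewrite big_split /=; congr (_ + _).
  rewrite exchange_big /= scaler_sumr; apply: eq_bigr => y _.
  under eq_bigr do rewrite TwZE.
  rewrite exchange_big /=; under eq_bigr do rewrite -scaler_suml rs.2.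
  rewrite (bigD1 y) //= eqxx mul1r big1 ?addr0// => z.
  by rewrite eq_sym => /negbTE ->; rewrite mul0r scale0r.
exists (mklin il), (mklin trl) => n; rewrite /= /tr /adj1.
under eq_bigr do rewrite ffunE inj_atE eqxx.
by rewrite sumr_const -scalerMnr scalerMnl v1 scale1r.
Qed.

Section Graded.
Variables (I : Type) (dsh : nat -> I -> I).
Variables (grA : nat -> {pred A}) (grB : nat -> {pred B}).
Hypothesis r_gr : forall n b x y, b \in grB n -> r b x y \in grA n.

Section GradedTw.
Variable M : gmod dsh grA.

Definition Tw_deg (n : I) : {pred Tw r M} :=
  [pred c | [forall x, (c : Tw r M) x \in gdeg M n]].

Lemma Tw_degP n (c : Tw r M) : reflect (forall x, c x \in gdeg M n) (c \in Tw_deg n).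
Proof. exact: forallP. Qed.

Lemma gdeg_sum K (t : seq K) (P : pred K) (F : K -> M) n :
  (forall i, P i -> F i \in gdeg M n) -> \sum_(i <- t | P i) F i \in gdeg M n.
Proof.
have [M0 MB] := gdeg_zmod M n; move=> FM.
apply: (big_ind (fun x => x \in gdeg M n)) => // x y xM yM.
by rewrite -[y]opprK MB// -sub0r MB.
Qed.

Lemma Tw_deg_zmod n : zmod_closed (Tw_deg n).
Proof.
have [M0 MB] := gdeg_zmod M n.
split=> [|c d /Tw_degP cM /Tw_degP dM]; apply/Tw_degP => x; first by rewrite ffunE.
by rewrite !ffunE MB.
Qed.

Lemma Tw_deg_scale m n b c :
  b \in grB m -> c \in Tw_deg n -> b *: c \in Tw_deg (dsh m n).
Proof.
move=> bm /Tw_degP cn; apply/Tw_degP => x; rewrite TwZE.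
by apply: gdeg_sum => y _; apply: gdeg_scale => //; exact: r_gr.
Qed.

Definition gTw : gmod dsh grB := @Gmod _ I dsh grB (Tw r M) Tw_deg Tw_deg_zmod Tw_deg_scale.

End GradedTw.

Lemma gTw_map (M N : gmod dsh grA) (f : {linear M -> N}) :
  ghom f -> @ghom _ _ _ grB (gTw M) (gTw N) (Tw_map r f).
Proof.
move=> [_ fd]; split=> [a c d|n c /Tw_degP cM]; first by rewrite linearP.
by apply/Tw_degP => x; rewrite Tw_mapE fd.
Qed.

Lemma gTw_exact (U V W : gmod dsh grA) (p : {linear U -> V}) (q : {linear V -> W}) :
  gexact p q ->
  gexact (Tw_map r p : gTw U -> gTw V) (Tw_map r q : gTw V -> gTw W).
Proof.
move=> pq n c /Tw_degP cV qc.
have /choice[h hP] x : exists u, u \in gdeg U n /\ p u = c x.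
  have [|u uU <-] := pq n (c x) (cV x); last by exists u.
  by have /ffunP/(_ x) := qc; rewrite Tw_mapE Tw0E.
exists ([ffun x => h x] : Tw r U); last first.
  by apply/ffunP => x; rewrite !ffunE (hP x).2.
by apply/Tw_degP => x; rewrite ffunE (hP x).1.
Qed.

End Graded.
End Adjunction.

Section GradedTwist.
Variables (J : finType) (A B : nzRingType).
Variables (r : mxmor J A B) (s : mxmor J B A).
Hypotheses (rs : mx_dual r s) (sr : mx_dual s r).
Variables (I : Type) (dsh : nat -> I -> I).
Variables (grA : nat -> {pred A}) (grB : nat -> {pred B}).
Hypothesis r_gr : forall n b x y, b \in grB n -> r b x y \in grA n.
Hypothesis s_gr : forall n a x y, a \in grA n -> s a x y \in grB n.

Lemma inj_at_deg (N : gmod dsh grB) x n m :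
  m \in gdeg N n -> inj_at s x m \in gdeg (gTw s_gr N) n.
Proof.
move=> mN; apply/Tw_degP => y; rewrite inj_atE; case: ifP => // _.
by case: (gdeg_zmod N n).
Qed.

(** The adjoint map is lifted against the image of the whole pair [p], [q], which stays exact degree
    by degree; both directions of the adjunction preserve degrees because [inj_at] does. *)
Lemma gTw_proj (P : gmod dsh grB) : gproj P -> gproj (gTw s_gr P).
Proof.
move=> Pproj U V W p q f hp hq pq [fl fd] qf.
have [p' pE] := linearE hp.1; have [q' qE] := linearE hq.1; subst p q.
have [||g gh gE] := Pproj (gTw r_gr U) (gTw r_gr V) (gTw r_gr W)
  (Tw_map r p') (Tw_map r q') (adj1 r f : P -> gTw r_gr V) (gTw_map r_gr hp)
  (gTw_map r_gr hq) (gTw_exact pq).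
- split; first exact: adj1_linear.
  move=> n x xP; apply/Tw_degP => y; rewrite ffunE.
  exact/fd/inj_at_deg.
- by move=> x; apply/ffunP => y; rewrite !ffunE qf.
have [gl gd] := gh; exists (adj2 g).
  split; first exact: adj2_linear.
  move=> n c /Tw_degP cP; rewrite /adj2; apply: gdeg_sum => x _.
  by have /Tw_degP := gd _ _ (cP x); exact.
move=> c /=; rewrite -[RHS](adj1K r fl) raddf_sum; apply: eq_bigr => x _.
by have := gE (c x) => /ffunP/(_ x); rewrite /= Tw_mapE.
Qed.

Lemma Tw_map_comp0 (L M N : lmodType B) (f : {linear L -> M}) (g : {linear M -> N}) :
  (forall x, g (f x) = 0) -> forall c, Tw_map s g (Tw_map s f c) = 0.
Proof. by move=> gf c; apply/ffunP => x; rewrite !Tw_mapE gf Tw0E. Qed.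

Lemma gTw_surj (M N : gmod dsh grB) (f : {linear M -> N}) :
  (forall n y, y \in gdeg N n -> exists2 x, x \in gdeg M n & f x = y) ->
  forall n y, y \in gdeg (gTw s_gr N) n ->
  exists2 x, x \in gdeg (gTw s_gr M) n & Tw_map s f x = y.
Proof.
move=> fsurj n c /Tw_degP cN.
have /choice[h hP] x : exists u, u \in gdeg M n /\ f u = c x.
  by have [u uU <-] := fsurj n (c x) (cN x); exists u.
exists ([ffun x => h x] : Tw s M); last first.
  by apply/ffunP => x; rewrite !ffunE (hP x).2.
by apply/Tw_degP => x; rewrite ffunE (hP x).1.
Qed.

Definition gTw_res (N : gmod dsh grB) (Q : gresol N) : gresol (gTw s_gr N) :=
  @Gresol _ _ _ grA (gTw s_gr N) (fun i => gTw s_gr (Q i))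
    (fun i => Tw_map s (rd Q i)) (Tw_map s (re Q))
    (fun i => gTw_map s_gr (rd_hom Q i)) (gTw_map s_gr (re_hom Q))
    (fun i => gTw_proj (@rP_proj _ _ _ _ _ Q i)) (gTw_surj (@re_surj _ _ _ _ _ Q))
    (Tw_map_comp0 (@rd_comp0 _ _ _ _ _ Q)) (gTw_exact (@rd_exact0 _ _ _ _ _ Q))
    (fun i => Tw_map_comp0 (rd_comp (i:=i))) (fun i => gTw_exact (@rd_exact _ _ _ _ _ Q i)).

End GradedTwist.

(** With every degree predicate full, a [ghom] into this module is just a linear map. The ring can
    thus be a target of homomorphisms whatever the grading of the source. *)
Definition gtriv (R : nzRingType) (I : Type) (dsh : nat -> I -> I)
  (gr : nat -> {pred R}) (M : lmodType R) : gmod dsh gr :=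
  @Gmod _ I dsh gr M (fun _ => predT) (fun n => conj isT (fun x y _ _ => isT))
    (fun m n a x _ _ => isT).

(** * Homomorphisms into the ring under twisting *)

Section Duality.
Variables (J : finType) (A B : nzRingType).
Variables (r : mxmor J A B) (s : mxmor J B A).
Hypotheses (rs : mx_dual r s) (sr : mx_dual s r).

Section Maps.
Variable N : lmodType B.

(* Hom_A(Tw s N, A) = Hom_B(N, B)^J *)
Definition split_dual (f : Tw s N -> A) (y : J) (n : N) : B :=
  \sum_x s (f (inj_at s x n)) x y.
Definition join_dual (F : J -> N -> B) (c : Tw s N) : A :=
  \sum_x \sum_y r (F y (c x)) x y.

Lemma split_dual_linear (f : Tw s N -> A^o) y :
  linear f -> linear (split_dual f y : N -> B^o).
Proof.
move=> /linearE[{}f ->] b m n; rewrite /split_dual.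
under eq_bigr do rewrite inj_atD raddfD mxmD.
rewrite big_split /=; congr (_ + _).
under eq_bigr do rewrite (inj_at_scale rs) raddf_sum mxm_sum.
under eq_bigr do under eq_bigr do rewrite /= linearZ_LR mxmM.
rewrite exchange_big /= /GRing.scale /= mulr_sumr; apply: eq_bigr => z _.
rewrite exchange_big /=; under eq_bigr do rewrite -mulr_suml rs.2.
rewrite (bigD1 z) //= eqxx mul1r big1 ?addr0// => w.
by rewrite eq_sym => /negbTE ->; rewrite !mul0r.
Qed.

Lemma join_dual_linear (F : J -> N -> B) :
  (forall y, linear (F y : N -> B^o)) -> linear (join_dual F : Tw s N -> A^o).
Proof.
move=> Fl a c d; rewrite /join_dual.
have FD y m n : F y (m + n) = F y m + F y n.
  by have /linearE[{}f ->] := Fl y; rewrite raddfD.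
have FS y K (t : seq K) (E : K -> N) : F y (\sum_(i <- t) E i) = \sum_(i <- t) F y (E i).
  by have /linearE[{}f ->] := Fl y; rewrite raddf_sum.
have FZ y b n : F y (b *: n) = b * F y n.
  by have /linearE[{}f ->] := Fl y; rewrite linearZ_LR.
under eq_bigr do under eq_bigr do rewrite TwDE FD mxmD.
under eq_bigr do rewrite big_split.
rewrite big_split /=; congr (_ + _).
under eq_bigr do under eq_bigr do rewrite TwZE FS mxm_sum.
under eq_bigr do under eq_bigr do under eq_bigr do rewrite FZ mxmM.
under eq_bigr do rewrite exchange_big.
rewrite exchange_big /= /GRing.scale /= mulr_sumr; apply: eq_bigr => z _.
rewrite exchange_big /= mulr_sumr; apply: eq_bigr => y _.
rewrite exchange_big /=; under eq_bigr do rewrite -mulr_suml sr.2.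
rewrite (bigD1 z) //= eqxx mul1r big1 ?addr0// => w.
by rewrite eq_sym => /negbTE ->; rewrite !mul0r.
Qed.

Lemma split_dualK (f : Tw s N -> A) :
  linear (f : _ -> A^o) -> join_dual (split_dual f) =1 f.
Proof.
move=> /linearE[{}f ->] c; rewrite /join_dual -[in RHS](sum_inj_at c).
rewrite raddf_sum; apply: eq_bigr => x _.
under eq_bigr do rewrite mxm_sum; rewrite exchange_big /=.
under eq_bigr do rewrite sr.1.
rewrite (bigD1 x) //= eqxx mul1r big1 ?addr0// => w.
by rewrite eq_sym => /negbTE ->; rewrite !mul0r.
Qed.

Lemma join_dualK (F : J -> N -> B) :
  (forall y, linear (F y : N -> B^o)) ->
  forall y, split_dual (join_dual F) y =1 F y.
Proof.
move=> Fl y n; rewrite /split_dual /join_dual.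
have F0 z : F z 0 = 0 by have /linearE[f ->] := Fl z; rewrite raddf0.
have E x : \sum_x' \sum_z r (F z (inj_at s x n x')) x' z = \sum_z r (F z n) x z.
  rewrite (bigD1 x) //= [X in _ + X]big1 ?addr0 => [|w /negbTE wx].
    by apply: eq_bigr => z _; rewrite inj_atE eqxx.
  by apply: big1 => z _; rewrite inj_atE wx F0 mxm0.
under eq_bigr do rewrite E mxm_sum; rewrite exchange_big /=.
under eq_bigr do rewrite rs.2.
rewrite (bigD1 y) //= eqxx mul1r big1 ?addr0// => w.
by move=> /negbTE ->; rewrite !mul0r.
Qed.

(** Right multiplication by a acts on J-tuples of maps through the transpose of [s]. The
    identification of the duals is therefore one of right A-modules, with the tuples restricted
    along [mxmor_op s]. *)
Lemma join_dualM (F : J -> N -> B) a c :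
  join_dual (fun y n => \sum_z F z n * s a z y) c = join_dual F c * a.
Proof.
rewrite /join_dual mulr_suml; apply: eq_bigr => x _.
under eq_bigr do rewrite mxm_sum.
under eq_bigr do under eq_bigr do rewrite mxmM.
rewrite exchange_big /= mulr_suml; apply: eq_bigr => z _.
rewrite exchange_big /=; under eq_bigr do rewrite -mulr_sumr sr.1.
rewrite (bigD1 z) //= eqxx mul1r big1 ?addr0// => w.
by rewrite eq_sym => /negbTE ->; rewrite mul0r mulr0.
Qed.

Lemma join_dualD (F G : J -> N -> B) c :
  join_dual (fun y n => F y n + G y n) c = join_dual F c + join_dual G c.
Proof.
rewrite /join_dual -big_split; apply: eq_bigr => x _.
by rewrite -big_split; apply: eq_bigr => y _; rewrite mxmD.
Qed.

Lemma eq_join_dual (F G : J -> N -> B) :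
  (forall y n, F y n = G y n) -> join_dual F =1 join_dual G.
Proof.
by move=> FG c; apply: eq_bigr => x _; apply: eq_bigr => y _; rewrite FG.
Qed.

End Maps.

Lemma split_dual_comp (M N : lmodType B) (d : {linear M -> N}) (f : Tw s N -> A) y m :
  split_dual (fun c => f (Tw_map s d c)) y m = split_dual f y (d m).
Proof. by apply: eq_bigr => x _; rewrite Tw_map_inj_at. Qed.

Lemma join_dual_comp (M N : lmodType B) (d : {linear M -> N}) (F : J -> N -> B) c :
  join_dual (fun y m => F y (d m)) c = join_dual F (Tw_map s d c).
Proof. by apply: eq_bigr => x _; apply: eq_bigr => y _; rewrite Tw_mapE. Qed.

Variables (I : Type) (dsh : nat -> I -> I).
Variables (grA : nat -> {pred A}) (grB : nat -> {pred B}).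
Hypothesis r_gr : forall n b x y, b \in grB n -> r b x y \in grA n.
Hypothesis s_gr : forall n a x y, a \in grA n -> s a x y \in grB n.
Variables (N : gmod dsh grB) (Q : gresol N).

Let XA : gmod dsh grA := gtriv dsh grA A^o.
Let XB : gmod dsh grB := gtriv dsh grB B^o.
Let TQ := gTw_res rs sr r_gr s_gr Q.

Lemma split_cocycle i (f : TQ i -> XA) y :
  gcocycle f -> gcocycle (split_dual f y : Q i -> XB).
Proof.
move=> [[fl _] fd]; split; first by split=> //; exact: split_dual_linear.
move=> x; rewrite -split_dual_comp; apply: big1 => z _.
by rewrite fd mxm0.
Qed.

Lemma join_cocycle i (F : J -> Q i -> XB) :
  (forall y, gcocycle (F y)) -> gcocycle (join_dual F : TQ i -> XA).
Proof.
move=> FZ; split.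
  by split=> //; apply: join_dual_linear => y; have [[]] := FZ y.
move=> c; rewrite -[LHS](join_dual_comp (rd Q i) F).
apply: big1 => x _; apply: big1 => y _; have [_ ->] := FZ y; exact: (mxm0 r x y).
Qed.

Lemma join_cobound i (F : J -> Q i -> XB) :
  (forall y, gcobound (F y)) -> gcobound (join_dual F : TQ i -> XA).
Proof.
case: i F => [|i] F FB /=.
  by move=> c; apply: big1 => x _; apply: big1 => y _; rewrite FB mxm0.
have /choice[G GP] y : exists g, ghomX g /\ forall x, F y x = g (rd Q i x).
  by have [g gh gE] := FB y; exists g.
exists (join_dual G).
  by split=> //; apply: join_dual_linear => y; have [[]] := GP y.
move=> c; rewrite -[RHS](join_dual_comp (rd Q i) G).
by apply: eq_join_dual => y n; rewrite (GP y).2.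
Qed.

Lemma split_cobound i (f : TQ i -> XA) y :
  gcobound f -> gcobound (split_dual f y : Q i -> XB).
Proof.
case: i f => [|i] f /=.
  by move=> f0 x; apply: big1 => z _; rewrite f0 mxm0.
move=> [g [gl _] gE]; exists (split_dual g y).
  by split=> //; exact: split_dual_linear.
move=> x; rewrite -split_dual_comp.
by apply: eq_bigr => z _; rewrite gE.
Qed.

Lemma cobound_split i (f : TQ i -> XA) :
  gcocycle f -> (forall y, gcobound (split_dual f y : Q i -> XB)) -> gcobound f.
Proof.
move=> [[fl _] _] /join_cobound; apply: gcobound_ext => c.
exact: split_dualK.
Qed.

Lemma cobound_join i (F : J -> Q i -> XB) :
  (forall y, gcocycle (F y)) -> gcobound (join_dual F : TQ i -> XA) ->
  forall y, gcobound (F y).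
Proof.
move=> FZ /split_cobound FB y; apply: gcobound_ext (FB y) => n.
by apply: join_dualK => z; have [[]] := FZ z.
Qed.

End Duality.

(** * Canonical resolutions and Ext *)

Section FreeProjective.
Variables (R : nzRingType) (I : Type) (dsh : nat -> I -> I) (gr : nat -> {pred R}).
Variables (K : choiceType) (deg : K -> I) (D : I -> {pred {freeg K / R}}).
Hypothesis D_zmod : forall n, zmod_closed (D n).
Hypothesis D_scale : forall m n a x, a \in gr m -> x \in D n -> a *: x \in D (dsh m n).
Hypothesis D_gen : forall x, << x >> \in D (deg x).
Hypothesis D_span : forall n v, v \in D n ->
  exists2 t : seq (R * K),
    forall p, p \in t -> exists2 m, p.1 \in gr m & dsh m (deg p.2) = n
  & v = \sum_(p <- t) << p.1 *g p.2 >>.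

(** The degrees [D] stay abstract so that both the graded and the ungraded free modules are
    instances; [D_span] is what makes the extension of a choice on the basis homogeneous. *)
Lemma free_gproj : gproj (Gmod D_zmod D_scale).
Proof.
move=> U V W p q f hp hq pq hf qf.
have /choice[h hP] x : exists u, u \in gdeg U (deg x) /\ p u = f << x >>.
  by have [|u uU uE] := pq (deg x) (f << x >>) (hf.2 _ _ (D_gen x)); [exact: qf | exists u].
exists (free_lift h).
  split=> [a x y|n v /D_span[t tD ->]]; first by rewrite linearP.
  rewrite raddf_sum big_seq; apply: gdeg_sum => z /tD[m zm <-] /=.
  by rewrite /free_lift liftU; apply: gdeg_scale => //; case: (hP z.2).
move=> x; have [f' fE] := linearE hf.1; have [p' pE] := linearE hp.1; subst f p.
rewrite -[x]freeg_sumE !raddf_sum; apply: eq_bigr => z _ /=.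
by rewrite /free_lift liftU linearZ_LR (hP z).2 -linearZ_LR free_scaleU mulr1.
Qed.

End FreeProjective.

Definition ung : nat -> unit -> unit := fun _ i => i.
Definition ungr (R : nzRingType) : nat -> {pred R} := fun _ => predT.
Definition umod (R : nzRingType) (M : lmodType R) : gmod ung (@ungr R) :=
  gtriv ung (@ungr R) M.

Section UngradedResolution.
Variable R : nzRingType.

Lemma umod_hom (M N : lmodType R) (f : M -> N) :
  linear f -> ghom (f : umod M -> umod N).
Proof. by []. Qed.

Lemma umod_exact (L M N : lmodType R) (f : L -> M) (g : M -> N) :
  exact f g -> gexact (f : umod L -> umod M) (g : umod M -> umod N).
Proof. by move=> fg n y _ /fg[x <-]; exists x. Qed.

Lemma exact_comp0 (L M N : lmodType R) (f : L -> M) (g : M -> N) :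
  exact f g -> forall x, g (f x) = 0.
Proof. by move=> fg x; apply/fg; exists x. Qed.

Lemma free_umod_gproj (K : choiceType) : gproj (umod {freeg K / R}).
Proof.
apply: (@free_gproj R unit ung (@ungr R) K (fun=> tt)) => // n v _.
exists [seq (coeff x v, x) | x <- dom v].
  by move=> p _; exists 0%N => //; case: n.
by rewrite big_map /= freeg_sumE.
Qed.

Variables (M : lmodType R) (P : nat -> lmodType R) (e : {linear P 0%N -> M}).
Variable d : forall i, {linear P i.+1 -> P i}.
Hypotheses (Pproj : forall i, gproj (umod (P i))) (esurj : surjective e).
Hypotheses (d0_exact : exact (d 0%N) e) (d_exact : forall i, exact (d i.+1) (d i)).

Lemma usurj (n : unit) (y : umod M) : y \in gdeg (umod M) n ->
  exists2 x : umod (P 0%N), x \in gdeg (umod (P 0%N)) n & e x = y.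
Proof. by move=> _; have [x] := esurj y; exists x. Qed.

Definition ures : gresol (umod M) :=
  @Gresol _ _ ung (@ungr R) (umod M) (fun i => umod (P i)) d e
    (fun i => umod_hom (linearP (d i))) (umod_hom (linearP e)) Pproj usurj
    (exact_comp0 d0_exact) (umod_exact d0_exact)
    (fun i => exact_comp0 (@d_exact i)) (fun i => umod_exact (@d_exact i)).

Lemma A_linear_ghom i (f : P i -> R) :
  A_linear (f : cochain P i) <-> ghom (f : ures i -> umod R^o).
Proof. by split=> [fl|[]]; [exact: umod_hom | ]. Qed.

Variable i : nat.

Lemma cocyclesP (f : P i -> R) :
  reflect (gcocycle (f : ures i -> umod R^o)) ((f : cochain P i) \in
    lspan (@cocycles R P d i)).
Proof.
rewrite lspan_closed; last exact: cocycles_submod.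
by apply: (iffP (asboolP _)) => -[fl fd]; split=> //; apply/A_linear_ghom.
Qed.

Lemma coboundaryE (f : P i -> R) :
  coboundary d (@A_linear R P) (f : cochain P i) <->
  gcobound (f : ures i -> umod R^o).
Proof.
by case: i f => [|j] f //=; split=> -[g gl gE]; exists g => //; apply/A_linear_ghom.
Qed.

Definition coh_class (f : P i -> R) (fZ : gcocycle (f : ures i -> umod R^o)) :
  dual_cohomology d i := quot_pi _ (Submodule (introT (cocyclesP f) fZ)).

Lemma coh_class_surj (x : dual_cohomology d i) : exists f fZ, x = @coh_class f fZ.
Proof.
have [[f fZ] ->] := quot_piP x; exists f, (elimT (cocyclesP f) fZ).
by congr quot_pi; apply: val_inj.
Qed.

Lemma coh_class_eq0 f fZ :
  @coh_class f fZ = 0 <-> gcobound (f : ures i -> umod R^o).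
Proof.
have z0 : (0 : dual_cohomology d i) = quot_pi _ 0.
  by apply: (addrI (quot_pi _ 0)); rewrite -quot_piD !addr0.
rewrite z0; split=> [/eqP|H]; last apply/eqP; rewrite quot_piE lspan_closed;
  try exact: coboundaries_submod.
  by rewrite subr0 => /coboundariesP/coboundaryE.
by rewrite subr0; apply/coboundariesP/coboundaryE.
Qed.

Lemma coh_classZD (a : R^c) (f g h : P i -> R) fZ gZ hZ :
  (forall x, h x = f x * (a : R) + g x) ->
  a *: @coh_class f fZ + @coh_class g gZ = @coh_class h hZ.
Proof.
move=> hE; rewrite /coh_class.
rewrite -[a *: quot_pi _ _]/(quot_scale a (quot_pi _ _)) -quot_piZ -quot_piD.
congr quot_pi; apply: val_inj; apply: etrans (submod_valP _ _ _) _ => /=.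
by apply: funext => x; rewrite hE.
Qed.

End UngradedResolution.

(* Ext computed from a resolution that no longer unfolds to the iterated free
   covers of res, with which unification is intractable. *)
Record ext_model (R : nzRingType) (M : lmodType R) := ExtModel {
  em_res :> gresol (umod M);
  em_class : forall i (f : em_res i -> umod R^o), gcocycle f -> Ext M i;
  em_surj : forall i (x : Ext M i), exists f fZ, x = @em_class i f fZ;
  em_eq0 : forall i f fZ, @em_class i f fZ = 0 <-> gcobound f;
  em_ZD : forall i (a : R^c) (f g h : em_res i -> R) fZ gZ hZ,
    (forall x, h x = f x * (a : R) + g x) ->
    a *: @em_class i f fZ + @em_class i g gZ = @em_class i h hZ }.

Section CanonicalResolution.
Variables (R : nzRingType) (M : lmodType R).

(* exact_no_check: the kernel converts the iterated covers quickly, unification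
   does not. *)
Lemma res_proj i : gproj (umod (res M i)).
Proof.
exact_no_check (@free_umod_gproj R
  (kernel_of (iter i (@free_cover R) (Arrow (\0 : {linear M -> M}))))).
Qed.

Lemma res_surj : surjective (res_arrow M 0 : {linear res M 0 -> M}).
Proof.
move=> y; have [+ _] := @free_cover_exact _ (Arrow (\0 : {linear M -> M})) y.
by case=> // x xE; exists x.
Qed.

(** Exactness is named over an arbitrary sequence so that the facts about [res] can be handed on
    without unfolding its iterated covers. *)
Definition aug_exact (P : nat -> lmodType R) (e : {linear P 0%N -> M})
  (d : forall i, {linear P i.+1 -> P i}) := exact (d 0%N) e.
Definition diff_exact (P : nat -> lmodType R)
  (d : forall i, {linear P i.+1 -> P i}) := forall i, exact (d i.+1) (d i).

Lemma res_aug_exact : aug_exact (res_arrow M 0) (@res_diff R M).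
Proof. exact_no_check (free_cover_exact (f := res_arrow M 0)). Qed.

Lemma res_diff_exact : diff_exact (@res_diff R M).
Proof.
move=> i; exact_no_check (free_cover_exact
  (f := iter i.+2 (@free_cover R) (Arrow (\0 : {linear M -> M})))).
Qed.

(** Behind the existential the resolution becomes opaque; only the interface of [ext_model] remains
    visible to its users. *)
Lemma ext_model_exists : exists _ : ext_model M, True.
Proof.
exists (@ExtModel R M (ures res_proj res_surj res_aug_exact res_diff_exact)
  (@coh_class _ _ _ _ _ res_proj res_surj res_aug_exact res_diff_exact)
  (@coh_class_surj _ _ _ _ _ res_proj res_surj res_aug_exact res_diff_exact)
  (@coh_class_eq0 _ _ _ _ _ res_proj res_surj res_aug_exact res_diff_exact)
  (@coh_classZD _ _ _ _ _ res_proj res_surj res_aug_exact res_diff_exact)).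
by [].
Qed.

End CanonicalResolution.

Lemma ext_neq0P (R : nzRingType) (M : lmodType R) (Q : ext_model M) i :
  (exists x : Ext M i, x != 0) <->
  exists2 f : Q i -> umod R^o, gcocycle f & ~ gcobound f.
Proof.
split=> [[x]|[f fZ fB]].
  have [f [fZ ->]] := em_surj Q x => /eqP xN; exists f => // fB; apply: xN.
  exact/em_eq0.
by exists (em_class fZ); apply/eqP => /em_eq0.
Qed.

(** * Ext and grade under twisting *)

Section ExtClasses.
Variables (R : nzRingType) (M : lmodType R) (Q : ext_model M) (i : nat).

(** A relation replaces [em_class], which takes a proof as argument, so that computations with
    classes can be made on representatives. *)
Definition ext_rep (f : Q i -> R) (x : Ext M i) :=
  exists fZ : gcocycle (f : Q i -> umod R^o), x = em_class fZ.

Lemma ext_rep_exists x : exists f, ext_rep f x.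
Proof. by have [f fZx] := em_surj Q x; exists f. Qed.

Lemma ext_rep_ZD (a : R) f g x y : ext_rep f x -> ext_rep g y ->
  ext_rep (fun m => f m * a + g m) ((a : R^c) *: x + y).
Proof.
move=> [fZ ->] [gZ ->].
have hZ : gcocycle (fun m => f m * a + g m : umod R^o).
  case: (fZ) (gZ) => [[fl _] fd] [[gl _] gd]; split=> [|m]; last first.
    by rewrite fd gd mul0r addr0.
  split=> // b m n; rewrite fl gl.
  by rewrite -![_ *: _]/(_ * _ : R) mulrDl mulrDr -!mulrA addrACA.
by exists hZ; exact: em_ZD.
Qed.

Lemma ext_rep0 : ext_rep (fun=> 0) 0.
Proof.
have zZ : gcocycle ((fun=> 0) : Q i -> umod R^o).
  by split=> //; exact: ghom_zero.
exists zZ; apply/esym/em_eq0; case: (i) zZ => [|j] _ //=.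
by exists (fun=> 0) => //; exact: ghom_zero.
Qed.

Lemma ext_rep_sum (K : finType) (b : K -> R) (f : K -> Q i -> R) (x : K -> Ext M i) :
  (forall z, ext_rep (f z) (x z)) ->
  ext_rep (fun m => \sum_z f z m * b z) (\sum_z (b z : R^c) *: x z).
Proof.
move=> fx; elim: (index_enum K) => [|z t IHt].
  rewrite big_nil; have := ext_rep0; congr ext_rep.
  by apply: funext => m; rewrite big_nil.
rewrite big_cons; have := ext_rep_ZD (b z) (fx z) IHt; congr ext_rep.
by apply: funext => m; rewrite big_cons.
Qed.

Lemma ext_rep_cobound f x : ext_rep f x ->
  x = 0 <-> gcobound (f : Q i -> umod R^o).
Proof. by move=> [fZ ->]; exact: em_eq0. Qed.

Lemma ext_rep_eq f g x : ext_rep f x -> ext_rep g x ->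
  gcobound (fun m => f m - g m : umod R^o).
Proof.
move=> fx gx; have := ext_rep_ZD (-1) gx fx => /ext_rep_cobound[+ _].
rewrite scaleN1r addNr => /(_ erefl); apply: gcobound_ext => m.
by rewrite mulrN1 addrC.
Qed.

Lemma ext_rep_shift f g x : ext_rep f x -> gcocycle (g : Q i -> umod R^o) ->
  gcobound (fun m => g m - f m : umod R^o) -> ext_rep g x.
Proof.
move=> fx gZ gfB; exists gZ; have gx : ext_rep g (em_class gZ) by exists gZ.
have [_ /(_ _)] := ext_rep_cobound (ext_rep_ZD (-1) fx gx).
rewrite scaleN1r addrC => /(_ _)/subr0_eq -> //.
by apply: gcobound_ext gfB => m; rewrite mulrN1 addrC.
Qed.

End ExtClasses.

Section ExtTwist.
Variables (J : finType) (A B : nzRingType).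
Variables (r : mxmor J A B) (s : mxmor J B A).
Hypotheses (rs : mx_dual r s) (sr : mx_dual s r).
Let r_gr n b x y : b \in @ungr B n -> r b x y \in @ungr A n.
Proof. by []. Qed.
Let s_gr n a x y : a \in @ungr A n -> s a x y \in @ungr B n.
Proof. by []. Qed.

Section Resolutions.
Variables (N : lmodType B) (Q : ext_model N) (P : ext_model (Tw s N : lmodType A)).
Let TQ := gTw_res rs sr r_gr s_gr Q.

(** The image of a resolution of N resolves [Tw s N] but is not the resolution defining its Ext;
    lifting the identity in both directions relates the two. *)
Lemma Tw_res_to : exists alpha : forall i, P i -> TQ i,
  chain_map (id : umod (Tw s N) -> gTw s_gr (umod N)) alpha.
Proof.
apply: chain_map_exists; split=> [a x y|n x _] //; exact/Tw_degP.
Qed.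

Lemma Tw_res_from : exists beta : forall i, TQ i -> P i,
  chain_map (id : gTw s_gr (umod N) -> umod (Tw s N)) beta.
Proof. exact: chain_map_exists. Qed.

(** This is the injectivity of the map from Ext_B(N, B)^J to Ext_A(Tw s N, A). *)
Lemma Tw_cobound_join i (alpha : forall i, P i -> TQ i)
    (F : J -> Q i -> umod B^o) :
  chain_map (id : umod (Tw s N) -> gTw s_gr (umod N)) alpha ->
  (forall y, gcocycle (F y)) ->
  gcobound (join_dual r F \o alpha i : P i -> umod A^o) ->
  forall y, gcobound (F y).
Proof.
move=> ha FZ FB; have [beta hb] := Tw_res_from.
refine (@cobound_join _ _ _ r s rs sr _ _ _ _ r_gr s_gr _ Q i F FZ _).
refine (gcobound_retract hb ha _ _ FB) => //.
exact: (@join_cocycle _ _ _ r s rs sr _ _ _ _ r_gr s_gr _ Q i).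
Qed.

(** Ext_A(Tw s N, A) is the J-th power of Ext_B(N, B), and [x0] shows that J is non-empty. A class
    is non-zero when one of its components is; conversely a non-zero class is repeated in every
    component. *)
Lemma Ext_Tw_neq0 (x0 : J) i :
  (exists x : Ext (Tw s N : lmodType A) i, x != 0) <-> (exists x : Ext N i, x != 0).
Proof.
rewrite (ext_neq0P P) (ext_neq0P Q); have [alpha ha] := Tw_res_to; split.
  move=> [f fZ fB]; have [beta hb] := Tw_res_from.
  have fbZ := gcocycle_comp hb fZ.
  apply: contrapT => noF; apply: fB.
  refine (gcobound_retract ha hb _ fZ _) => //.
  refine (@cobound_split _ _ _ r s rs sr _ _ _ _ r_gr s_gr _ Q i _ fbZ _) => y.
  apply: contrapT => nB; apply: noF.
  exists (@split_dual _ _ _ s (Q i) (f \o beta i) y) => //.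
  exact: (@split_cocycle _ _ _ r s rs sr _ _ _ _ r_gr s_gr _ Q i _ y fbZ).
move=> [F FZ FB]; exists (join_dual r (fun=> F) \o alpha i).
  apply: (gcocycle_comp ha).
  exact: (@join_cocycle _ _ _ r s rs sr _ _ _ _ r_gr s_gr _ Q i).
by move=> /(Tw_cobound_join ha) => /(_ (fun=> FZ) x0).
Qed.

End Resolutions.

Lemma grade_Tw (R : realType) (x0 : J) (N : lmodType B) :
  grade R (Tw s N : lmodType A) = grade R N.
Proof.
have [Q _] := ext_model_exists N; have [P _] := ext_model_exists (Tw s N : lmodType A).
congr ereal_inf; congr ([set _ | _ in _]%classic).
by apply/funext => i; apply/propext; exact: Ext_Tw_neq0.
Qed.

(** The columns with a single generator of N generate over A: by [inj_at_scale], a B-multiple of n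
    at x is an A-combination of the columns with n at the various y. *)
Lemma Tw_finitely_generated (N : lmodType B) :
  finitely_generated N -> finitely_generated (Tw s N : lmodType A).
Proof.
move=> [t tN]; exists [seq inj_at s x n | x <- enum J, n <- t] => c; apply/idP.
rewrite -(sum_inj_at c); apply: rpred_sum => x _.
have /asboolP[u ut ->] : c x \in lspan [in t] by rewrite tN.
have -> : inj_at s x (\sum_(p <- u) p.1 *: p.2) =
    \sum_(p <- u) inj_at s x (p.1 *: p.2).
  apply: (big_morph (inj_at s x) (inj_atD s x)).
  by apply/ffunP => y; rewrite !ffunE if_same.
rewrite big_seq; apply: rpred_sum => p pu; rewrite (inj_at_scale rs).
apply: rpred_sum => y _; apply: rpredZ; apply/asboolP.
exists [:: (1, inj_at s y p.2)]; last by rewrite big_seq1 scale1r.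
rewrite /= andbT; apply/allpairsP; exists (y, p.2); split=> //=.
  by rewrite mem_enum.
exact: (allP ut).
Qed.

End ExtTwist.

(** * The Auslander condition under twisting *)

Section Auslander.
Variables (R : realType) (k : fieldType) (J : finType) (x0 : J) (A B : algType k).
Variables (r : mxmor J A B) (s : mxmor J B A).
Hypotheses (rs : mx_dual r s) (sr : mx_dual s r).

(** A submodule E of Ext^i_B(M, B) yields the submodule [Tw (mxmor_op s) E] of Ext^i_A(Tw s M, A),
    by joining J-tuples of classes. The condition for A bounds its grade, which equals that of E. *)
Lemma Auslander_Tw : left_Auslander_Gorenstein R A -> left_Auslander_Gorenstein R B.
Proof.
move=> HA M Mfg i E phi phi_inj.
have [Q _] := ext_model_exists M.
have [P _] := ext_model_exists (Tw s M : lmodType A).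
have [alpha ha] := Tw_res_to rs sr Q P.
(* The chosen cocycles need not depend linearly on e; linearity of [psi] will hold on classes
   only. *)
have /choice[Z Zrep] : forall e, exists f : Q i -> B, ext_rep f (phi e).
  by move=> e; exact: (ext_rep_exists Q (phi e)).
pose F (e : Tw (mxmor_op s) E) y : Q i -> umod B^o := Z (e y).
have FZ e y : gcocycle (F e y) by have [fZ _] := Zrep (e y).
pose G e : P i -> A := join_dual r (F e) \o alpha i.
have GZ e : gcocycle (G e : P i -> umod A^o).
  apply: (gcocycle_comp ha).
  exact: (@join_cocycle _ _ _ r s rs sr _ _ _ _ (fun _ _ _ _ _ => isT)
    (fun _ _ _ _ _ => isT) _ Q i (F e) (FZ e)).
pose psi e : Ext (Tw s M : lmodType A) i := em_class (GZ e).
have Grep e : ext_rep (G e) (psi e) by exists (GZ e).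
have psi_lin : linear psi.
  move=> a e e'; apply/eqP; rewrite -subr_eq0; apply/eqP.
  have H := ext_rep_ZD (-1 : A) (@ext_rep_ZD A _ P i a _ _ _ _ (Grep e) (Grep e'))
    (Grep (a *: e + e')).
  have [_ H0] := ext_rep_cobound H.
  rewrite [X in X = 0]addrC -scaleN1r; refine (H0 _).
  pose C y n := \sum_z F e z n * s a z y + F e' y n.
  (* [C y] and the chosen cocycle represent the same element of Ext, so they differ by a
     coboundary. *)
  have DB y : gcobound (fun n => F (a *: e + e') y n - C y n : umod B^o).
    have Crep : ext_rep (C y) (phi ((a *: e + e') y)).
      have := @ext_rep_ZD B _ Q i 1 _ _ _ _
        (@ext_rep_sum B _ Q i J (fun z => s a z y) _ _ (fun z => Zrep (e z)))
        (Zrep (e' y)).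
      congr ext_rep; first by apply: funext => n; rewrite mulr1.
      rewrite scale1r TwDE TwZE raddfD raddf_sum; congr (_ + _).
      by apply: eq_bigr => z _; rewrite /= linearZ_LR.
    exact: ext_rep_eq (Zrep _) Crep.
  have := gcobound_comp ha (@join_cobound _ _ _ r s rs sr _ _ _ _
    (fun _ _ _ _ _ => isT) (fun _ _ _ _ _ => isT) _ Q i _ DB).
  apply: gcobound_ext => x; rewrite /G /= mulrN1.
  have -> : join_dual r (F (a *: e + e')) (alpha i x) =
      join_dual r (fun y n => (F (a *: e + e') y n - C y n) + C y n) (alpha i x).
    by apply: eq_join_dual => y n; rewrite subrK.
  by rewrite !join_dualD (join_dualM sr) [RHS]addrC addrK.
have psi_inj : injective (mklin psi_lin).
  apply: raddf_inj => e /(ext_rep_cobound (Grep e)) eB.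
  apply/ffunP => y; apply: phi_inj; rewrite Tw0E raddf0.
  apply/(ext_rep_cobound (Zrep (e y))).
  exact: (@Tw_cobound_join _ _ _ r s rs sr _ Q P i alpha (F e) ha (FZ e) eB).
have := HA _ (Tw_finitely_generated rs Mfg) i _ _ psi_inj.
by rewrite (grade_Tw (mx_dual_op rs) (mx_dual_op sr)).
Qed.
End Auslander.

(** * Global dimension *)

Section ProjectiveDimension.
Variable R : nzRingType.
Implicit Types M N P Q U V W : lmodType R.

Definition ker_pred U V (p : {linear U -> V}) : {pred U} := [pred x | p x == 0].
Definition ker_mod U V (p : {linear U -> V}) : lmodType R := submodule (ker_pred p).

Lemma ker_predE U V (p : {linear U -> V}) x : (x \in lspan (ker_pred p)) = (p x == 0).
Proof.
rewrite lspan_closed ?inE//; split=> [|a u v]; first by rewrite !inE raddf0.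
rewrite !inE => /eqP pu /eqP pv.
by rewrite raddfD /= linearZ_LR pu pv scaler0 addr0.
Qed.

Definition ker_val U V (p : {linear U -> V}) : {linear ker_mod p -> U} :=
  mklin (@submod_valP R U (ker_pred p)).

Lemma ker_valP U V (p : {linear U -> V}) x : p (ker_val p x) = 0.
Proof. by apply/eqP; rewrite -ker_predE; case: x. Qed.

Lemma ker_lift U V W (p : {linear U -> V}) (g : {linear W -> U}) :
  (forall w, p (g w) = 0) ->
  exists h : {linear W -> ker_mod p}, forall w, ker_val p (h w) = g w.
Proof.
move=> pg.
have gK w : g w \in lspan (ker_pred p) by rewrite ker_predE pg.
pose h w : ker_mod p := Submodule (gK w).
have hl : linear h.
  by move=> a x y; apply: val_inj; rewrite [RHS]submod_valP /= linearP.
by exists (mklin hl).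
Qed.

Lemma ker_val_inj U V (p : {linear U -> V}) : injective (ker_val p).
Proof. exact: val_inj. Qed.

Lemma projdim0P M : projdim_le M 0 <-> projective M.
Proof.
split=> [[P [e [d [Pproj esurj d0 dex P0]]]] U W p f psurj|Mproj].
  have einj : injective e.
    by apply: raddf_inj => x /d0[y <-]; rewrite (P0 1%N _ y) ?raddf0.
  have [h hE] := choice esurj.
  have hl : linear h.
    by move=> a x y; apply: einj; rewrite raddfD /= linearZ_LR !hE.
  have [g gE] := Pproj 0%N _ _ p (f \o e) psurj.
  by exists (g \o mklin hl) => x /=; rewrite gE /= hE.
(* The zero module, obtained as the kernel of the identity. *)
pose Z : lmodType R := ker_mod (idfun : {linear M -> M}).
have Z0 (x : Z) : x = 0.
  by apply: (@ker_val_inj _ _ idfun); rewrite raddf0; have := ker_valP x.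
pose P i : lmodType R := if i is _.+1 then Z else M.
exists P, idfun, (fun i => \0 : {linear P i.+1 -> P i}).
split=> //.
- case=> // i U W p f _; exists \0 => x /=.
  by rewrite raddf0 (Z0 x) raddf0.
- by move=> y; exists y.
- move=> y /=; split=> [->|[x <-]] //; by exists 0.
- by move=> i y; split=> // _; exists 0; rewrite /= [LHS]Z0 [RHS]Z0.
- by case=> // i _ x; exact: Z0.
Qed.

Lemma projdimS M P (p : {linear P -> M}) n : projective P -> surjective p ->
  projdim_le (ker_mod p) n -> projdim_le M n.+1.
Proof.
move=> Pproj psurj [Q [e [d [Qproj esurj d0 dex Q0]]]].
pose T i : lmodType R := if i is j.+1 then Q j else P.
pose D i : {linear T i.+1 -> T i} :=
  match i with 0%N => (ker_val p \o e : {linear Q 0%N -> P}) | j.+1 => d j end.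
exists T, p, D.
split=> //.
- by case.
- move=> y /=; split=> [py|[x <-]]; last exact: ker_valP.
  have yK : y \in lspan (ker_pred p) by rewrite ker_predE py.
  by have [x xE] := esurj (Submodule yK); exists x; rewrite /= xE.
- case=> [|i] //= y; split=> [|[x <-]].
    rewrite -(raddf0 (ker_val p)) => /ker_val_inj/d0[x <-]; by exists x.
  have ed0 : e (d 0%N x) = 0 by apply/d0; exists x.
  exact: etrans (congr1 (ker_val p) ed0) (raddf0 _).
- by case=> // i; exact: Q0.
Qed.

Lemma projdimS_inv M n : projdim_le M n.+1 ->
  exists P (p : {linear P -> M}),
    [/\ projective P, surjective p & projdim_le (ker_mod p) n].
Proof.
move=> [P [e [d [Pproj esurj d0 dex P0]]]]; exists (P 0%N), e; split=> //.
have [w|h hE] := @ker_lift _ _ _ e (d 0%N); first by apply/d0; exists w.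
exists (fun i => P i.+1), h, (fun i => d i.+1); split=> //.
- move=> y; have /d0[x xE] := ker_valP y.
  by exists x; apply: ker_val_inj; rewrite hE.
- move=> y; rewrite -dex -hE -(raddf0 (ker_val e)).
  by split=> [->|/ker_val_inj].
- by move=> i lt_ni; exact: P0.
Qed.

(* For projective presentations of M and N, the comparison maps exhibit the kernel for
   N as a retract of the kernel for M plus a projective. *)
Lemma projdim_retract n M N Q (i1 : {linear N -> M}) (r1 : {linear M -> N})
    (i2 : {linear N -> Q}) (r2 : {linear Q -> N}) :
  projective Q -> projdim_le M n -> (forall x, r1 (i1 x) + r2 (i2 x) = x) ->
  projdim_le N n.
Proof.
elim: n => [|n IHn] in M N Q i1 r1 i2 r2 * => Qproj.
  move=> /projdim0P Mproj ri; apply/projdim0P => U W p f psurj.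
  have [g1 g1E] := Mproj _ _ p (f \o r1) psurj.
  have [g2 g2E] := Qproj _ _ p (f \o r2) psurj.
  have gl : linear (fun x => g1 (i1 x) + g2 (i2 x)).
    by move=> a x y; rewrite !linearP /= scalerDr addrACA.
  exists (mklin gl) => x /=.
  by rewrite raddfD /= g1E g2E /= -raddfD ri.
move=> /projdimS_inv[P [e [Pproj esurj Kpd]]] ri.
pose F : lmodType R := {freeg N / R}.
pose q : {linear F -> N} := free_lift (fun x : N => x).
have Fproj : projective F by exact: free_projective.
have qsurj : surjective q.
  by move=> x; exists << x >>; rewrite /= /free_lift liftU scale1r.
have [a1 a1E] := Fproj _ _ e (i1 \o q) esurj.
have [b1 b1E] := Pproj _ _ q (r1 \o e) qsurj.
have [b2 b2E] := Qproj _ _ q r2 qsurj.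
have [w|j1 j1E] := @ker_lift _ _ _ e (a1 \o ker_val q).
  by rewrite /= a1E /= ker_valP raddf0.
have [w|s1 s1E] := @ker_lift _ _ _ q (b1 \o ker_val e).
  by rewrite /= b1E /= ker_valP raddf0.
(* The part of the identity of F that is not lifted through M or Q. It lands in the kernel of [q]
   since r1 i1 + r2 i2 = 1, so the identity of that kernel is a sum of a map through the kernel of
   [e] and a map through F. *)
pose g : {linear F -> F} := (idfun \- (b1 \o a1)) \- (b2 \o (i2 \o q)).
have [w|s2 s2E] := @ker_lift _ _ _ q g.
  rewrite /= !raddfB /= b1E b2E /= a1E /=.
  by rewrite -addrA -opprD ri subrr.
apply: (projdimS Fproj qsurj).
apply: (IHn _ _ F j1 s1 (ker_val q) s2 Fproj Kpd) => x.
apply: ker_val_inj; set y := ker_val q x.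
have b1j1 : (b1 \o ker_val e) (j1 x) = b1 (a1 y) := congr1 b1 (j1E x).
apply: etrans (congr2 +%R (etrans (s1E (j1 x)) b1j1) (s2E y)) _.
have -> : g y = y - b1 (a1 y) - b2 (i2 (q y)) by [].
by rewrite ker_valP !raddf0 addr0 addrC subrK.
Qed.

End ProjectiveDimension.

Section GlobalDimension.
Variables (J : finType) (A B : nzRingType).
Variables (r : mxmor J A B) (s : mxmor J B A).
Hypotheses (rs : mx_dual r s) (sr : mx_dual s r).

Lemma Tw_map_surj (M N : lmodType A) (p : {linear M -> N}) :
  surjective p -> surjective (Tw_map r p).
Proof.
move=> psurj c; have [h hE] := choice psurj.
by exists [ffun x => h (c x)]; apply/ffunP => x; rewrite !ffunE hE.
Qed.

Lemma Tw_map_exact (L M N : lmodType A) (f : {linear L -> M}) (g : {linear M -> N}) :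
  exact f g -> exact (Tw_map r f) (Tw_map r g).
Proof.
move=> fg c; split=> [gc|[x <-]]; last first.
  by apply/ffunP => y; rewrite !Tw_mapE Tw0E; apply/fg; exists (x y).
have /choice[h hE] x : exists u, f u = c x.
  by apply/fg; have /ffunP/(_ x) := gc; rewrite Tw_mapE Tw0E.
by exists [ffun x => h x]; apply/ffunP => x; rewrite !ffunE hE.
Qed.

Lemma projdim_Tw (M : lmodType A) n :
  projdim_le M n -> projdim_le (Tw r M : lmodType B) n.
Proof.
move=> [P [e [d [Pproj esurj d0 dex P0]]]].
exists (fun i => Tw r (P i)), (Tw_map r e), (fun i => Tw_map r (d i)); split.
- by move=> i; apply: (Tw_projective sr rs).
- exact: Tw_map_surj.
- exact: Tw_map_exact.
- by move=> i; exact: Tw_map_exact.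
- by move=> i lt_ni c; apply/ffunP => x; rewrite Tw0E; exact: P0.
Qed.

(** N is a summand of its double image, which is the image of an A-module and so has projective
    dimension at most n. No projective correction occurs here, hence the zero maps through a free
    module. *)
Lemma gldim_Tw (v : B) n : (forall b, v * b = b * v) -> v *+ #|J| = 1 ->
  gldim_le A n -> gldim_le B n.
Proof.
move=> vC v1 An N; have [i [p pi]] := Tw_retract rs N vC v1.
apply: (projdim_retract (i1 := i) (r1 := p) (i2 := \0) (r2 := \0)
  (@free_projective B nat)) => [|x]; last by rewrite /= addr0.
exact/projdim_Tw/An.
Qed.

End GlobalDimension.

(** * One-dimensional modules and the Gorenstein condition *)

(** Fewer equations than unknowns leave a non-zero row in the kernel of the coefficient matrix. This
    one count serves both the Ext of the trivial module and the comparison of growth. *)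
Lemma lin_dep (k : fieldType) (K L : finType) (I : {set K}) (I' : {set L})
    (c : K -> L -> k) :
  (#|I'| < #|I|)%N ->
  exists b : K -> k, (exists2 t, t \in I & b t != 0) /\
    forall y, y \in I' -> \sum_(t in I) b t * c t y = 0.
Proof.
move=> ltI; pose C := \matrix_(i < #|I|, j < #|I'|) c (enum_val i) (enum_val j).
have : kermx C != 0.
  rewrite -mxrank_eq0 mxrank_ker subn_eq0 -ltnNge.
  exact: leq_ltn_trans (rank_leq_col C) ltI.
case/rowV0Pn => v /sub_kermxP vC v0.
have [i vi] : exists i, v 0 i != 0.
  apply/existsP; apply: contraNT v0 => /existsPn v0.
  by apply/eqP/rowP => i; rewrite mxE; apply/eqP; have := v0 i; rewrite negbK.
have iI := enum_valP i.
exists (fun t => v 0 (enum_rank_in iI t)); split.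
  by exists (enum_val i); rewrite ?enum_valK_in.
move=> y yI; have /rowP/(_ (enum_rank_in yI y)) := vC; rewrite !mxE => vCy.
rewrite -[RHS]vCy big_enum_val; apply: eq_bigr => j _.
by rewrite enum_valK_in mxE enum_rankK_in.
Qed.

Lemma gcocycle_sum (R : nzRingType) (I : Type) (dsh : nat -> I -> I)
    (gr : nat -> {pred R}) (M : gmod dsh gr) (P : gresol M) i (K : finType)
    (f : K -> P i -> gtriv dsh gr R^o) (b : K -> R) :
  (forall t, gcocycle (f t)) ->
  gcocycle (fun m => \sum_t (f t m : R) * b t : gtriv dsh gr R^o).
Proof.
move=> fZ; split=> [|x]; last first.
  by apply: big1 => t _; have [_ ->] := fZ t; rewrite mul0r.
split=> // a x y.
suff E : \sum_t (f t (a *: x + y) : R) * b t =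
  a * (\sum_t (f t x : R) * b t) + \sum_t (f t y : R) * b t by exact: E.
rewrite mulr_sumr -big_split; apply: eq_bigr => t _; have [[fl _] _] := fZ t; rewrite fl.
by rewrite -[_ *: _]/(_ * _ : R) mulrDl -mulrA.
Qed.

(* K = k e, with x = (coef x) e. *)
Section Line.
Variables (k : fieldType) (A : algType k) (K : lmodType A) (e : K) (coef : K -> k).

Definition is_line :=
  (forall x, (coef x)%:A *: e = x) /\ (forall c, coef (c%:A *: e) = c).

Hypothesis Ke : is_line.

Lemma coef_inj : injective coef.
Proof. by move=> x y xy; rewrite -[x]Ke.1 xy Ke.1. Qed.

Lemma coefD x y : coef (x + y) = coef x + coef y.
Proof. by rewrite -{1}[x]Ke.1 -{1}[y]Ke.1 -scalerDl -scalerDl Ke.2. Qed.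

Lemma coef_sum I (t : seq I) (P : pred I) (F : I -> K) :
  coef (\sum_(i <- t | P i) F i) = \sum_(i <- t | P i) coef (F i).
Proof.
apply: (big_morph coef coefD); apply: (addrI (coef 0)).
by rewrite -coefD !addr0.
Qed.

Lemma coefZ a x : coef (a *: x) = coef (a *: e) * coef x.
Proof.
have E c : a *: (c%:A *: e) = c%:A *: (a *: e).
  by rewrite !scalerA mulr_algl mulr_algr.
by rewrite -{1}[x]Ke.1 E -{1}[a *: e]Ke.1 scalerA mulr_algl scalerA Ke.2 mulrC.
Qed.

End Line.

Section LineTwist.
Variables (k : fieldType) (J : finType) (A B : algType k).
Variables (r : mxmor J A B) (KA : lmodType A) (KB : lmodType B).
Variables (eA : KA) (cA : KA -> k) (eB : KB) (cB : KB -> k).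
Hypotheses (KAe : is_line eA cA) (KBe : is_line eB cB).
Hypothesis rK : forall b x y, cA (r b x y *: eA) = (x == y)%:R * cB (b *: eB).

(** By [rK], [Tw r KA] is a direct sum of J copies of KB; these are its projections and
    inclusions. *)
Definition line_ev (x : J) (c : Tw r KA) : KB := (cA (c x))%:A *: eB.
Definition line_inj (x : J) (v : KB) : Tw r KA := inj_at r x ((cB v)%:A *: eA).

Lemma line_coef_Tw b (c : Tw r KA) x :
  cA ((b *: c) x) = cB (b *: eB) * cA (c x).
Proof.
rewrite TwZE (coef_sum KAe) (bigD1 x) //= (coefZ KAe) rK eqxx mul1r.
rewrite big1 ?addr0// => y yx.
by rewrite (coefZ KAe) rK eq_sym (negbTE yx) !mul0r.
Qed.

Lemma line_ev_linear x : linear (line_ev x).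
Proof.
move=> b c d; rewrite /line_ev TwDE (coefD KAe) line_coef_Tw.
by apply: (coef_inj KBe); rewrite (coefD KBe) [in RHS](coefZ KBe) !KBe.2.
Qed.

Lemma line_inj_linear x : linear (line_inj x).
Proof.
move=> b u v; apply/ffunP => y; rewrite TwDE.
apply: (coef_inj KAe).
have cA0 : cA 0 = 0 by rewrite -(scale0r eA) -(scale0r (1 : A)) KAe.2.
rewrite (coefD KAe) line_coef_Tw !inj_atE; case: ifP => _.
  by rewrite !KAe.2 (coefD KBe) (coefZ KBe).
by rewrite cA0 mulr0 addr0.
Qed.

Lemma line_evK x y v : line_ev x (line_inj y v) = (x == y)%:R *: v.
Proof.
rewrite /line_ev inj_atE; case: eqP => _; first by rewrite KAe.2 KBe.1 scale1r.
by rewrite -(scale0r eA) -(scale0r (1 : A)) KAe.2 !scale0r.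
Qed.

End LineTwist.

Section Gorenstein.
Variables (k : fieldType) (J : finType) (A B : algType k).
Variables (r : mxmor J A B) (s : mxmor J B A) (KA : lmodType A) (KB : lmodType B).
Hypotheses (rs : mx_dual r s) (sr : mx_dual s r).
Hypothesis rk : forall c b x y, r (c *: b) x y = c *: r b x y.
Variables (eA : KA) (cA : KA -> k) (eB : KB) (cB : KB -> k).
Hypotheses (KAe : is_line eA cA) (KBe : is_line eB cB).
Hypothesis rK : forall b x y, cA (r b x y *: eA) = (x == y)%:R * cB (b *: eB).

Let r_gr n b x y : b \in @ungr B n -> r b x y \in @ungr A n.
Proof. by []. Qed.
Let s_gr n a x y : a \in @ungr A n -> s a x y \in @ungr B n.
Proof. by []. Qed.

Variables (P : ext_model KA) (Q : ext_model KB).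
Let TP := gTw_res sr rs s_gr r_gr P.

Lemma line_chain_to x : exists alpha : forall i, Q i -> TP i,
  chain_map (line_inj r eA cB x : umod KB -> gTw r_gr (umod KA)) alpha.
Proof.
apply: chain_map_exists; split; last by move=> n u _; exact/Tw_degP.
exact: (line_inj_linear KAe KBe rK).
Qed.

Lemma line_chain_from x : exists beta : forall i, TP i -> Q i,
  chain_map (@line_ev _ _ _ _ r _ _ cA eB x : gTw r_gr (umod KA) -> umod KB) beta.
Proof.
by apply: chain_map_exists; split=> //; exact: (line_ev_linear KAe KBe rK).
Qed.

(** KB is a summand of [Tw r KA], and the duality with A and B exchanged makes Ext_B(Tw r KA, B) a
    power of Ext_A(KA, A). *)
Lemma line_Ext_vanish (x0 : J) i :
  (forall x : Ext KA i, x = 0) -> (forall x : Ext KB i, x = 0).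
Proof.
move=> KA0 u; have [U Urep] := ext_rep_exists Q u.
apply/(ext_rep_cobound Urep); have [UZ _] := Urep.
have [alpha ha] := line_chain_to x0; have [beta hb] := line_chain_from x0.
refine (gcobound_retract ha hb _ UZ _).
  by move=> v; rewrite /= (line_evK r KAe KBe) eqxx scale1r.
have ubZ := gcocycle_comp hb UZ.
refine (@cobound_split _ _ _ s r sr rs _ _ _ _ s_gr r_gr _ P i _ ubZ _) => y.
have Z := @split_cocycle _ _ _ s r sr rs _ _ _ _ s_gr r_gr _ P i _ y ubZ.
by have [+ _] := em_eq0 Z; apply; exact: KA0.
Qed.

(** Spread over the J copies of KB in [Tw r KA], the classes u and v give 2|J| classes in a J-th
    power of the line spanned by [zeta]. A linear relation among them, restricted to a copy where it
    is not trivial, relates u and v. *)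
Lemma line_Ext_dependent (x0 : J) d (zeta : Ext KA d) :
  (forall x : Ext KA d, exists c : k, x = (c%:A : A^c) *: zeta) ->
  forall u v : Ext KB d, exists a b : k,
    [/\ a != 0 \/ b != 0 & (a%:A : B^c) *: u + (b%:A : B^c) *: v = 0].
Proof.
move=> zetaP u v.
have /choice[alpha ha] x := line_chain_to x.
have /choice[beta hb] x := line_chain_from x.
pose w (i : bool) := if i then u else v.
have /choice[W Wrep] i : exists f : Q d -> B, ext_rep f (w i).
  exact: ext_rep_exists.
have WZ i : gcocycle (W i : Q d -> umod B^o) by have [] := Wrep i.
pose f (t : bool * J) : TP d -> umod B^o := W t.1 \o beta t.2 d.
have fZ t : gcocycle (f t) := gcocycle_comp (hb t.2) (WZ t.1).
have sfZ t y := @split_cocycle _ _ _ s r sr rs _ _ _ _ s_gr r_gr _ P d _ y (fZ t).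
have /choice[c cE] t : exists c : J -> k, forall y,
    ext_rep (@split_dual _ _ _ r (P d) (f t) y) ((c y)%:A *: zeta).
  have /choice[c cE] y : exists c : k, em_class (sfZ t y) = (c%:A : A^c) *: zeta.
    exact: zetaP.
  by exists c => y; exists (sfZ t y); rewrite cE.
(* There are 2|J| unknowns for |J| equations, and J is non-empty; [t0] marks a non-zero
   coefficient. *)
have [|b [[t0 _ bt0] bE]] := @lin_dep k _ _ [set: bool * J]%SET [set: J]%SET c.
  rewrite !cardsT card_prod card_bool mul2n -addnn -[X in (X < _)%N]addn0 ltn_add2l.
  by apply/card_gt0P; exists x0.
pose F : TP d -> umod B^o := fun m => \sum_t (f t m : B) * (b t)%:A.
have FZ : gcocycle F by exact: gcocycle_sum.
have FB : gcobound F.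
  refine (@cobound_split _ _ _ s r sr rs _ _ _ _ s_gr r_gr _ P d _ FZ _) => y.
  have H := @ext_rep_sum A _ P d _ (fun t => (b t)%:A) _ _ (fun t => cE t y).
  have : gcobound ((fun m => \sum_t @split_dual _ _ _ r (P d) (f t) y m * (b t)%:A)
      : P d -> umod A^o).
    apply/(ext_rep_cobound H); under eq_bigr do rewrite scalerA.
    under eq_bigr do rewrite -[_ * _]/((c _ y)%:A * (b _)%:A : A) mulr_algr scalerA.
    rewrite -[X in X = _](@scaler_suml A^c).
    have {}bE : \sum_t b t * c t y = 0.
      by rewrite -[RHS](bE y) ?inE//; apply: eq_bigl => t; rewrite inE.
    have -> : \sum_t (b t * c t y) *: (1 : A) = 0 by rewrite -scaler_suml bE scale0r.
    by rewrite scale0r.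
  apply: gcobound_ext => m; rewrite /split_dual /F.
  under eq_bigr do rewrite mulr_suml.
  rewrite exchange_big /=; apply: eq_bigr => x _; rewrite mxm_sum.
  by apply: eq_bigr => t _; rewrite !mulr_algr rk.
exists (b (true, t0.2)), (b (false, t0.2)); split.
  by case: t0 bt0 => [[] z] /= bz; [left | right].
pose g (t : bool * J) : Q d -> B := f t \o alpha t0.2 d.
(* On the copy [t0.2], the cocycle [f t] restricts to u or v if it comes from that copy and to a
   coboundary otherwise; [sel] is the identity or zero accordingly. *)
have grep t : ext_rep (g t) ((t.2 == t0.2)%:R *: w t.1).
  pose sel (V : lmodType B) (x : V) := if t.2 == t0.2 then x else 0.
  have hba : chain_map (@sel KB : umod KB -> umod KB)
      (fun i => beta t.2 i \o alpha t0.2 i).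
    have [h1 h2 h3] := chain_map_comp (hb t.2) (ha t0.2); split=> // q.
    rewrite h2 /= (line_evK r KAe KBe) /sel.
    by case: eqP => _; rewrite ?scale1r ?scale0r.
  have hid : chain_map (@sel KB : umod KB -> umod KB) (fun i => @sel (Q i)).
    rewrite /sel; case: eqP => _; first exact: chain_map_id.
    by split=> [i|q|i q]; [exact: ghom_zero | rewrite raddf0 | rewrite raddf0].
  have gZ : gcocycle (g t : Q d -> umod B^o) := gcocycle_comp (ha t0.2) (fZ t).
  have gB := gcobound_homotopy hba hid (WZ t.1).
  apply: ext_rep_shift gZ _; last exact: gB.
  rewrite /sel; case: eqP => _; first by rewrite scale1r.
  have := ext_rep0 Q d; rewrite scale0r; congr ext_rep; apply: funext => m.
  by have [[+ _] _] := WZ t.1; move=> /linearE[W' ->]; rewrite raddf0.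
have H := @ext_rep_sum B _ Q d _ (fun t => (b t)%:A) _ _ grep.
have /(ext_rep_cobound H) := gcobound_comp (ha t0.2) FB.
have -> : \sum_t ((b t)%:A : B^c) *: ((t.2 == t0.2)%:R *: w t.1) =
    \sum_i \sum_x ((b (i, x))%:A : B^c) *: ((x == t0.2)%:R *: w i).
  by rewrite pair_bigA; apply: eq_bigr => -[i x] _.
have E i : \sum_x ((b (i, x))%:A : B^c) *: ((x == t0.2)%:R *: w i) =
    ((b (i, t0.2))%:A : B^c) *: w i.
  rewrite (bigD1 t0.2) //= eqxx scale1r big1 ?addr0// => x /negbTE ->.
  by rewrite scale0r scaler0.
by rewrite big_bool !E.
Qed.
End Gorenstein.

(** * The trivial module of a connected graded algebra *)

Section TrivialModule.
Variables (k : fieldType) (A : algType k) (gr : nat -> {pred A}).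
Hypothesis gr_conn : connected_graded gr.

Let gr_alg : graded_algebra gr. Proof. by case: gr_conn. Qed.

Let gr0 n : 0 \in gr n.
Proof. by case: gr_alg => /(_ n)[]. Qed.

Let grZD n c a b : a \in gr n -> b \in gr n -> c *: a + b \in gr n.
Proof. by case: gr_alg => /(_ n)[_ H] _ _ _ _; exact: H. Qed.

Let grM m n a b : a \in gr m -> b \in gr n -> a * b \in gr (m + n)%N.
Proof. by case: gr_alg => _ _ H _ _; exact: H. Qed.

Let grD n a b : a \in gr n -> b \in gr n -> a + b \in gr n.
Proof. by move=> an bn; rewrite -[a]scale1r grZD. Qed.

(** Membership in A_{>=1}, with c i the component of degree i + 1. The family is total so that sums
    of different lengths can be padded and added. *)
Definition pos_sum (a : A) := exists (n : nat) (c : nat -> A),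
  (forall i, c i \in gr i.+1) /\ a = \sum_(i < n) c i.

Lemma pos_sumD a b : pos_sum a -> pos_sum b -> pos_sum (a + b).
Proof.
move=> [m [c [cgr ->]]] [n [d [dgr ->]]].
pose cut (p : nat) (e : nat -> A) i := if (i < p)%N then e i else 0.
have cut_gr p e i : (forall i, e i \in gr i.+1) -> cut p e i \in gr i.+1.
  by move=> egr; rewrite /cut; case: ifP.
have cutE p q (e : nat -> A) : (p <= q)%N -> \sum_(i < p) e i = \sum_(i < q) cut p e i.
  move=> le_pq; rewrite (big_ord_widen q e le_pq) big_mkcond.
  by apply: eq_bigr => i _.
exists (maxn m n), (fun i => cut m c i + cut n d i); split=> [i|].
  by apply: grD; exact: cut_gr.
by rewrite big_split /= -!cutE ?leq_maxl ?leq_maxr.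
Qed.

Lemma pos_sum_homog n a : a \in gr n.+1 -> pos_sum a.
Proof.
move=> an; exists n.+1, (fun i => if i == n then a else 0); split=> [i|].
  by case: eqP => [->|_].
rewrite (bigD1 ord_max) //= eqxx big1 ?addr0// => i.
by rewrite -val_eqE /= => /negbTE ->.
Qed.

Lemma pos_sum0 : pos_sum 0.
Proof. by exists 0%N, (fun=> 0); split=> //; rewrite big_ord0. Qed.

Lemma decomp a : exists c : k, exists2 b, pos_sum b & a = c%:A + b.
Proof.
have [_ gr0P _] := gr_conn; case: gr_alg => _ _ _ /(_ a)[n [c cgr ->]] _.
case: n c cgr => [|n] c cgr.
  exists 0, 0; first exact: pos_sum0.
  by rewrite big_ord0 scale0r add0r.
have /gr0P[x xE] := cgr ord0; exists x, (\sum_(i < n) c (fintype.lift ord0 i)).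
  elim/big_ind: _ => [|u v|i _]; [exact: pos_sum0 | exact: pos_sumD |].
  exact: (@pos_sum_homog i _ (cgr (fintype.lift ord0 i))).
by rewrite big_ord_recl xE.
Qed.

Lemma pos_sum_mul a b : pos_sum b -> pos_sum (a * b).
Proof.
move=> [n [d [dgr ->]]]; case: gr_alg => _ _ _ /(_ a)[m [c cgr ->]] _.
rewrite mulr_suml; elim/big_ind: _ => [|u v|i _]; [exact: pos_sum0 | exact: pos_sumD |].
rewrite mulr_sumr; elim/big_ind: _ => [|u v|j _]; [exact: pos_sum0 | exact: pos_sumD |].
by apply: (@pos_sum_homog (i + j)); rewrite -addnS grM.
Qed.

Lemma pos_sum_scalar (c : k) : pos_sum c%:A -> c = 0.
Proof.
move=> [n [d [dgr cE]]]; have [_ gr0P _] := gr_conn.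
(* With -c in degree 0 in front of the terms of positive degree, a homogeneous sum equals zero;
   independence of the degrees gives c = 0. *)
case: gr_alg => _ _ _ _ /(_ n.+1 (fun i => if i == 0%N :> nat then - c%:A else d i.-1)) H.
have /H/(_ _ ord0) : forall i : 'I_n.+1,
    (if i == 0%N :> nat then - c%:A else d i.-1) \in gr i.
  move=> [[|i] lt_in] /=; last exact: dgr.
  by apply/gr0P; exists (- c); rewrite scaleNr.
rewrite big_ord_recl /= -cE addNr => /(_ erefl)/eqP.
by rewrite oppr_eq0 scaler_eq0 oner_eq0 orbF => /eqP.
Qed.

Lemma pos_sum_span a : a \in lspan (positive_part gr) <-> pos_sum a.
Proof.
split=> [/asboolP[t tpos ->]|].
  elim: t tpos => [_|[x p] t IHt] /=; first by rewrite big_nil; exact: pos_sum0.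
  move=> /andP[/asboolP[n pn] tpos]; rewrite big_cons; apply: pos_sumD (IHt tpos).
  by apply: pos_sum_mul; exact: pos_sum_homog pn.
move=> [n [c [cgr ->]]]; apply: rpred_sum => i _; apply/asboolP.
exists [:: (1, c i)]; last by rewrite big_seq1 scale1r.
by rewrite /= andbT; apply/asboolP; exists i.
Qed.

Definition triv_gen : trivial_module gr := quot_pi _ (1 : A^o).

Lemma triv_gen_pi (a : A) : a *: triv_gen = quot_pi _ (a : A^o).
Proof. by rewrite -[LHS]quot_piZ; congr quot_pi; rewrite -[LHS]/(a * 1) mulr1. Qed.

Lemma triv_pi_eq0 (a : A) : (quot_pi _ (a : A^o) : trivial_module gr) = 0 <-> pos_sum a.
Proof.
have z0 : (0 : trivial_module gr) = quot_pi _ (0 : A^o).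
  by apply: (addrI (quot_pi _ (0 : A^o))); rewrite -quot_piD !addr0.
by rewrite z0 -pos_sum_span -[a in a \in _]subr0 -quot_piE; split=> [/eqP|/eqP].
Qed.

Lemma trivial_line : exists coef : trivial_module gr -> k, is_line triv_gen coef.
Proof.
have /choice[coef coefE] (x : trivial_module gr) : exists c : k, x = c%:A *: triv_gen.
  have [a ->] := quot_piP x; have [c [b bpos ->]] := decomp a; exists c.
  rewrite triv_gen_pi quot_piD; have /triv_pi_eq0 -> := bpos.
  by rewrite addr0.
exists coef; split=> [x|c]; first by rewrite -coefE.
apply/eqP; rewrite -subr_eq0; apply/eqP/pos_sum_scalar/triv_pi_eq0.
rewrite -triv_gen_pi scalerBl scalerBl -coefE subrr.
by [].
Qed.

Lemma trivial_pos n a (x : trivial_module gr) : a \in gr n.+1 -> a *: x = 0.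
Proof.
move=> an; have [b ->] := quot_piP x.
rewrite -[LHS]quot_piZ; apply/triv_pi_eq0.
case: gr_alg => _ _ _ /(_ b)[m [c cgr ->]] _.
rewrite -[_ *: _]/(a * _) mulr_sumr.
elim/big_ind: _ => [|u v|i _]; [exact: pos_sum0 | exact: pos_sumD |].
by apply: (@pos_sum_homog (n + i)); rewrite -addSn grM.
Qed.

End TrivialModule.

Section TrivialTwist.
Variables (k : fieldType) (J : finType) (A B : algType k).
Variables (r : mxmor J A B).
Hypothesis rk : forall c b x y, r (c *: b) x y = c *: r b x y.
Variables (grA : nat -> {pred A}) (grB : nat -> {pred B}).
Hypotheses (A_conn : connected_graded grA) (B_conn : connected_graded grB).
Hypothesis r_gr : forall n b x y, b \in grB n -> r b x y \in grA n.
Variables (cA : trivial_module grA -> k) (cB : trivial_module grB -> k).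
Hypotheses (KAe : is_line (triv_gen grA) cA) (KBe : is_line (triv_gen grB) cB).

(** Scalars go to scalar matrices, and positive degrees, which [r] preserves, act as zero on both
    trivial modules. This verifies the hypothesis [rK] made on lines. *)
Lemma trivial_coef b x y :
  cA (r b x y *: triv_gen grA) = (x == y)%:R * cB (b *: triv_gen grB).
Proof.
have cA0 : cA 0 = 0 by apply: (addrI (cA 0)); rewrite -(coefD KAe) !addr0.
have cB0 : cB 0 = 0 by apply: (addrI (cB 0)); rewrite -(coefD KBe) !addr0.
have [c [p [n [d [dgr ->]]] ->]] := decomp B_conn b.
rewrite mxmD !scalerDl (coefD KAe) (coefD KBe) mulrDr; congr (_ + _).
  rewrite rk mxm1 KBe.2; case: eqP => _; first by rewrite KAe.2 mul1r.
  by rewrite scaler0 scale0r cA0 mul0r.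
rewrite mxm_sum !scaler_suml (coef_sum KAe) (coef_sum KBe) mulr_sumr.
apply: eq_bigr => i _.
rewrite (trivial_pos A_conn _ (r_gr _ _ (dgr i))) (trivial_pos B_conn _ (dgr i)).
by rewrite cA0 cB0 mulr0.
Qed.

End TrivialTwist.

Section GorensteinTwist.
Variables (k : fieldType) (J : finType) (x0 : J) (A B : algType k).
Variables (r : mxmor J A B) (s : mxmor J B A).
Hypotheses (rs : mx_dual r s) (sr : mx_dual s r).
Hypothesis rk : forall c b x y, r (c *: b) x y = c *: r b x y.
Hypothesis sk : forall c a x y, s (c *: a) x y = c *: s a x y.
Variables (grA : nat -> {pred A}) (grB : nat -> {pred B}).
Hypotheses (A_conn : connected_graded grA) (B_conn : connected_graded grB).
Hypothesis r_gr : forall n b x y, b \in grB n -> r b x y \in grA n.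
Hypothesis s_gr : forall n a x y, a \in grA n -> s a x y \in grB n.

(** One-dimensionality is reached as non-vanishing together with linear dependence of any two
    classes. *)
Lemma AS_Gorenstein_Tw d : left_AS_Gorenstein grA d -> left_AS_Gorenstein grB d.
Proof.
have [cA KAe] := trivial_line A_conn; have [cB KBe] := trivial_line B_conn.
have rK := trivial_coef rk A_conn B_conn r_gr KAe KBe.
have sK := trivial_coef sk B_conn A_conn s_gr KBe KAe.
have [P _] := ext_model_exists (trivial_module grA).
have [Q _] := ext_model_exists (trivial_module grB).
move=> [vanish [zeta [g gK1 gK2]]]; split=> [i /vanish|].
  exact: (line_Ext_vanish rs sr KAe KBe rK P Q x0).
(* Vanishing over B would give vanishing over A, with [r] and [s] exchanged, and force [zeta] to be
   0. *)
have [u u0] : exists u : Ext (trivial_module grB) d, u != 0.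
  apply: contrapT => noU.
  have zeta0 := line_Ext_vanish sr rs KBe KAe sK Q P x0 (i := d).
  have {}zeta0 : zeta = 0.
    by apply: zeta0 => x; apply: contrapT => /eqP x0'; apply: noU; exists x.
  have /eqP : (1 : k) = 0 by rewrite -(gK1 1) -(gK1 0) zeta0 !scaler0.
  by rewrite oner_eq0.
have scA c c' (w : Ext (trivial_module grB) d) :
    (c%:A : B^c) *: ((c'%:A : B^c) *: w) = ((c * c')%:A : B^c) *: w.
  rewrite scalerA; congr (_ *: w).
  by rewrite -[LHS]/((c'%:A : B) * c%:A) mulr_algl scalerA mulrC.
have scV c (w : Ext (trivial_module grB) d) : c != 0 ->
    (c^-1%:A : B^c) *: ((c%:A : B^c) *: w) = w.
  by move=> c0; rewrite scA mulVf// !scale1r.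
have uinj c : ((c%:A : B^c) *: u = 0) -> c = 0.
  move=> cu; apply/eqP; apply: contraNT u0 => c0; apply/eqP.
  by rewrite -[u](scV c)// cu scaler0.
exists u; have /choice[h hE] (v : Ext (trivial_module grB) d) :
    exists c : k, (c%:A : B^c) *: u = v.
  have [|a [b [ab0 abE]]] :=
    line_Ext_dependent rs sr rk KAe KBe rK P Q x0 (zeta := zeta) _ u v.
    by move=> x; exists (g x); rewrite gK2.
  have b0 : b != 0.
    apply/eqP => b0; case: ab0 => [/eqP a0|]; last by rewrite b0 eqxx.
    by apply/a0/uinj; move: abE; rewrite b0 !scale0r addr0.
  exists (- (b^-1 * a)).
  have : (b^-1%:A : B^c) *: ((a%:A : B^c) *: u + (b%:A : B^c) *: v) = 0.
    by rewrite abE scaler0.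
  rewrite scalerDr scV// scA => /(canRL (addKr _)); rewrite addr0 => ->.
  by rewrite scaleNr scaleNr.
exists h => [c|v]; last exact: hE.
apply/eqP; rewrite -subr_eq0; apply/eqP/uinj.
by rewrite !scalerBl hE subrr.
Qed.

End GorensteinTwist.

(** * Koszul algebras *)

Definition zsh (m : nat) (n : int) : int := m%:Z + n.

Section GradedCover.
Variables (k : fieldType) (A : algType k) (gr : nat -> {pred A}).
Hypothesis gr_alg : graded_algebra gr.

Let gr_mul m n a b : a \in gr m -> b \in gr n -> a * b \in gr (m + n)%N.
Proof. by case: gr_alg => _ _ H _ _; exact: H. Qed.

Section Free.
Variables (K : choiceType) (deg : K -> int).

Lemma free_deg_zmod n : zmod_closed (free_deg gr deg n).
Proof.
split; first by apply/asboolP; exists [::]; rewrite ?big_nil.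
move=> u v /asboolP[t tn ->] /asboolP[t' tn' ->]; apply/asboolP.
exists (t ++ [seq (- p.1, p.2) | p <- t']).
  move=> p; rewrite mem_cat => /orP[/tn//|/mapP[q /tn'[m qm qn] ->]].
  exists m => //=; case: gr_alg => /(_ m)[gr0 grZ] _ _ _ _.
  by rewrite -scaleN1r -[_ *: _]addr0 grZ.
rewrite big_cat big_map /=; congr (_ + _); rewrite -sumrN.
by apply: eq_bigr => p _; apply/eqP/freeg_eqP => y; rewrite coeffN !coeffU mulNr.
Qed.

Lemma free_deg_scale m n a v :
  a \in gr m -> v \in free_deg gr deg n -> a *: v \in free_deg gr deg (zsh m n).
Proof.
move=> am /asboolP[t tn ->]; apply/asboolP.
exists [seq (a * p.1, p.2) | p <- t].
  move=> p /mapP[q /tn[l ql <-] ->]; exists (m + l)%N; first exact: gr_mul.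
  by rewrite /zsh PoszD addrA.
by rewrite big_map scaler_sumr; apply: eq_bigr => p _; rewrite free_scaleU.
Qed.

Lemma free_deg_gen x : << x >> \in free_deg gr deg (deg x).
Proof.
apply/asboolP; exists [:: (1, x)]; last by rewrite big_seq1.
move=> p; rewrite inE => /eqP -> /=; exists 0%N; last by rewrite add0r.
by case: gr_alg.
Qed.

End Free.

End GradedCover.

Section DegreePredicates.
Variables (k : fieldType) (A : algType k) (gr : nat -> {pred A}).
Implicit Types U V W : lmodType A.

Definition deg_closed U (dU : int -> {pred U}) :=
  (forall n, zmod_closed (dU n)) /\
  (forall m n a x, a \in gr m -> x \in dU n -> a *: x \in dU (zsh m n)).

Definition deg_hom U V (dU : int -> {pred U}) (dV : int -> {pred V})
  (f : {linear U -> V}) := forall n x, x \in dU n -> f x \in dV n.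

Definition comp_zero U V W (f : {linear U -> V}) (g : {linear V -> W}) :=
  forall x, g (f x) = 0.

Definition deg_exact U V W (dU : int -> {pred U}) (dV : int -> {pred V})
    (f : {linear U -> V}) (g : {linear V -> W}) :=
  forall n y, y \in dV n -> g y = 0 -> exists2 x, x \in dU n & f x = y.

(** Quantifying over the closure proofs makes projectivity a property of the degree predicate
    alone. *)
Definition deg_proj U (dU : int -> {pred U}) :=
  forall (H : forall n, zmod_closed (dU n))
    (H' : forall m n a x, a \in gr m -> x \in dU n -> a *: x \in dU (zsh m n)),
  gproj (@Gmod A int zsh gr U dU H H').

End DegreePredicates.

Section Cover.
Variables (k : fieldType) (A : algType k) (gr : nat -> {pred A}).
Hypothesis gr_alg : graded_algebra gr.
Variable f : garrow A.
Notation c := (graded_free_cover gr f).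

Lemma cover_closed : deg_closed gr (@garrow_deg _ _ c).
Proof. by split; [exact: free_deg_zmod | exact: free_deg_scale]. Qed.

Lemma cover_hom : deg_closed gr (@garrow_deg _ _ f) ->
  deg_hom (@garrow_deg _ _ c) (@garrow_deg _ _ f) (garrow_map c).
Proof.
move=> [f_zmod f_scale] n x /asboolP[t tn ->]; rewrite raddf_sum big_seq.
apply: (@gdeg_sum _ _ _ _ (Gmod f_zmod f_scale)) => p /tn[m pm <-] /=.
rewrite /free_lift liftU; apply: f_scale => //.
by have /andP[] := valP p.2.
Qed.

Lemma cover_comp0 : comp_zero (garrow_map c) (garrow_map f).
Proof.
move=> x; rewrite -[x]freeg_sumE !raddf_sum big1// => z _ /=.
rewrite /free_lift liftU linearZ_LR; have /andP[_ /eqP ->] := valP z.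
by rewrite scaler0.
Qed.

Lemma cover_exact :
  deg_exact (@garrow_deg _ _ c) (@garrow_deg _ _ f) (garrow_map c) (garrow_map f).
Proof.
move=> n y yn /eqP fy; have yK : (y \in garrow_deg (n, y).1) && (f (n, y).2 == 0).
  by rewrite /= yn fy.
exists << exist _ (n, y) yK : graded_kernel_of f >>; last first.
  by rewrite /= /free_lift liftU scale1r.
exact: (free_deg_gen gr_alg (fun x : graded_kernel_of f => (val x).1)).
Qed.

Lemma cover_proj : deg_proj gr (@garrow_deg _ _ c).
Proof.
move=> H H'.
apply: (free_gproj (deg := fun x : graded_kernel_of f => (val x).1)) => [x|n v].
  exact: (free_deg_gen gr_alg (fun x : graded_kernel_of f => (val x).1)).
by move=> /asboolP.
Qed.

End Cover.

(** The graded counterpart of [ext_model]. The Koszul property asks only whether Ext vanishes, so no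
    classes are kept. *)
Record gext_model (k : fieldType) (A : algType k) (gr : nat -> {pred A})
    (M : gmod zsh gr) := GextModel {
  gem_res :> gresol M;
  gem_Ext : forall (N : gmod zsh gr) i,
    graded_Ext_zero gr (gdeg M) (gdeg N) i <->
    forall f : gem_res i -> N, gcocycle f -> gcobound f }.

Section SequenceResolution.
Variables (k : fieldType) (A : algType k) (gr : nat -> {pred A}) (M : gmod zsh gr).
Variables (P : nat -> lmodType A) (D : forall i, int -> {pred P i}).
Variables (d : forall i, {linear P i.+1 -> P i}) (e : {linear P 0%N -> M}).

Definition seq_closed := forall i, deg_closed gr (@D i).
Definition seq_hom := forall i, deg_hom (@D i.+1) (@D i) (d i).
Definition seq_aug_hom := deg_hom (@D 0%N) (gdeg M) e.
Definition seq_proj := forall i, deg_proj gr (@D i).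
(** Exactness against the zero map encodes surjectivity in every degree. *)
Definition seq_aug_surj := deg_exact (@D 0%N) (gdeg M) e (\0 : {linear M -> M}).
Definition seq_aug_comp := comp_zero (d 0%N) e.
Definition seq_aug_exact := deg_exact (@D 1%N) (@D 0%N) (d 0%N) e.
Definition seq_comp := forall i, comp_zero (d i.+1) (d i).
Definition seq_exact := forall i, deg_exact (@D i.+2) (@D i.+1) (d i.+1) (d i).

Hypotheses (Dcl : seq_closed) (dh : seq_hom) (eh : seq_aug_hom) (Dp : seq_proj).
Hypotheses (es : seq_aug_surj) (ec : seq_aug_comp) (ee : seq_aug_exact).
Hypotheses (dc : seq_comp) (dE : seq_exact).

Definition seq_gresol : gresol M :=
  @Gresol _ _ zsh gr M (fun i => Gmod (Dcl i).1 (Dcl i).2) d e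
    (fun i => conj (linearP (d i)) (@dh i)) (conj (linearP e) eh)
    (fun i => @Dp i (Dcl i).1 (Dcl i).2) (fun n y yn => es yn erefl)
    ec ee dc dE.

Lemma seq_Ext (N : gmod zsh gr) i :
  (forall f : P i -> N,
    cocycle d (fun i (f : P i -> N) =>
      linear f /\ forall n x, x \in @D i n -> f x \in gdeg N n) f ->
    coboundary d (fun i (f : P i -> N) =>
      linear f /\ forall n x, x \in @D i n -> f x \in gdeg N n) f) <->
  forall f : seq_gresol i -> N, gcocycle f -> gcobound f.
Proof. by []. Qed.

End SequenceResolution.

Section GradedResolution.
Variables (k : fieldType) (A : algType k) (gr : nat -> {pred A}).
Hypothesis gr_alg : graded_algebra gr.
Variable M : gmod zsh gr.

Notation P := (gres gr (gdeg M)).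
Notation D := (fun i => @gres_deg _ _ gr _ (gdeg M) i).
Notation d := (@gres_diff _ _ gr _ (gdeg M)).
Notation F i := (gres_arrow gr (gdeg M) i).
Notation e := (garrow_map (F 0) : {linear P 0 -> M}).

(** [G i] is the arrow whose kernel is covered by P_i, so that [F i] is the cover of [G i]; it
    starts with the zero map of M. *)
Notation G i := (iter i (graded_free_cover gr) (GArrow (gdeg M) (\0 : {linear M -> M}))).

Lemma gres_closed : seq_closed gr D.
Proof. by move=> i; exact_no_check (cover_closed gr_alg (G i)). Qed.

Lemma gres_hom : seq_hom D d.
Proof. by move=> i; exact_no_check (cover_hom (f := G i.+1) (gres_closed i)). Qed.

Lemma gres_aug_hom : seq_aug_hom D e.
Proof.
exact_no_check (cover_hom (f := GArrow (gdeg M) (\0 : {linear M -> M}))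
  (conj (@gdeg_zmod _ _ _ _ M) (@gdeg_scale _ _ _ _ M))).
Qed.

Lemma gres_proj : seq_proj gr D.
Proof. by move=> i; exact_no_check (cover_proj gr_alg (f := G i)). Qed.

Lemma gres_aug_surj : seq_aug_surj D e.
Proof.
exact_no_check (cover_exact gr_alg (f := GArrow (gdeg M) (\0 : {linear M -> M}))).
Qed.

Lemma gres_aug_comp : seq_aug_comp d e.
Proof. exact_no_check (cover_comp0 (gr := gr) (f := F 0)). Qed.

Lemma gres_aug_exact : seq_aug_exact D d e.
Proof. exact_no_check (cover_exact gr_alg (f := F 0)). Qed.

Lemma gres_comp : seq_comp d.
Proof. by intros i; exact_no_check (@cover_comp0 k A gr (graded_free_cover gr (F i))). Qed.

Lemma gres_exact : seq_exact D d.
Proof.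
by move=> i; exact_no_check (cover_exact gr_alg (f := graded_free_cover gr (F i))).
Qed.

Lemma gext_model_exists : exists _ : gext_model M, True.
Proof.
by exists (GextModel (seq_Ext gres_closed gres_hom gres_aug_hom gres_proj
  gres_aug_surj gres_aug_comp gres_aug_exact gres_comp gres_exact)).
Qed.

End GradedResolution.

Section Placed.
Variables (k : fieldType) (A : algType k) (gr : nat -> {pred A}).
Hypothesis gr_conn : connected_graded gr.
Notation K := (trivial_module gr).

Lemma placed_zmod (V : zmodType) j n : zmod_closed (@placed_in V j n).
Proof.
rewrite /placed_in; case: eqP => // _; split=> [|x y]; first by rewrite inE.
by rewrite !inE => /eqP -> /eqP ->; rewrite subrr.
Qed.

(** Positive degrees annihilate the trivial module and degree 0 does not shift, so a module
    concentrated in one degree is graded. *)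
Lemma placed_scale j m n a (x : K) : a \in gr m -> x \in @placed_in K j n ->
  a *: x \in @placed_in K j (zsh m n).
Proof.
have in0 l : (0 : K) \in @placed_in K j l by case: (@placed_zmod K j l).
case: m => [|m] am; last by rewrite (trivial_pos gr_conn _ am) in0.
rewrite /zsh add0r /placed_in; case: eqP => // _.
by rewrite !inE => /eqP ->; rewrite scaler0.
Qed.

Definition gplaced (j : int) : gmod zsh gr :=
  @Gmod A int zsh gr K (@placed_in K j) (@placed_zmod K j) (@placed_scale j).

End Placed.

Section KoszulTwist.
Variables (k : fieldType) (J : finType) (x0 : J) (A B : algType k).
Variables (r : mxmor J A B) (s : mxmor J B A).
Hypotheses (rs : mx_dual r s) (sr : mx_dual s r).
Hypothesis rk : forall c b x y, r (c *: b) x y = c *: r b x y.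
Hypothesis sk : forall c a x y, s (c *: a) x y = c *: s a x y.
Variables (grA : nat -> {pred A}) (grB : nat -> {pred B}).
Hypotheses (A_conn : connected_graded grA) (B_conn : connected_graded grB).
Hypothesis r_gr : forall n b x y, b \in grB n -> r b x y \in grA n.
Hypothesis s_gr : forall n a x y, a \in grA n -> s a x y \in grB n.
Notation KA := (trivial_module grA).
Notation KB := (trivial_module grB).
Notation eA := (triv_gen grA).
Notation eB := (triv_gen grB).
Variables (cA : KA -> k) (cB : KB -> k).
Hypotheses (KAe : is_line eA cA) (KBe : is_line eB cB).

Let rK := trivial_coef rk A_conn B_conn r_gr KAe KBe.
Let sK := trivial_coef sk B_conn A_conn s_gr KBe KAe.

Let cA0 : cA 0 = 0. Proof. by apply: (addrI (cA 0)); rewrite -(coefD KAe) !addr0. Qed.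
Let cB0 : cB 0 = 0. Proof. by apply: (addrI (cB 0)); rewrite -(coefD KBe) !addr0. Qed.

Lemma placedA j n (x : KB) : x \in @placed_in KB j n ->
  (cB x)%:A *: eA \in @placed_in KA j n.
Proof.
rewrite /placed_in; case: eqP => // _.
by rewrite !inE => /eqP ->; rewrite cB0 !scale0r.
Qed.

Lemma placedB j n (I : finType) (x : I -> KA) :
  (forall i, x i \in @placed_in KA j n) ->
  (\sum_i cA (x i))%:A *: eB \in @placed_in KB j n.
Proof.
rewrite /placed_in; case: eqP => // _ x_0; rewrite inE big1 ?scale0r ?scale0r// => i _.
by have := x_0 i; rewrite inE => /eqP ->.
Qed.

Variables (P : gresol (gplaced A_conn 0)) (Q : gresol (gplaced B_conn 0)).
Let TP := gTw_res sr rs s_gr r_gr P.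

(** The target is now the trivial module, not the ring. As [Tw s KB] is a sum of J copies of KA, a
    B-linear map from [Tw r] of P_i to KB amounts to J maps from P_i to KA; each is a coboundary by
    hypothesis, and KB is a retract of [Tw r KA]. *)
Lemma Koszul_Tw j i :
  (forall f : P i -> gplaced A_conn j, gcocycle f -> gcobound f) ->
  forall f : Q i -> gplaced B_conn j, gcocycle f -> gcobound f.
Proof.
move=> Aj f fZ.
have [|alpha ha] := @chain_map_exists _ _ _ _ _ _ Q TP
    (line_inj r eA cB x0 : gplaced B_conn 0 -> gTw r_gr (gplaced A_conn 0)).
  split=> [|n u uK]; first exact: (line_inj_linear KAe KBe rK).
  apply/Tw_degP => y; rewrite inj_atE; case: ifP => _; first exact: placedA.
  by case: (@placed_zmod KA 0 n).
have [|beta hb] := @chain_map_exists _ _ _ _ _ _ TP Q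
    (@line_ev _ _ _ _ r _ _ cA eB x0 : gTw r_gr (gplaced A_conn 0) -> gplaced B_conn 0).
  split=> [|n c /Tw_degP cK]; first exact: (line_ev_linear KAe KBe rK).
  have := placedB (I := unit) (x := fun=> c x0) (fun=> cK x0).
  by rewrite big_const card_unit /= addr0.
refine (gcobound_retract ha hb _ fZ _).
  by move=> v; rewrite /= (line_evK r KAe KBe) eqxx scale1r.
have := gcocycle_comp hb fZ; move: (f \o beta i) => F [[+ Fdeg] Fd].
move=> /linearE[F' FE]; subst F; rename F' into F.
(* By [sK], reading F on the column x through coefficients gives an A-linear map to the trivial
   A-module. *)
pose h x (m : P i) : gplaced A_conn j := (cB (F (inj_at r x m)))%:A *: eA.
have hZ x : gcocycle (h x).
  split; last by move=> m; rewrite /h -Tw_map_inj_at Fd cB0 !scale0r.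
  split=> [a m n|n m mP]; last by apply: placedA; apply: Fdeg; exact: inj_at_deg.
  apply: (coef_inj KAe); rewrite (coefD KAe) [in RHS](coefZ KAe) !KAe.2.
  rewrite inj_atD raddfD (coefD KBe); congr (_ + _).
  rewrite (inj_at_scale sr) raddf_sum (coef_sum KBe) (bigD1 x) //=.
  rewrite linearZ_LR (coefZ KBe) sK eqxx mul1r big1 ?addr0// => y yx.
  by rewrite linearZ_LR (coefZ KBe) sK eq_sym (negbTE yx) !mul0r.
have FE c : cB (F c) = \sum_x cA (h x (c x)).
  rewrite -[in LHS](sum_inj_at c) raddf_sum (coef_sum KBe).
  by apply: eq_bigr => x _; rewrite KAe.2.
have hB x := Aj _ (hZ x).
case: i {Aj f fZ alpha ha beta hb} F Fdeg Fd h hZ FE hB => [|i] F Fdeg Fd h hZ FE hB.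
  move=> c; apply: (coef_inj KBe); rewrite FE cB0 big1// => x _.
  by rewrite [h x _]hB cA0.
have /choice[g gP] x : exists g : P i -> gplaced A_conn j,
    ghom g /\ forall m, h x m = g (rd P i m).
  by have [g gh gE] := hB x; exists g.
(* The primitives [g x] are summed over the columns, which reverses the passage from F to [h]. *)
exists (fun c : Tw r (P i) => (\sum_x cA (g x (c x)))%:A *: eB); last first.
  move=> c; apply: (coef_inj KBe); rewrite FE KBe.2; apply: eq_bigr => x _.
  by rewrite (gP x).2 Tw_mapE.
split=> [b c d|n c /Tw_degP cP]; last first.
  by apply: placedB => x; have [[_ gd] _] := gP x; exact: gd.
apply: (coef_inj KBe); rewrite (coefD KBe) [in RHS](coefZ KBe) !KBe.2.
rewrite mulr_sumr -big_split; apply: eq_bigr => x _ /=.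
have [[/linearE[g' gE] _] _] := gP x.
rewrite TwDE TwZE gE raddfD (coefD KAe) raddf_sum (coef_sum KAe); congr (_ + _).
rewrite (bigD1 x) //= linearZ_LR (coefZ KAe) rK eqxx mul1r big1 ?addr0// => y yx.
by rewrite linearZ_LR (coefZ KAe) rK eq_sym (negbTE yx) !mul0r.
Qed.

End KoszulTwist.

Section Koszul.
Variables (k : fieldType) (J : finType) (x0 : J) (A B : algType k).
Variables (r : mxmor J A B) (s : mxmor J B A).
Hypotheses (rs : mx_dual r s) (sr : mx_dual s r).
Hypothesis rk : forall c b x y, r (c *: b) x y = c *: r b x y.
Hypothesis sk : forall c a x y, s (c *: a) x y = c *: s a x y.
Variables (grA : nat -> {pred A}) (grB : nat -> {pred B}).
Hypothesis B_conn : connected_graded grB.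
Hypothesis r_gr : forall n b x y, b \in grB n -> r b x y \in grA n.
Hypothesis s_gr : forall n a x y, a \in grA n -> s a x y \in grB n.

Lemma Koszul_mx_dual : Koszul grA -> Koszul grB.
Proof.
move=> [A_conn AK]; split=> // i j /AK Aij.
have [A_alg _ _] := A_conn; have [B_alg _ _] := B_conn.
have [P _] := gext_model_exists A_alg (gplaced A_conn 0).
have [Q _] := gext_model_exists B_alg (gplaced B_conn 0).
have [cA KAe] := trivial_line A_conn; have [cB KBe] := trivial_line B_conn.
apply/(gem_Ext Q (gplaced B_conn j)).
apply: (Koszul_Tw x0 rs sr rk sk r_gr s_gr KAe KBe (P := P)).
exact/(gem_Ext P (gplaced A_conn j)).
Qed.

End Koszul.

(** * Noetherian rings *)

Section LspanTheory.
Variables (R : nzRingType) (M : lmodType R).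

Lemma lspan_le (S T : {pred M}) : submod_closed T -> {subset S <= T} -> {subset lspan S <= T}.
Proof.
move=> [T0 TP] ST x /asboolP[t tS ->]; elim: t tS => [|p t IHt] /=.
  by rewrite big_nil.
by move=> /andP[pS tS]; rewrite big_cons TP ?IHt ?ST.
Qed.

Lemma mem_lspan (S : {pred M}) x : x \in S -> x \in lspan S.
Proof.
move=> xS; apply/asboolP; exists [:: (1, x)]; first by rewrite /= xS.
by rewrite big_seq1 scale1r.
Qed.

End LspanTheory.

Section Noetherian.
Variables (R : nzRingType) (M : lmodType R).

Lemma lspan_cons x (t : seq M) z : z \in lspan [in x :: t] ->
  exists a, z - a *: x \in lspan [in t].
Proof.
pose T := [pred z | `[< exists a, z - a *: x \in lspan [in t] >]].
suff TP : submod_closed T.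
  move=> /(lspan_le TP)zT; apply/asboolP/zT => y; rewrite inE => /predU1P[->|yt].
    by apply/asboolP; exists 1; rewrite scale1r subrr rpred0.
  by apply/asboolP; exists 0; rewrite scale0r subr0 mem_lspan.
split=> [|c u v /asboolP[a au] /asboolP[b bv]]; apply/asboolP.
  by exists 0; rewrite scale0r subr0 rpred0.
exists (c * a + b); rewrite scalerDl -scalerA opprD addrACA -scalerBr.
by rewrite rpredD// rpredZ.
Qed.

(** Induction on the generators. Modulo the span of t, the coefficients at x of the elements of N
    form a left ideal; lifts to N of its generators, with generators of the part of N inside the
    span of t, generate N. *)
Lemma fg_noetherian (t : seq M) (N : {pred M}) : left_noetherian R ->
  submod_closed N -> {subset N <= lspan [in t]} -> exists u : seq M, lspan [in u] =i N.
Proof.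
move=> Rnoeth; elim: t N => [|x t IHt] N NP Nt.
  exists [::] => z; apply/idP/idP => [|/Nt//]; case: NP => N0 NP.
  by apply: lspan_le => //.
have [N0 NS] := NP.
pose I : {pred R^o} := [pred a | `[< exists2 y, y \in N & y - a *: x \in lspan [in t] >]].
have IP : submod_closed I.
  split=> [|c a b /asboolP[y yN ya] /asboolP[z zN zb]]; apply/asboolP.
    by exists 0; rewrite ?scale0r ?subrr ?rpred0.
  exists (c *: y + z); first exact: NS.
  rewrite scalerDl -[(c *: a) *: x]scalerA opprD addrACA -scalerBr.
  by rewrite rpredD// rpredZ.
have [g gI] := Rnoeth I IP.
have /choice[Y YP] (a : R^o) : exists y, a \in I -> y \in N /\ y - a *: x \in lspan [in t].
  have [aI|aI] := boolP (a \in I); last by exists 0.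
  by have /asboolP[y yN ya] := aI; exists y.
have [|z|u uE] := IHt [pred z | (z \in N) && (z \in lspan [in t])].
- split=> [|c y z]; first by apply/andP; split; last exact: rpred0.
  move=> /andP[yN yt] /andP[zN zt]; apply/andP; split; first exact: NS.
  by rewrite rpredD// rpredZ.
- by case/andP.
have gY a : a \in g -> Y a \in N /\ Y a - a *: x \in lspan [in t].
  by move=> ag; apply: YP; rewrite -gI mem_lspan.
exists ([seq Y a | a <- g] ++ u) => z; apply/idP/idP => [|zN].
  apply: lspan_le => // y; rewrite mem_cat => /orP[/mapP[a ag ->]|yu].
    by case: (gY a ag).
  have : y \in lspan [in u] by exact: mem_lspan.
  by rewrite uE => /andP[].
have [a za] := lspan_cons (Nt z zN).
have : a \in lspan [in g] by rewrite gI; apply/asboolP; exists z.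
(* [y] is generated by the lifts and has the coefficient of z at x, so z - y falls in N and in the
   span of t. *)
move=> /asboolP[c cg aE]; pose y := \sum_(p <- c) p.1 *: Y p.2.
have cgE p : p \in c -> p.2 \in g by move/(allP cg).
have yN : y \in N.
  rewrite /y big_seq; apply: (big_ind (fun y => y \in N)) => // [v w vN wN|p /cgE pg].
    by rewrite -[v]scale1r NS.
  by rewrite -[_ *: _]addr0 NS//; case: (gY _ pg).
have yg : y \in lspan [in [seq Y a | a <- g] ++ u].
  rewrite /y big_seq; apply: rpred_sum => p /cgE pg; apply: rpredZ.
  by apply: mem_lspan; rewrite mem_cat map_f.
have ya : y - a *: x \in lspan [in t].
  rewrite aE /y scaler_suml -sumrB big_seq; apply: rpred_sum => p /cgE pg.
  by rewrite -[(p.1 *: p.2) *: x]scalerA -scalerBr; apply: rpredZ; case: (gY _ pg).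
rewrite -[z](subrK y) rpredD//.
have /(lspan_le _) : {subset [in u] <= lspan [in [seq Y a | a <- g] ++ u]}.
  by move=> w wu; apply: mem_lspan; rewrite mem_cat wu orbT.
apply; first exact: lspan_submod.
rewrite uE; apply/andP; split; first by rewrite addrC -scaleN1r NS.
by rewrite -[z - y](subrKA (a *: x)) rpredD// -opprB rpredN.
Qed.

End Noetherian.

Section NoetherianTwist.
Variables (J : finType) (x0 : J) (A B : nzRingType).
Variables (r : mxmor J A B) (s : mxmor J B A).
Hypothesis rs : mx_dual r s.

(** The columns with entries in a left ideal I of B form an A-submodule of [Tw s B^o], which is
    finitely generated over A. The entries of its generators generate I, as one sees from the
    columns with a single entry at [x0]. *)
Lemma left_noetherian_Tw : left_noetherian A -> left_noetherian B.
Proof.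
move=> Anoeth I IP; have [I0 IS] := IP.
have [|t tB] := Tw_finitely_generated rs (N := B^o).
  exists [:: (1 : B^o)] => b; apply/idP/asboolP.
  exists [:: (b : B, 1 : B^o)]; first by rewrite /= inE eqxx.
  by rewrite big_seq1 -[RHS]/((b : B) * 1) mulr1.
pose N : {pred Tw s B^o} := [pred c | [forall x, (c : Tw s B^o) x \in I]].
have NP : submod_closed N.
  split=> [|a c d /forallP cI /forallP dI]; apply/forallP => x; first by rewrite ffunE.
  rewrite TwDE TwZE -[X in X + _]addr0; elim/big_rec: _ => [|y z _ zI].
    by rewrite addr0 add0r.
  by rewrite addr0 -addrA IS// -[z]addr0.
have [u uN] := fg_noetherian Anoeth NP (fun c _ => etrans (tB c) isT).
exists [seq (c : Tw s B^o) x | c <- u, x <- enum J] => b; apply/idP/idP.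
  apply: lspan_le => // z /allpairsP[[c x] [cu _ ->]] /=.
  have : c \in lspan [in u] by exact: mem_lspan.
  by rewrite uN => /forallP.
move=> bI; have : inj_at s x0 (b : B^o) \in lspan [in u].
  rewrite uN; apply/forallP => y; rewrite inj_atE; case: ifP => _ //.
move=> /asboolP[c cu /ffunP/(_ x0)]; rewrite inj_atE eqxx => ->.
rewrite sum_ffunE big_seq; apply: rpred_sum => p pc; rewrite TwZE.
apply: rpred_sum => y _; apply: rpredZ; apply: mem_lspan.
by apply/allpairsP; exists (p.2, y); rewrite mem_enum; split=> //; exact: (allP cu).
Qed.

End NoetherianTwist.

(** * Gelfand-Kirillov dimension *)

(* As in span_dim, k acts on an A-module through c |-> c%:A. *)
Definition kmod (k : fieldType) (A : algType k) (M : lmodType A) : Type := M.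
HB.instance Definition _ (k : fieldType) (A : algType k) (M : lmodType A) :=
  GRing.Zmodule.copy (kmod M) M.

Section Kmod.
Variables (k : fieldType) (A : algType k) (M : lmodType A).
Definition kscale (c : k) (x : kmod M) : kmod M := c%:A *: (x : M).

Lemma kscaleA a b x : kscale a (kscale b x) = kscale (a * b) x.
Proof. by rewrite /kscale scalerA mulr_algl scalerA. Qed.
Lemma kscale1 : left_id 1 kscale.
Proof. by move=> x; rewrite /kscale !scale1r. Qed.
Lemma kscaleDr : right_distributive kscale +%R.
Proof. by move=> c x y; exact: scalerDr. Qed.
Lemma kscaleDl x : {morph kscale^~ x : a b / a + b}.
Proof. by move=> a b; rewrite /kscale !scalerDl. Qed.

HB.instance Definition _ := GRing.Zmodule_isLmodule.Build k (kmod M)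
  kscaleA kscale1 kscaleDr kscaleDl.

Lemma kscaleE (c : k) (x : kmod M) : c *: x = c%:A *: (x : M).
Proof. by []. Qed.

Lemma kscale_comm (c : k) (a : A) (x : kmod M) :
  (a *: ((c *: x : kmod M) : M) : kmod M) = c *: (a *: (x : M) : kmod M).
Proof. by rewrite !kscaleE !scalerA mulr_algl mulr_algr. Qed.

End Kmod.

Section Dimension.
Variables (k : fieldType).

Section Independent.
Variables (V : lmodType k).
Implicit Types (t : seq V).

Definition indep t (I : {set 'I_(size t)}) :=
  forall c : 'I_(size t) -> k, \sum_(i in I) c i *: t`_i = 0 -> forall i, i \in I -> c i = 0.

Lemma max_indep t : exists I : {set 'I_(size t)}, indep I /\
  forall x, x \in lspan [in t] ->
    exists c : 'I_(size t) -> k, x = \sum_(i in I) c i *: t`_i.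
Proof.
pose Q (I : {set 'I_(size t)}) := `[< indep I >].
have ind0 : Q finset.set0.
  by apply/asboolP => c _ i; rewrite inE.
have [I /asboolP Iind Imax] := @arg_maxnP _ _ Q (fun I => #|I|) ind0.
exists I; split=> // x.
pose T := [pred x : V | `[< exists c : 'I_(size t) -> k, x = \sum_(i in I) c i *: t`_i >]].
suff xT : {subset lspan [in t] <= T} by move=> /xT/asboolP.
apply: lspan_le => [|y /nthP-/(_ 0)[j' ltj <-]].
  split=> [|a u v /asboolP[c ->] /asboolP[d ->]]; apply/asboolP.
    by exists (fun=> 0); rewrite big1// => i _; rewrite scale0r.
  exists (fun i => a * c i + d i); rewrite scaler_sumr -big_split.
  by apply: eq_bigr => i _; rewrite scalerDl scalerA.
apply/asboolP; pose j := Ordinal ltj; rewrite -[j']/(val j).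
have [jI|jI] := boolP (j \in I).
  exists (fun i => (i == j)%:R); rewrite (bigD1 j) //= eqxx scale1r.
  by rewrite big1 ?addr0// => i /andP[_ /negbTE ->]; rewrite scale0r.
have [c cE [i0 [i0I ci0]]] : exists2 c : 'I_(size t) -> k,
    \sum_(i in j |: I) c i *: t`_i = 0 & exists i0, i0 \in j |: I /\ c i0 != 0.
  apply: contrapT => noc; have : (#|j |: I| <= #|I|)%N.
    apply: Imax; apply/asboolP => c cE i iI; apply: contrapT => /eqP ci.
    by apply: noc; exists c => //; exists i.
  by rewrite cardsU1 jI add1n ltnn.
move: cE; rewrite big_setU1 //= => cE.
have cj : c j != 0.
  apply/eqP => cj; move: cE; rewrite cj scale0r add0r => /Iind cI.
  move: i0I; rewrite !inE => /predU1P[i0j|/cI ci00]; last by rewrite ci00 eqxx in ci0.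
  by rewrite i0j cj eqxx in ci0.
exists (fun i => - ((c j)^-1 * c i)).
have -> : t`_j = (c j)^-1 *: (c j *: t`_j) by rewrite scalerA mulVf// scale1r.
move/(canRL (addrK _)): cE => ->; rewrite sub0r scalerN scaler_sumr -sumrN.
by apply: eq_bigr => i _; rewrite scaleNr scalerA.
Qed.

End Independent.

(** The jointly injective maps [theta] embed V in W^L, where the vectors of t fall in a space
    spanned by |L| |I'| vectors. *)
Lemma indep_card_le (V W : lmodType k) (L : finType) (theta : L -> {linear V -> W})
    (t : seq V) (u : seq W) (I : {set 'I_(size t)}) (I' : {set 'I_(size u)}) :
  (forall v, (forall x, theta x v = 0) -> v = 0) ->
  (forall x v, v \in t -> exists c : 'I_(size u) -> k,
     theta x v = \sum_(j in I') c j *: u`_j) ->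
  indep I -> (#|I| <= #|L| * #|I'|)%N.
Proof.
move=> inj tu Iind; rewrite leqNgt; apply/negP => ltI.
have /choice[c cE] (q : L * 'I_(size t)) : exists c : 'I_(size u) -> k,
    theta q.1 t`_q.2 = \sum_(j in I') c j *: u`_j.
  by apply: tu; exact: mem_nth.
have [|b [[i0 i0I bi0] bE]] := @lin_dep k _ _ I (finset.setX [set: L]%SET I')
  (fun i q => c (q.1, i) q.2).
  by rewrite cardsX cardsT.
suff : \sum_(i in I) b i *: t`_i = 0 by move=> /Iind/(_ i0 i0I)/eqP; rewrite (negbTE bi0).
apply: inj => x; rewrite raddf_sum /=.
under eq_bigr do rewrite linearZ_LR (cE (x, _)) scaler_sumr.
rewrite exchange_big big1 //= => j jI'.
under eq_bigr do rewrite scalerA.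
by rewrite -scaler_suml (bE (x, j)) ?scale0r// !inE.
Qed.

End Dimension.

Section SpanDim.
Variables (k : fieldType) (A B : algType k) (M : lmodType A) (N : lmodType B).
Variables (L : finType) (theta : L -> {linear kmod M -> kmod N}).
Hypothesis theta_inj : forall m, (forall x, theta x m = 0) -> m = 0.

Lemma span_dim_le (t : seq M) (u : seq N) :
  (forall x m, m \in t -> theta x m \in lspan [in (u : seq (kmod N))]) ->
  (span_dim t <= #|L| * span_dim u)%N.
Proof.
move=> tu; have [I' [I'ind I'span]] := max_indep (u : seq (kmod N)).
have leI' : (#|I'| <= span_dim u)%N.
  rewrite /span_dim.
  refine (@leq_bigmax_cond _ _ (fun I : {set 'I_(size u)} => #|I|) I' _).
  by apply/asboolP => c /I'ind.
apply/bigmax_leqP => I /asboolP Iind.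
apply: leq_trans (leq_mul (leqnn _) leI').
apply: (indep_card_le (t := t : seq (kmod M)) theta_inj) => // x m mt.
exact/I'span/tu.
Qed.

Variable comp : A -> seq B.
Hypothesis theta_comp : forall (a : A) (m : kmod M) x,
  theta x (a *: (m : M)) \in
    lspan [in [seq (b *: (theta y m : N) : kmod N) | b <- comp a, y <- enum L]].

Lemma lspan_scale (b : B) (u w : seq (kmod N)) :
  (forall v, v \in u -> (b *: (v : N) : kmod N) \in lspan [in w]) ->
  forall v : kmod N, v \in lspan [in u] -> (b *: (v : N) : kmod N) \in lspan [in w].
Proof.
move=> uw v /asboolP[c cu ->]; rewrite [X in X \in _]scaler_sumr big_seq.
apply: rpred_sum => p pc; rewrite kscale_comm; apply: rpredZ.
exact/uw/(allP cu).
Qed.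

(** Each letter a is replaced by letters of [comp a], so word lengths do not grow and the two
    filtrations are compared at the same n. *)
Lemma words_span (s : seq A) (t : seq M) (u : seq N) n :
  (forall x m, m \in t -> theta x m \in lspan [in (u : seq (kmod N))]) ->
  forall x w m, w \in words s n -> m \in t ->
    theta x (w *: m) \in lspan [in ([seq w' *: v |
      w' <- words (flatten [seq comp a | a <- s]) n, v <- u] : seq (kmod N))].
Proof.
pose s' := flatten [seq comp a | a <- s]; rewrite -/s' => tu.
have base x m n' : m \in t -> theta x m \in
    lspan [in ([seq w' *: v | w' <- words s' n', v <- u] : seq (kmod N))].
  move=> mt; apply: lspan_le (tu x m mt); first exact: lspan_submod.
  move=> v vu; apply: mem_lspan; apply/allpairsP; exists (1, v).
  by rewrite scale1r; split=> //; case: n' => *; exact: mem_head.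
elim: n => [|n IHn] x w m /=.
  by rewrite inE => /eqP -> mt; rewrite scale1r; apply: (base _ _ 0%N).
rewrite inE => /predU1P[->|/allpairsP[[a w0] [/= aS w0W ->]]] mt.
  by rewrite scale1r; apply: (base _ _ n.+1).
rewrite -scalerA; apply: lspan_le (theta_comp a (w0 *: m) x); first exact: lspan_submod.
move=> v vS; have /allpairsP[[b y] [/= bC _ vE]] :
  v \in [seq (b *: (theta y (w0 *: m) : N) : kmod N) | b <- comp a, y <- enum L] := vS.
rewrite {}vE {vS}.
apply: lspan_scale (IHn y w0 m w0W mt) => {}v vS.
have /allpairsP[[w' v'] [/= w'W v'u vE]] :
  (v : N) \in [seq w' *: v | w' <- words s' n, v <- u] := vS.
rewrite {}vE {vS}.
apply: mem_lspan.
suff : b *: (w' *: v') \in [seq w *: v | w <- words s' n.+1, v <- u] by [].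
apply/allpairsP; exists (b * w', v') => /=; rewrite scalerA; split=> //.
rewrite inE; apply/orP; right.
apply/allpairsP; exists (b, w'); split=> //=.
by apply/flattenP; exists (comp a) => //; apply: map_f.
Qed.

End SpanDim.

Section LimsupLn.
Local Open Scope classical_set_scope.

Lemma ln_nat_ge0 (R : realType) (n : nat) : (0 <= ln n%:R :> R).
Proof. by case: n => [|n]; [rewrite ln0 | apply: ln_ge0; rewrite ler1n]. Qed.

(** [C.+1] is positive, so the logarithm of the product splits even when C is 0. *)
Lemma ln_nat_le (R : realType) (d e C : nat) : (d <= C.+1 * e)%N ->
  ln d%:R <= ln C.+1%:R + ln e%:R :> R.
Proof.
(* A zero span has dimension 0, where [ln] takes the default value 0. *)
case: d => [|d]; first by move=> _; rewrite ln0// addr_ge0// ln_nat_ge0.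
case: e => [|e]; first by rewrite muln0.
by move=> de; rewrite -lnM ?posrE ?ltr0n// -natrM ler_ln ?posrE ?ltr0n// ler_nat.
Qed.

Lemma ln_nat_unbounded (R : realType) (K : R) :
  exists N : nat, forall n, (N <= n)%N -> 0 < ln (n%:R : R) /\ K <= ln n%:R.
Proof.
exists (maxn 2 (Num.bound (expR K))) => n; rewrite geq_max => /andP[n2 nK].
have n0 : (0 < n)%N by exact: ltn_trans n2.
split; first by rewrite ln_gt0// ltr1n.
rewrite -[K]expRK ler_ln ?posrE ?expR_gt0 ?ltr0n//.
apply: le_trans (ltW (archi_boundP (expR_ge0 K))) _.
by rewrite ler_nat.
Qed.

(** The factor C adds a constant to the logarithm; divided by ln n, it is below any eps for large
    n. *)
Lemma limn_esup_ln_le (R : realType) (d e : nat -> nat) (C : nat) :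
  (forall n, d n <= C * e n)%N ->
  (limn_esup (fun n => (ln (d n)%:R / ln n%:R)%:E : \bar R) <=
   limn_esup (fun n => (ln (e n)%:R / ln n%:R)%:E : \bar R))%E.
Proof.
move=> de; set u := fun n => _; set v := fun n => (ln (e n)%:R / _)%:E.
apply/lee_addgt0Pr => eps eps0.
have [N NP] : exists N : nat, forall n, (N <= n)%N -> (u n <= v n + eps%:E)%E.
  have [N NP] := ln_nat_unbounded (ln C.+1%:R / eps : R); exists N => n /NP[n0 nC].
  rewrite /u /v -EFinD lee_fin ler_pdivrMr// mulrDl mulfVK ?gt_eqF// addrC.
  apply: le_trans (_ : ln C.+1%:R + ln (e n)%:R <= _).
    by apply: ln_nat_le; rewrite (leq_trans (de n))// leq_mul2r leqnSn orbT.
  by rewrite lerD2r mulrC -ler_pdivrMr.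
rewrite -leeBlDr//; apply: le_ereal_inf_tmp => _ [S Sinf <-].
(* The limsup is an infimum of suprema over sets of the filter at infinity, and cutting S down to n
   >= N stays among them. *)
rewrite leeBlDr//; apply: le_trans (_ : ereal_sup (u @` (S `&` [set n | (N <= n)%N])) <= _)%E.
  apply: ereal_inf_lbound; exists (S `&` [set n | (N <= n)%N]) => //.
  by apply: filterI => //; exists N.
apply: ge_ereal_sup => _ [n [Sn Nn] <-]; apply: le_trans (NP n Nn) _.
by rewrite leeD2r//; apply: ereal_sup_ubound; exists n.
Qed.

End LimsupLn.

Section Growth.
Variables (R : realType) (k : fieldType) (A B : algType k).
Variables (M : lmodType A) (N : lmodType B).
Variables (L : finType) (theta : L -> {linear kmod M -> kmod N}) (comp : A -> seq B).
Hypothesis theta_inj : forall m, (forall x, theta x m = 0) -> m = 0.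
Hypothesis theta_comp : forall (a : A) (m : kmod M) x,
  theta x (a *: (m : M)) \in
    lspan [in [seq (b *: (theta y m : N) : kmod N) | b <- comp a, y <- enum L]].

Lemma growth_le (s : seq A) (t : seq M) (u : seq N) :
  (forall x m, m \in t -> theta x m \in lspan [in (u : seq (kmod N))]) ->
  (growth_exponent R s t <= growth_exponent R (flatten [seq comp a | a <- s]) u)%E.
Proof.
move=> tu; apply: (@limn_esup_ln_le R _ _ #|L|) => n.
apply: (span_dim_le theta_inj) => x m /allpairsP[[w m'] [/= ws mt ->]].
exact: (words_span theta_comp tu).
Qed.

Lemma GKdim_mod_le : (GKdim_mod R M <= GKdim_mod R N)%E.
Proof.
apply: ge_ereal_sup => _ [[s t] _ <-] /=.
pose u : seq N := [seq theta x m | m <- t, x <- enum L].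
apply: le_trans (growth_le s (t := t) (u := u) _) _.
  move=> x m mt; apply: mem_lspan.
  suff : (theta x m : N) \in u by [].
  by apply/allpairsP; exists (m, x); rewrite mem_enum.
by apply: ereal_sup_ubound; exists (flatten [seq comp a | a <- s], u).
Qed.

End Growth.

Section GKTwist.
Variables (R : realType) (k : fieldType) (J : finType) (x0 : J) (A B : algType k).
Variables (r : mxmor J A B) (s : mxmor J B A).
Hypotheses (rs : mx_dual r s) (sr : mx_dual s r).
Hypothesis sk : forall c a x y, s (c *: a) x y = c *: s a x y.

Let entries_mem (C D : algType k) (q : mxmor J D C) (c : C) x y :
  q c x y \in [seq q c p.1 p.2 | p : J * J].
Proof. by apply/mapP; exists (x, y); rewrite ?mem_enum. Qed.

Lemma Tw_kscale (N : lmodType B) (a : k) (c : Tw s N) x :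
  (a%:A *: c) x = a%:A *: c x.
Proof.
rewrite TwZE (bigD1 x) //= sk mxm1 eqxx big1 ?addr0// => y yx.
by rewrite sk mxm1 eq_sym (negbTE yx) scaler0 scale0r.
Qed.

(** The coordinates embed [Tw s N] in N^J and turn the action of a into that of the finitely many
    entries of [s a]. *)
Lemma GKdim_mod_Tw_le (N : lmodType B) :
  (GKdim_mod R (Tw s N : lmodType A) <= GKdim_mod R N)%E.
Proof.
have evl x : linear (fun c : kmod (Tw s N : lmodType A) => ((c : Tw s N) x : kmod N)).
  by move=> a c d; rewrite kscaleE TwDE Tw_kscale.
apply: (@GKdim_mod_le R k A B _ _ J (fun x => mklin (evl x))
  (fun a => [seq s a p.1 p.2 | p : J * J])) => [c c0|a c x /=].
  by apply/ffunP => x; have := c0 x; rewrite /= Tw0E.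
rewrite TwZE; apply: rpred_sum => y _; apply: mem_lspan.
suff : s a x y *: (c : Tw s N) y \in
    [seq b *: (c : Tw s N) z | b <- [seq s a p.1 p.2 | p : J * J], z <- enum J] by [].
by apply/allpairsP; exists (s a x y, y); rewrite entries_mem mem_enum.
Qed.

(** The reverse comparison uses the columns [inj_at s x] and the entries of [r b]. *)
Lemma GKdim_mod_le_Tw (N : lmodType B) :
  (GKdim_mod R N <= GKdim_mod R (Tw s N : lmodType A))%E.
Proof.
have inl x : linear (fun n : kmod N => (inj_at s x (n : N) : kmod (Tw s N : lmodType A))).
  move=> a m n; rewrite inj_atD; congr (_ + _); rewrite kscaleE.
  apply/ffunP => y; rewrite Tw_kscale !inj_atE.
  by case: ifP => // _; rewrite scaler0.
apply: (@GKdim_mod_le R k B A _ _ J (fun x => mklin (inl x))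
  (fun b => [seq r b p.1 p.2 | p : J * J])) => [n n0|b n x /=].
  by have /ffunP/(_ x0) := n0 x0; rewrite /= inj_atE eqxx Tw0E.
rewrite (inj_at_scale rs); apply: rpred_sum => y _; apply: mem_lspan.
suff : r b x y *: inj_at s y (n : N) \in
    [seq a *: inj_at s z (n : N) | a <- [seq r b p.1 p.2 | p : J * J], z <- enum J] by [].
by apply/allpairsP; exists (r b x y, y); rewrite entries_mem mem_enum.
Qed.

Lemma GKdim_mod_Tw (N : lmodType B) :
  GKdim_mod R (Tw s N : lmodType A) = GKdim_mod R N.
Proof. by apply/eqP; rewrite eq_le GKdim_mod_Tw_le GKdim_mod_le_Tw. Qed.

(** The |J|^2 entries of [s] are maps from A to B, jointly injective because the dual pair recovers
    an element from them. They send 1 to 0 or 1, so the growth of the algebras themselves is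
    compared. *)
Lemma GKdim_le_mx : (GKdim R A <= GKdim R B)%E.
Proof.
apply: ge_ereal_sup => _ [t _ <-] /=.
have sl (p : J * J) : linear (fun a : kmod A^o => (s a p.1 p.2 : kmod B^o)).
  move=> c a b; rewrite mxmD !kscaleE.
  rewrite -[X in s X]/(c%:A * (a : A)) mulr_algl sk.
  by rewrite -[X in _ = X + _]/(c%:A * s a p.1 p.2) mulr_algl.
have H := @growth_le R k A B A^o B^o _ (fun p => mklin (sl p))
  (fun a => [seq s a p.1 p.2 | p : J * J]).
apply: le_trans (H _ _ t [:: 1%R : A^o] [:: 1%R : B^o] _) _.
- move=> m m0; have := sr.1 m x0 x0; rewrite eqxx mul1r => <-.
  by apply: big1 => y _; rewrite [s m x0 y](m0 (x0, y)) mxm0.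
- move=> a m [x z] /=; rewrite -[X in s X]/(a * (m : A)) mxmM.
  apply: rpred_sum => y _; apply: mem_lspan.
  suff : s a x y * s m y z \in [seq (b : B) * s m p.1 p.2 |
      b <- [seq s a p.1 p.2 | p : J * J], p <- enum {: J * J}] by [].
  by apply/allpairsP; exists (s a x y, (y, z)); rewrite entries_mem mem_enum.
- move=> [x y] m; rewrite inE => /eqP -> /=; rewrite mxm1; case: eqP => _.
    by apply: mem_lspan; rewrite inE.
  exact: rpred0.
by apply: ereal_sup_ubound; exists (flatten [seq [seq s a p.1 p.2 | p : J * J] | a <- t]).
Qed.

End GKTwist.

(** * Transfer of the homological properties *)

Lemma connected_graded_op (k : fieldType) (A : algType k) (gr : nat -> {pred A}) :
  connected_graded gr -> connected_graded (gr : nat -> {pred A^c}).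
Proof.
move=> [[grS gr1 grM grD grI] gr0 grF]; split=> //; split=> //.
by move=> m n a b am bn; rewrite addnC; exact: grM.
Qed.

Section Transfer.
Variables (R : realType) (k : fieldType) (J : finType) (x0 : J) (A B : algType k).
Variables (r : mxmor J A B) (s : mxmor J B A).
Hypotheses (rs : mx_dual r s) (sr : mx_dual s r).
Hypothesis rk : forall c b x y, r (c *: b) x y = c *: r b x y.
Hypothesis sk : forall c a x y, s (c *: a) x y = c *: s a x y.
Hypothesis J_neq0 : #|J|%:R != 0 :> k.

Lemma GKdim_mx : GKdim R A = GKdim R B.
Proof.
by apply/eqP; rewrite eq_le (GKdim_le_mx R x0 sr sk) (GKdim_le_mx R x0 rs rk).
Qed.

Lemma gldim_mx n : gldim_le A n <-> gldim_le B n.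
Proof.
have vC (C : algType k) (c : C) : (#|J|%:R^-1)%:A * c = c * (#|J|%:R^-1)%:A.
  by rewrite mulr_algl mulr_algr.
have v1 (C : algType k) : (#|J|%:R^-1)%:A *+ #|J| = 1 :> C.
  by rewrite -scaler_nat scalerA mulfV// scale1r.
split; first exact: (gldim_Tw rs sr (vC B) (v1 B)).
exact: (gldim_Tw sr rs (vC A) (v1 A)).
Qed.

Lemma left_gldim_mx d : left_gldim A d -> left_gldim B d.
Proof. by move=> [Ad Amin]; split=> [|n]; rewrite -gldim_mx//; exact: Amin. Qed.

(** [D] is a parameter because right modules too are measured against the dimension of A and not of
    [A^c]. *)
Lemma left_CM_mx (D : \bar R) :
  (forall M : lmodType A, finitely_generated M -> (exists x : M, x != 0) ->
     (GKdim_mod R M + grade R M = D)%E) ->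
  (forall M : lmodType B, finitely_generated M -> (exists x : M, x != 0) ->
     (GKdim_mod R M + grade R M = D)%E).
Proof.
move=> HA M Mfg [m m0]; rewrite -(HA (Tw s M)).
- by rewrite (grade_Tw rs sr R x0) (GKdim_mod_Tw R x0 rs sk).
- exact: (Tw_finitely_generated rs).
- exists (inj_at s x0 m); apply/eqP => /ffunP/(_ x0).
  by rewrite inj_atE eqxx Tw0E => mE; rewrite mE eqxx in m0.
Qed.

End Transfer.

Section TwoSided.
Variables (R : realType) (k : fieldType) (J : finType) (x0 : J) (A B : algType k).
Variables (r : mxmor J A B) (s : mxmor J B A).
Hypotheses (rs : mx_dual r s) (sr : mx_dual s r).
Hypothesis rk : forall c b x y, r (c *: b) x y = c *: r b x y.
Hypothesis sk : forall c a x y, s (c *: a) x y = c *: s a x y.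
Hypothesis J_neq0 : #|J|%:R != 0 :> k.

Let rop : mxmor J A^c B^c := mxmor_op r.
Let sop : mxmor J B^c A^c := mxmor_op s.
Let rsop : mx_dual rop sop := mx_dual_op rs.
Let srop : mx_dual sop rop := mx_dual_op sr.
Let rkop c (b : B^c) x y : rop (c *: b) x y = c *: rop b x y.
Proof. exact: rk. Qed.
Let skop c (a : A^c) x y : sop (c *: a) x y = c *: sop a x y.
Proof. exact: sk. Qed.

Lemma noetherian_mx : noetherian A -> noetherian B.
Proof.
move=> [Al Ar]; split; first exact: (left_noetherian_Tw x0 rs).
exact: (left_noetherian_Tw x0 rsop).
Qed.

Lemma Auslander_regular_mx : Auslander_regular R A -> Auslander_regular R B.
Proof.
move=> [Al Ar [d Ad] [d' Ad']]; split.
- exact: (Auslander_Tw x0 rs sr).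
- exact: (Auslander_Tw x0 rsop srop).
- by exists d; exact: (left_gldim_mx rs sr).
- by exists d'; exact: (left_gldim_mx (A := A^c) (B := B^c) rsop srop).
Qed.

Lemma Cohen_Macaulay_mx : Cohen_Macaulay R A -> Cohen_Macaulay R B.
Proof.
rewrite /Cohen_Macaulay (GKdim_mx R x0 rs sr rk sk) => -[Al Ar]; split.
  exact: (left_CM_mx x0 rs sr sk Al).
exact: (left_CM_mx x0 (A := A^c) (B := B^c) rsop srop skop Ar).
Qed.

Variables (grA : nat -> {pred A}) (grB : nat -> {pred B}).
Hypothesis B_conn : connected_graded grB.
Hypothesis r_gr : forall n b x y, b \in grB n -> r b x y \in grA n.
Hypothesis s_gr : forall n a x y, a \in grA n -> s a x y \in grB n.

Lemma AS_regular_mx d : AS_regular R grA d -> AS_regular R grB d.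
Proof.
move=> [A_conn A_GK [Al Ar] AG AGop]; split=> //.
- by rewrite -(GKdim_mx R x0 rs sr rk sk).
- split; first exact: (left_gldim_mx rs sr).
  exact: (left_gldim_mx (A := A^c) (B := B^c) rsop srop).
- exact: (AS_Gorenstein_Tw x0 rs sr rk sk A_conn B_conn r_gr s_gr).
- exact: (AS_Gorenstein_Tw x0 rsop srop rkop skop (connected_graded_op A_conn)
    (connected_graded_op B_conn) (fun n b x y => r_gr y x (b:=b) (n:=n))
    (fun n a x y => s_gr y x (a:=a) (n:=n))).
Qed.

End TwoSided.

(** * Cocycle twists *)

Section CocycleTwist.
Variables (k : fieldType) (gT : finGroupType) (A : algType k).
Variables (act : gT -> {lrmorphism A -> A}) (chi mu : gT -> gT -> k).
Hypotheses (cardG : [pchar k]^'.-nat #|gT|) (actP : is_algebra_action act).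
Hypotheses (chiP : is_dual_iso chi) (muP : normalised_cocycle mu).

Local Notation proj := (isotypic_proj act chi).
Local Notation B := (cocycle_twist cardG actP chiP muP : algType k).

Let proj_in := isotypic_proj_in actP chiP.
Let proj_id := @isotypic_proj_id k gT A act chi cardG chiP.
Let proj_sum := isotypic_sum cardG actP chiP.

Lemma proj_sum_left (x : gT) a : \sum_y proj (x * y^-1)%g a = a.
Proof.
rewrite -[RHS]proj_sum [RHS](reindex_inj (h := fun y => x * y^-1)%g) //.
by move=> y z /mulgI/invg_inj.
Qed.

Lemma proj_sum_right (z : gT) a : \sum_x proj (x * z^-1)%g a = a.
Proof. by rewrite -[RHS]proj_sum [RHS](reindex_inj (mulIg z^-1%g)). Qed.

(** The pairs (g, h) with g h = x z^-1 are the (x y^-1, y z^-1) for y in G, which turns a graded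
    product into a matrix product. Weight 1 gives the product of A, weight mu that of the twist. *)
Lemma proj_mul_weight (w : gT -> gT -> k) x z a b :
  proj (x * z^-1)%g (\sum_g \sum_h w g h *: (proj g a * proj h b)) =
  \sum_y w (x * y^-1)%g (y * z^-1)%g *: (proj (x * y^-1)%g a * proj (y * z^-1)%g b).
Proof.
rewrite raddf_sum (reindex_inj (h := fun y => x * y^-1)%g) /=; last first.
  by move=> y y' /mulgI/invg_inj.
apply: eq_bigr => y _.
rewrite raddf_sum (reindex_inj (h := fun v => y * v^-1)%g) /=; last first.
  by move=> v v' /mulgI/invg_inj.
rewrite (bigD1 z) //= big1 ?addr0 => [|v vz]; rewrite linearZ_LR /=.
  rewrite (proj_id _ (isotypicM chiP (proj_in _ _) (proj_in _ _))).
  by rewrite mulgA mulgKV eqxx scale1r.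
rewrite (proj_id _ (isotypicM chiP (proj_in _ _) (proj_in _ _))) mulgA mulgKV.
by rewrite (inj_eq (mulgI x)) (inj_eq invg_inj) (negbTE vz) scale0r scaler0.
Qed.

Lemma proj_mul x z a b : proj (x * z^-1)%g (a * b) =
  \sum_y proj (x * y^-1)%g a * proj (y * z^-1)%g b.
Proof.
transitivity (proj (x * z^-1)%g (\sum_g \sum_h 1 *: (proj g a * proj h b))).
  congr (proj _ _); rewrite -{1}[a]proj_sum mulr_suml; apply: eq_bigr => g _.
  by rewrite -{1}[b]proj_sum mulr_sumr; apply: eq_bigr => h _; rewrite scale1r.
by rewrite proj_mul_weight; apply: eq_bigr => y _; rewrite scale1r.
Qed.

Lemma proj_idx (x y z : gT) a : proj (z * y^-1)%g (proj (x * y^-1)%g a) =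
  (x == z)%:R *: proj (x * y^-1)%g a.
Proof. by rewrite (proj_id _ (proj_in _ _)) (inj_eq (mulIg _)). Qed.

Lemma proj_idx' (x y z : gT) a : proj (x * y^-1)%g (proj (x * z^-1)%g a) =
  (z == y)%:R *: proj (x * z^-1)%g a.
Proof.
by rewrite (proj_id _ (proj_in _ _)) (inj_eq (mulgI x)) (inj_eq invg_inj).
Qed.

Lemma proj1 x y : proj (x * y^-1)%g 1 = (x == y)%:R.
Proof.
rewrite (proj_id _ (isotypic1 act chiP)) eq_sym -eq_mulgV1.
by case: eqP => _; rewrite ?scale1r ?scale0r.
Qed.

Let mu_neq0 g h : mu g h != 0. Proof. by case: muP. Qed.

(** The cocycle identity at (x y^-1, y z^-1, z). It makes [untwist] multiplicative and, after
    inversion, [retwist] too. *)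
Let muC x y z : mu (x * z^-1)%g z * mu (x * y^-1)%g (y * z^-1)%g =
  mu (x * y^-1)%g y * mu (y * z^-1)%g z.
Proof.
have [_ /(_ (x * y^-1)%g (y * z^-1)%g z)] := muP.
by rewrite !mulgKV mulgA mulgKV mulrC => ->.
Qed.

Definition untwist_fun (b : B) (x y : gT) : A :=
  mu (x * y^-1)%g y *: proj (x * y^-1)%g (b : A).

Definition retwist_fun (a : A) (x y : gT) : B :=
  ((mu (x * y^-1)%g y)^-1 *: proj (x * y^-1)%g a : A).

Lemma untwist_funD b c x y :
  untwist_fun (b + c) x y = untwist_fun b x y + untwist_fun c x y.
Proof. by rewrite /untwist_fun raddfD scalerDr. Qed.

Lemma retwist_funD a c x y :
  retwist_fun (a + c) x y = retwist_fun a x y + retwist_fun c x y.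
Proof. by rewrite /retwist_fun raddfD scalerDr. Qed.

Lemma untwist_funM b c x z :
  untwist_fun (b * c) x z = \sum_y untwist_fun b x y * untwist_fun c y z.
Proof.
rewrite /untwist_fun -[b * c]/(twist_mul act chi mu b c) /twist_mul.
rewrite proj_mul_weight scaler_sumr; apply: eq_bigr => y _.
move: (proj _ (b : A)) (proj _ (c : A)) => u v.
by rewrite -scalerAl -scalerAr !scalerA muC.
Qed.

Lemma retwist_funM a c x z :
  retwist_fun (a * c) x z = \sum_y retwist_fun a x y * retwist_fun c y z.
Proof.
rewrite /retwist_fun proj_mul [LHS]scaler_sumr; apply: eq_bigr => y _.
set g := (x * y^-1)%g; set h := (y * z^-1)%g.
rewrite -[RHS]/(twist_mul act chi mu ((mu g y)^-1 *: proj g a) ((mu h z)^-1 *: proj h c)).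
rewrite -twist_scaleAl -twist_scaleAr (twist_mulE mu cardG chiP (proj_in _ _) (proj_in _ _)).
move: (proj _ a * proj _ c) => u; rewrite !scalerA; congr (_ *: _).
apply: (mulfI (mu_neq0 (x * z^-1)%g z)); rewrite mulfV// [RHS]mulrCA muC.
by rewrite mulrACA !mulVf ?mulr1.
Qed.

Lemma untwist_fun1 x y : untwist_fun 1 x y = (x == y)%:R.
Proof.
rewrite /untwist_fun proj1; have [->|_] := eqVneq x y; last by rewrite scaler0.
by rewrite mulgV; have [_ _ /(_ y)[-> _]] := muP; rewrite scale1r.
Qed.

Lemma retwist_fun1 x y : retwist_fun 1 x y = (x == y)%:R.
Proof.
rewrite /retwist_fun proj1; have [->|_] := eqVneq x y; last by rewrite scaler0.
by rewrite mulgV; have [_ _ /(_ y)[-> _]] := muP; rewrite invr1 scale1r.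
Qed.

(* b |-> (mu(g, y) b_g)_{x, y} with g = x y^-1 embeds A^{G,mu} in M_G(A);
   retwist is the same for A, seen as the twist of A^{G,mu} by mu^-1. *)
Definition untwist : mxmor gT A B := Mxmor untwist_funD untwist_funM untwist_fun1.
Definition retwist : mxmor gT B A := Mxmor retwist_funD retwist_funM retwist_fun1.

Lemma untwistZ c b x y : untwist (c *: b) x y = c *: untwist b x y.
Proof.
rewrite /= /untwist_fun (linearZ_LR (proj _)) /=; move: (proj _ _) => u.
by rewrite !scalerA mulrC.
Qed.

Lemma retwistZ c a x y : retwist (c *: a) x y = c *: retwist a x y.
Proof.
rewrite /= /retwist_fun (linearZ_LR (proj _)) /=; move: (proj _ _) => u.
by rewrite [LHS]scalerA [RHS]scalerA mulrC.
Qed.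

(** In the first identity the two projections are onto the degrees x y^-1 and z y^-1, which differ
    unless x = z. On the diagonal the values of mu cancel and the sum over y collects all components
    of b. The second identity is similar. *)
Lemma untwist_retwist : mx_dual untwist retwist.
Proof.
split=> b x z; rewrite /= /untwist_fun /retwist_fun.
  rewrite -[in RHS](proj_sum_left x b) mulr_natl -sumrMnl.
  apply: eq_bigr => y _; rewrite (linearZ_LR (proj _)) /= proj_idx.
  move: (proj _ _) => u; have [->|_] := eqVneq; last by rewrite scale0r !scaler0.
  by rewrite scale1r scalerA mulVf ?scale1r.
rewrite -[in RHS](proj_sum_right x b) mulr_natl -sumrMnl.
apply: eq_bigr => y _; rewrite (linearZ_LR (proj _)) /= proj_idx'.
move: (proj _ _) => u; have [->|_] := eqVneq; last by rewrite scale0r !scaler0.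
by rewrite scale1r scalerA mulVf ?scale1r.
Qed.

Lemma retwist_untwist : mx_dual retwist untwist.
Proof.
split=> b x z; rewrite /= /untwist_fun /retwist_fun.
  rewrite -[in RHS](proj_sum_left x b) mulr_natl -sumrMnl.
  apply: eq_bigr => y _; rewrite (linearZ_LR (proj _)) /= proj_idx.
  move: (proj _ _) => u; have [->|_] := eqVneq; last by rewrite scale0r !scaler0.
  by rewrite scale1r scalerA mulfV ?scale1r.
rewrite -[in RHS](proj_sum_right x b) mulr_natl -sumrMnl.
apply: eq_bigr => y _; rewrite (linearZ_LR (proj _)) /= proj_idx'.
move: (proj _ _) => u; have [->|_] := eqVneq; last by rewrite scale0r !scaler0.
by rewrite scale1r scalerA mulfV ?scale1r.
Qed.

(** Normalisation gives mu(g, 1) = 1. In a tensor product with G acting on one factor, the other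
    factor lies in the neutral degree and is thus multiplied as before. *)
Lemma twist_mul_inv_r a v : v \in isotypic act chi 1%g -> twist_mul act chi mu a v = a * v.
Proof.
move=> v1; rewrite /twist_mul -[in RHS](proj_sum a) mulr_suml; apply: eq_bigr => g _.
rewrite (bigD1 1%g) //= big1 ?addr0 => [|h h1]; rewrite (proj_id _ v1).
  by rewrite eqxx scale1r; have [_ _ /(_ g)[_ ->]] := muP; rewrite scale1r.
by rewrite eq_sym (negbTE h1) scale0r mulr0 scaler0.
Qed.

Lemma twist_mul_inv_l a v : v \in isotypic act chi 1%g -> twist_mul act chi mu v a = v * a.
Proof.
move=> v1; rewrite /twist_mul exchange_big -[in RHS](proj_sum a) mulr_sumr.
apply: eq_bigr => g _.
rewrite (bigD1 1%g) //= big1 ?addr0 => [|h h1]; rewrite (proj_id _ v1).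
  by rewrite eqxx scale1r; have [_ _ /(_ g)[-> _]] := muP; rewrite scale1r.
by rewrite eq_sym (negbTE h1) scale0r mul0r scaler0.
Qed.

Lemma act_proj g h a : act g (proj h a) = proj h (act g a).
Proof.
rewrite -[in RHS](proj_sum a) !linear_sum /= (bigD1 h) //=.
have actE l : act g (proj l a) = chi l^-1%g g *: proj l a.
  exact: (isotypicP _ _ _ _ (proj_in l a)).
rewrite !actE big1 ?addr0 => [|l lh]; rewrite ?actE (linearZ_LR (proj _)) /=.
  by rewrite (proj_id _ (proj_in _ _)) eqxx scale1r.
by rewrite (proj_id _ (proj_in _ _)) (negbTE lh) scale0r scaler0.
Qed.

Section Grading.
Variable gr : nat -> {pred A}.
Hypothesis act_gr : forall g n a, a \in gr n -> act g a \in gr n.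
Hypothesis gr_submod : forall n, submod_closed (gr n).

Lemma proj_gr g n a : a \in gr n -> proj g a \in gr n.
Proof.
have [gr0 grS] := gr_submod n; move=> an.
have grZ c b : b \in gr n -> c *: b \in gr n by move=> bn; rewrite -[_ *: _]addr0 grS.
apply: (grZ); apply: (big_ind (fun b => b \in gr n)) => // [b c bn cn|h _].
  by rewrite -[b]scale1r grS.
by apply/grZ/act_gr.
Qed.

Lemma untwist_gr n b x y : b \in gr n -> untwist b x y \in gr n.
Proof.
have [gr0 grS] := gr_submod n; move=> bn.
by rewrite -[untwist _ _ _]addr0 grS// proj_gr.
Qed.

Lemma retwist_gr n a x y : a \in gr n -> (retwist a x y : A) \in gr n.
Proof.
have [gr0 grS] := gr_submod n; move=> an.
by rewrite -[(retwist _ _ _ : A)]addr0 grS// proj_gr.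
Qed.

End Grading.

Lemma twist_connected (gr : nat -> {pred A}) :
  (forall g n a, a \in gr n -> act g a \in gr n) ->
  connected_graded gr -> connected_graded (gr : nat -> {pred B}).
Proof.
move=> act_gr [[grS gr1 grM grD grI] gr0 grF]; split=> //; split=> //.
move=> m n a b am bn; have [gr_0 gr_S] := grS (m + n)%N.
rewrite -[a * b]/(twist_mul act chi mu a b).
have grA : forall u v : A, u \in gr (m + n)%N -> v \in gr (m + n)%N -> u + v \in gr (m + n)%N.
  by move=> u v um vn; rewrite -[u]scale1r gr_S.
apply: (big_ind (fun b => b \in gr (m + n)%N)) => // g _.
apply: (big_ind (fun b => b \in gr (m + n)%N)) => // h _.
by rewrite -[_ *: _]addr0 gr_S// grM// proj_gr.
Qed.

End CocycleTwist.

Definition mklrm (k : fieldType) (A T : algType k) (f : A -> T) (fl : linear f)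
    (fm : monoid_morphism f) : {lrmorphism A -> T} :=
  HB.pack f (GRing.isLinear.Build k A T *:%R f fl)
    (GRing.isMonoidMorphism.Build A T f fm).

Lemma inv_cocycle (k : fieldType) (gT : finGroupType) (mu : gT -> gT -> k) :
  normalised_cocycle mu -> normalised_cocycle (fun g h => (mu g h)^-1).
Proof.
move=> [mu0 muA mu1]; split=> [g h|g h l|g]; first by rewrite invr_eq0.
  by rewrite -!invfM muA.
by have [-> ->] := mu1 g; rewrite invr1.
Qed.

(** * Twisting back a tensor product *)

Section TensorTwist.
Variables (k : fieldType) (gT : finGroupType) (A : algType k).
Variables (act : gT -> {lrmorphism A -> A}) (chi mu : gT -> gT -> k).
Hypotheses (cardG : [pchar k]^'.-nat #|gT|) (actP : is_algebra_action act).
Hypotheses (chiP : is_dual_iso chi) (muP : normalised_cocycle mu).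

Local Notation proj := (isotypic_proj act chi).
Local Notation B := (cocycle_twist cardG actP chiP muP : algType k).

Variables (C : comAlgType k) (T : algType k).
Variables (f : {lrmorphism B -> T}) (g : {lrmorphism C -> T}).
Hypothesis fg : is_tensor_product f g.

Lemma tensor_ext (V : lmodType k) (h h' : {linear T -> V}) :
  (forall a c, h (f a * g c) = h' (f a * g c)) -> h =1 h'.
Proof.
move=> hh'; have [_ /(_ V (fun a c => h' (f a * g c)))] := fg.
case=> [a c u v|c a u v|h0 _ h0U x].
- by rewrite linearP mulrDr -scalerAr linearP.
- by rewrite linearP mulrDl -scalerAl linearP.
- by rewrite (h0U h)// (h0U h').
Qed.

Lemma twist_act_mul x (a b : B) :
  (act x (a * b : B) : B) = (act x a : B) * (act x b : B).
Proof.
rewrite -[a * b]/(twist_mul act chi mu a b) -[RHS]/(twist_mul act chi mu (act x a) (act x b)).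
rewrite /twist_mul linear_sum; apply: eq_bigr => y _ /=.
rewrite linear_sum; apply: eq_bigr => z _ /=.
by rewrite linearZ_LR rmorphM /= !(act_proj cardG actP chiP).
Qed.

Lemma tensor_act_exists x : exists h : {linear T -> T},
  forall a c, h (f a * g c) = f (act x a : B) * g c.
Proof.
have [_ /(_ T (fun a c => f (act x a : B) * g c))] := fg.
case=> [a c u v|c a u v|h hE _]; last by exists h.
  by rewrite linearP mulrDr -scalerAr.
have -> : act x (a *: u + v : B) = a *: (act x u : B) + act x v :> B := linearP (act x) a u v.
by rewrite linearP mulrDl -scalerAl.
Qed.

(** T is known only by its universal property, so multiplicativity is checked on pure tensors, one
    variable at a time. *)
Lemma tensor_act_morph x (h : {linear T -> T}) :
  (forall a c, h (f a * g c) = f (act x a : B) * g c) -> monoid_morphism h.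
Proof.
move=> hE; have [fgC _] := fg; split.
  have -> : (1 : T) = f 1 * g 1 by rewrite !rmorph1 mulr1.
  by rewrite hE; have -> : act x (1 : B) = 1 :> B := rmorph1 (act x).
move=> u v.
have l1 w : linear (fun z => h (z * w)).
  by move=> c z z'; rewrite mulrDl -scalerAl linearP.
have l2 w : linear (fun z => h z * w).
  by move=> c z z'; rewrite linearP mulrDl -scalerAl.
have r1 w : linear (fun z => h (w * z)).
  by move=> c z z'; rewrite mulrDr -scalerAr linearP.
have r2 w : linear (fun z => w * h z).
  by move=> c z z'; rewrite linearP mulrDr -scalerAr.
apply: (@tensor_ext T (mklin (l1 v)) (mklin (l2 (h v)))) => a c /=.
apply: (@tensor_ext T (mklin (r1 _)) (mklin (r2 _))) => b d /=.
have E (a' b' : B) (c' d' : C) : f a' * g c' * (f b' * g d') = f (a' * b') * g (c' * d').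
  by rewrite !rmorphM -!mulrA; congr (_ * _); rewrite !mulrA fgC.
by rewrite E !hE E twist_act_mul.
Qed.

(** G acts on T through the factor B. Twisting T by mu^-1 undoes mu on that factor and leaves the
    invariant factor C alone, so the result is a tensor product of A and C, noetherian by
    hypothesis. A dual pair brings the property back to T. *)
Lemma strongly_noetherian_tensor : noetherian C -> strongly_noetherian A -> noetherian T.
Proof.
move=> Cnoeth [_ Asn].
have /choice[h hE] x := tensor_act_exists x.
pose actT x : {lrmorphism T -> T} := mklrm (linearP (h x)) (tensor_act_morph (hE x)).
have actTE x a c : actT x (f a * g c) = f (act x a : B) * g c := hE x a c.
have actTP : is_algebra_action actT.
  have [act1 actM] := actP; split.
    apply: (@tensor_ext T (h 1%g) idfun) => a c.
    by rewrite hE act1.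
  move=> x y; apply: (@tensor_ext T (h (x * y)%g) (h y \o h x)) => a c.
  by rewrite /= !hE actM.
have muVP := inv_cocycle muP.
pose T' : algType k := cocycle_twist cardG actTP chiP muVP.
suff T'noeth : noetherian T'.
  exact: (noetherian_mx (1%g : gT) (retwist_untwist cardG actTP chiP muVP) T'noeth).
have actf x a : actT x (f a) = f (act x a : B).
  by rewrite -[f a]mulr1 -(rmorph1 g) actTE rmorph1 mulr1.
have actg x c : actT x (g c) = g c.
  rewrite -[g c]mul1r -(rmorph1 f) actTE.
  by have -> : act x (1 : B) = 1 :> B := rmorph1 (act x).
have fin x (a : A) : a \in isotypic act chi x -> f (a : B) \in isotypic actT chi x.
  by move=> /isotypicP aE; apply/isotypicP => y; rewrite actf aE linearZ_LR.
have gin c : g c \in isotypic actT chi 1%g.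
  apply/isotypicP => y; rewrite actg.
  have /isotypicP/(_ y) := isotypic1 actT chiP; rewrite rmorph1 => E.
  by rewrite -[g c]mulr1 {1}E -scalerAr.
have mulTE x y u v : u \in isotypic actT chi x -> v \in isotypic actT chi y ->
    ((u : T') * (v : T') : T') = (mu x y)^-1 *: (u * v) :> T.
  exact: twist_mulE.
have fS (F : gT -> A) : f (\sum_x F x : A) = \sum_x f (F x : B) :> T := raddf_sum f _ _ F.
have projS (a : A) : \sum_x proj x a = a := isotypic_sum cardG actP chiP a.
have projI x a : proj x a \in isotypic act chi x := isotypic_proj_in actP chiP x a.
(* The factor mu(x, y) from the product of B cancels its inverse from the product of T'. *)
have fmul x y (u v : A) : u \in isotypic act chi x -> v \in isotypic act chi y ->
    f (u * v : A) = (f (u : B) : T') * (f (v : B) : T') :> T.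
  move=> ux vy; rewrite (mulTE _ _ _ _ (fin _ _ ux) (fin _ _ vy)) -rmorphM.
  have -> : (u : B) * (v : B) = mu x y *: (u * v : A) :> A.
    exact: (twist_mulE mu cardG chiP ux vy).
  rewrite [X in _ *: X](linearZ_LR f (mu x y) (u * v : A)).
  by rewrite scalerA mulVf ?scale1r//; case: muP.
have f'M : monoid_morphism (f : A -> T').
  split=> [|a b]; first exact: (rmorph1 f).
  rewrite -{1}(projS a) mulr_suml fS.
  have -> : (f (a : B) : T') = \sum_x (f (proj x a : B) : T') by rewrite -{1}(projS a) fS.
  rewrite mulr_suml; apply: eq_bigr => x _.
  have -> : (f (b : B) : T') = \sum_y (f (proj y b : B) : T') by rewrite -{1}(projS b) fS.
  rewrite mulr_sumr -{1}(projS b) mulr_sumr fS; apply: eq_bigr => y _.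
  exact: fmul (projI _ _) (projI _ _).
have g'M : monoid_morphism (g : C -> T').
  split=> [|c d]; first exact: (rmorph1 g).
  rewrite rmorphM; symmetry.
  exact: (twist_mul_inv_r cardG actTP chiP muVP (g c) (gin d)).
pose f' : {lrmorphism A -> T'} := mklrm (linearP f : linear (f : A -> T')) f'M.
pose g' : {lrmorphism C -> T'} := mklrm (linearP g : linear (g : C -> T')) g'M.
have fgE a c : f' a * g' c = f (a : B) * g c :> T.
  exact: (twist_mul_inv_r cardG actTP chiP muVP (f (a : B)) (gin c)).
(* T and T' share their vector space and, by [fgE], their pure tensors, so the universal property
   carries over. *)
apply: (Asn C Cnoeth T' f' g'); have [fgC fgU] := fg; split=> [a c|V phi pl pr].
  rewrite fgE fgC; symmetry.
  exact: (twist_mul_inv_l cardG actTP chiP muVP (f (a : B)) (gin c)).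
have [h0 h0E h0U] := fgU V phi pl pr.
exists h0 => [a c|h' h'E]; first by rewrite fgE h0E.
apply: h0U => a c; have := h'E a c; rewrite fgE; exact.
Qed.
End TensorTwist.

Theorem theorem1p2 (R : realType) (k : closedFieldType) (gT : finGroupType)
    (Gab : abelian [set: gT]) (cardG : [pchar k]^'.-nat #|gT|)
    (A : algType k) (gr : nat -> {pred A})
    (Anoeth : noetherian A) (Aconn : connected_graded gr)
    (act : gT -> {lrmorphism A -> A}) (actP : is_algebra_action act)
    (act_gr : forall g n a, a \in gr n -> act g a \in gr n)
    (chi : gT -> gT -> k) (chiP : is_dual_iso chi)
    (mu : gT -> gT -> k) (muP : normalised_cocycle mu) :
  let B : algType k := cocycle_twist cardG actP chiP muP in
  let grB : nat -> {pred B} := gr in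
  [/\ strongly_noetherian A -> strongly_noetherian B,
      forall d : nat, AS_regular R gr d -> AS_regular R grB d,
      Koszul gr -> Koszul grB,
      Auslander_regular R A -> Auslander_regular R B
    & Cohen_Macaulay R A -> Cohen_Macaulay R B].
Proof.
move=> B grB.
have rs := untwist_retwist cardG actP chiP muP.
have sr := retwist_untwist cardG actP chiP muP.
have rk := @untwistZ _ _ _ _ _ _ cardG actP chiP muP.
have sk := @retwistZ _ _ _ _ _ _ cardG actP chiP muP.
have card0 : #|gT|%:R != 0 :> k by rewrite natf_neq0_pchar.
have Bconn : connected_graded grB by exact: twist_connected.
have [[gr_submod _ _ _ _] _ _] := Aconn.
have r_gr := @untwist_gr _ _ _ _ _ _ cardG actP chiP muP gr act_gr gr_submod.
have s_gr := @retwist_gr _ _ _ _ _ _ cardG actP chiP muP gr act_gr gr_submod.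
split.
- move=> Asn; split; first exact: (noetherian_mx (1%g : gT) rs).
  by move=> C Cnoeth T f g fg; exact: (strongly_noetherian_tensor fg).
- exact: (AS_regular_mx (1%g : gT) rs sr rk sk card0 Bconn r_gr s_gr).
- exact: (Koszul_mx_dual (1%g : gT) rs sr rk sk Bconn r_gr s_gr).
- exact: (Auslander_regular_mx (1%g : gT) rs sr card0).
- exact: (Cohen_Macaulay_mx (1%g : gT) rs sr rk sk).
Qed.
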